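(* Fix $(\alpha,\beta,\theta)\in(0,1)^3$ and suppose $\alpha<\tilde\eta^{sig}_\theta(\beta)$. Consider the signal recovery problem in the ARW model with parameters $(\alpha,\beta,\theta)$. As $p\to\infty$: (i) $\mathrm{Hamm}_p(\hat S^{(sa)}_*,\alpha,\beta,\theta)\to0$ if $0<\beta<(1-\theta)/2$; (ii) $\mathrm{Hamm}_p(\hat S^{(if)}_*,\alpha,\beta,\theta)\to0$ if $(1-\theta)/2<\beta<1/2$; (iii) $\mathrm{Hamm}_p(\hat S^{(if)}_q,\alpha,\beta,\theta)\to0$ if $1/2<\beta<1$ and $q\ge3$.
   Context: ARW model. For each $p$ let $n=n_p=p^\theta$ (treated as an integer), $\epsilon_p=p^{-\beta}$, $\tau_p=p^{-\alpha}$. The labels $\ell_1,\dots,\ell_n$ are i.i.d. uniform on $\{-1,1\}$; the coordinates of $\mu\in\mathbb R^p$ are i.i.d., equal to $\tau_p$ with probability $\epsilon_p$ and to $0$ with probability $1-\epsilon_p$; $Z$ is an $n\times p$ matrix with i.i.d. $N(0,1)$ entries; $\ell,\mu,Z$ are independent. One observes $X=\ell\mu'+Z=[x_1,\dots,x_p]\in\mathbb R^{n\times p}$. The support is $S(\mu)=\{1\le j\le p:\mu(j)\ne0\}$. Signal recovery error. $\mathrm{Hamm}_p(\hat S,\alpha,\beta,\theta)=(p\epsilon_p)^{-1}E(|\hat S\,\Delta\,S(\mu)|)$, where $\Delta$ is the symmetric difference and the expectation is over $(\mu,\ell,Z)$. Methods ($\mathrm{sgn}$ acts entrywise). Let $\hat\ell^{(sa)}_*=\mathrm{sgn}(\sum_{j=1}^px_j)$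 and $\hat\ell^{(if)}_*=\mathrm{sgn}(\xi)$, where $\xi$ is the first left singular vector of $X$. Set $y^{(sa)}_*=n^{-1/2}X'\hat\ell^{(sa)}_*$ and $y^{(if)}_*=n^{-1/2}X'\hat\ell^{(if)}_*$; then $\hat S^{(sa)}_*=\{1\le j\le p:|y^{(sa)}_{*,j}|\ge\sqrt{2\log p}\}$ and $\hat S^{(if)}_*=\{1\le j\le p:|y^{(if)}_{*,j}|\ge\sqrt{2\log p}\}$. For fixed $q>0$, $\hat S^{(if)}_q=\{1\le j\le p:Q(j)\ge\sqrt{2q\log p}\}$ with $Q(j)=(2n)^{-1/2}(\|x_j\|^2-n)$. The curve: $\tilde\eta^{sig}_\theta(\beta)=\theta/2$ for $\beta\le(1-\theta)/2$, $(1+\theta-2\beta)/4$ for $(1-\theta)/2\le\beta\le1/2$, and $\theta/4$ for $\beta\ge1/2$. *)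

(* Defs.v *)
From HB Require Import structures.
From mathcomp Require Import all_boot all_order all_algebra.
From mathcomp Require Import all_classical all_reals all_analysis.
Set Implicit Arguments.
Unset Strict Implicit.
Unset Printing Implicit Defensive.
Import Order.TTheory GRing.Theory Num.Theory.
Import numFieldNormedType.Exports.
Local Open Scope classical_set_scope.
Local Open Scope ring_scope.

(* Mutual independence of a finite family of real random variables. *)
Definition mutually_independent (R : realType) (d : measure_display)
    (T : measurableType d) (P : probability T R) (I : finType)
    (X : I -> {RV P >-> R}) : Prop :=
  forall (J : {set I}) (B : I -> set R), (forall i, measurable (B i)) ->
    P [set w | forall i, i \in J -> B i (X i w)] =
    (\big[*%E/1%E]_(i in J) P (X i @^-1` B i))%E.

Section calibration.
Context (R : realType).

(* The sample size $p^\theta$ is rounded down to an integer. *)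
Definition nsamples (theta : R) (p : nat) : nat := Num.truncn (p%:R `^ theta).

Definition epsilon (beta : R) (p : nat) : R := p%:R `^ (- beta).

Definition tau (alpha : R) (p : nat) : R := p%:R `^ (- alpha).

Definition eta_sig (theta beta : R) : R :=
  if beta <= (1 - theta) / 2 then theta / 2
  else if beta <= 1 / 2 then (1 + theta - 2 * beta) / 4
  else theta / 4.

End calibration.

Section arw.
Context (R : realType) (d : measure_display) (T : measurableType d).
Context (P : probability T R) (n p : nat).

Definition arw_variable (ell : 'I_n -> {RV P >-> R})
    (mu : 'I_p -> {RV P >-> R}) (Z : 'I_n -> 'I_p -> {RV P >-> R})
    (k : 'I_n + 'I_p + 'I_n * 'I_p) : {RV P >-> R} :=
  match k with
  | inl (inl i) => ell i
  | inl (inr j) => mu j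
  | inr ij => Z ij.1 ij.2
  end.

(* Independence within and between the labels, the contrast mean vector and
   the noise is the mutual independence of all their coordinates together. *)
Record arw_model (eps t : R) (ell : 'I_n -> {RV P >-> R})
    (mu : 'I_p -> {RV P >-> R}) (Z : 'I_n -> 'I_p -> {RV P >-> R}) : Prop := {
  arw_ell_pos : forall i, P [set w | ell i w = 1] = (1 / 2)%:E;
  arw_ell_neg : forall i, P [set w | ell i w = -1] = (1 / 2)%:E;
  arw_mu_signal : forall j, P [set w | mu j w = t] = eps%:E;
  arw_mu_null : forall j, P [set w | mu j w = 0] = (1 - eps)%:E;
  arw_Z_normal : forall i j (B : set R), measurable B ->
    distribution P (Z i j) B = normal_prob 0 1 B;
  arw_indep : mutually_independent (arw_variable ell mu Z) }.

Definition arw_data (ell : 'I_n -> {RV P >-> R}) (mu : 'I_p -> {RV P >-> R})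
    (Z : 'I_n -> 'I_p -> {RV P >-> R}) (w : T) : 'M[R]_(n, p) :=
  (\col_i ell i w) *m (\row_j mu j w) + \matrix_(i, j) Z i j w.

Definition arw_support (mu : 'I_p -> {RV P >-> R}) (w : T) : {set 'I_p} :=
  [set j | mu j w != 0]%SET.

Definition hamm (eps : R) (mu : 'I_p -> {RV P >-> R})
    (S : T -> {set 'I_p}) : \bar R :=
  (((p%:R * eps)^-1)%:E *
   'E_P[fun w => (#|((S w :\: arw_support mu w) :|:
                     (arw_support mu w :\: S w))%SET|)%:R])%E.

End arw.

Section methods.
Context (R : realType) (n p : nat).
Implicit Types (X : 'M[R]_(n, p)) (xi l : 'cV[R]_n).

Definition singular_triple X (s : R) (u : 'cV[R]_n) (v : 'cV[R]_p) : Prop :=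
  [/\ 0 <= s, u^T *m u = 1%:M, v^T *m v = 1%:M,
      X *m v = s *: u & X^T *m u = s *: v].

(* Such a vector is determined at best up to its sign. *)
Definition first_left_singular_vector X (u : 'cV[R]_n) : Prop :=
  exists s v, singular_triple X s u v /\
    forall s' u' v', singular_triple X s' u' v' -> s' <= s.

Definition sgn_vec (x : 'cV[R]_n) : 'cV[R]_n := map_mx Num.sg x.

Definition label_sa X : 'cV[R]_n := sgn_vec (\sum_(j < p) col j X).

Definition label_if xi : 'cV[R]_n := sgn_vec xi.

Definition score X l : 'cV[R]_p := (Num.sqrt n%:R)^-1 *: (X^T *m l).

Definition support_of_label X l : {set 'I_p} :=
  [set j | Num.sqrt (2 * ln p%:R) <= `|score X l j 0|]%SET.

Definition support_sa X : {set 'I_p} := support_of_label X (label_sa X).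

Definition support_if xi X : {set 'I_p} := support_of_label X (label_if xi).

Definition column_stat X (j : 'I_p) : R :=
  (Num.sqrt (2 * n%:R))^-1 * (\sum_(i < n) X i j ^+ 2 - n%:R).

Definition support_q (q : R) X : {set 'I_p} :=
  [set j | Num.sqrt (2 * q * ln p%:R) <= column_stat X j]%SET.

End methods.

(* Main.v *)
Require Import Defs.
From HB Require Import structures.
From mathcomp Require Import all_boot all_order all_algebra.
From mathcomp Require Import all_classical all_reals all_analysis.
From mathcomp Require Import measurable_realfun ring lra.
Import Order.TTheory GRing.Theory Num.Theory.
Import numFieldNormedType.Exports.
Set Implicit Arguments.
Unset Strict Implicit.
Unset Printing Implicit Defensive.
Local Open Scope classical_set_scope.
Local Open Scope ring_scope.

(** All estimates take place on the space of the coordinates of (ell, mu, Z), where independence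
    means that a coordinate may be resampled without changing integrals of nonnegative functions.
    Integrating out one coordinate at a time gives Chernoff bounds for [sum_i c_i Z_i], even with
    random [c_i] that do not depend on the [Z_i], and for chi-square and Bernoulli sums.

    For (iii), a column statistic is a chi-square variable shifted by [n tau^2] plus a negligible
    cross term.  For (i) and (ii) it is enough that all labels are recovered up to a global sign,
    because the score of column [j] is then [sqrt n * mu_j] plus a standard normal term.  In (i) the
    signal [sum_j mu_j] dominates the noise of every row sum.

    In (ii), [X X'] is close in operator norm to [p I + |mu|^2 ell ell'], by a net argument for
    [Z Z'].  Entrywise control of the top eigenvector [xi] uses leave-one-out: let [v] be a
    normalised iterate of the power method for [X] with row [i] deleted.  It is independent of row
    [i] of [Z], it is almost parallel to [ell], and it nearly satisfies the eigenvalue equation, so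
    the sign of [xi_i] is read off the [i]-th entry of [X X' v].  Deterministic power iterates are
    used instead of the eigenvector of the reduced matrix because they are measurable by
    construction. *)

(** The pieces of the curve compare powers of [p], up to logarithms. With known labels a column is
    detected when [sqrt n * tau] is large, that is [alpha < theta / 2]. The singular vector aligns
    with the labels when the spike [n * |mu|^2], of order [p ^ (theta + 1 - beta - 2 * alpha)],
    exceeds the fluctuation [sqrt (n * p)] of [Z Z'], that is [alpha < (1 + theta - 2 * beta) / 4].
    A single column norm reveals a signal when [n * tau^2] exceeds [sqrt n], that is
    [alpha < theta / 4]. These inequalities are strict, which leaves polynomial room for logarithms
    and crude constants; what must be kept is a failure probability per column of order
    [o(p ^ (- beta))].

    The obstacle in (ii) is that alignment in mean square still allows a fraction of wrong signs,
    whereas here every sign must be right. As [xi] depends on all of [Z], no tail bound applies to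
    its entries directly. *)

Definition rectangles (R : realType) (I : finType) : set (set (I -> R)) :=
  [set A | exists B : I -> set R,
     (forall i, measurable (B i)) /\ A = [set v | forall i, B i (v i)]].

Notation coordsType R I := (g_sigma_algebraType (@rectangles R I)).

Definition upd (R : realType) (I : finType) (v : I -> R) (i : I) (r : R) : I -> R :=
  fun k => if k == i then r else v k.

(** * Resampling a coordinate *)

Section resampling.
Context (R : realType) (I : finType).
Local Notation V := (coordsType R I).

Lemma measurable_coord (i : I) : measurable_fun setT ((fun v => v i) : V -> R).
Proof.
move=> _ B mB; apply: sub_sigma_algebra.
exists (fun k => if k == i then B else setT); split=> [k|].
  by case: ifP.
apply/seteqP; split => v /=.
  by move=> [_ Bv] k; case: eqP => // ->.
by move=> /(_ i); rewrite eqxx.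
Qed.

Lemma measurable_rectangle (B : I -> set R) : (forall i, measurable (B i)) ->
  measurable ([set v | forall i, B i (v i)] : set V).
Proof. by move=> mB; apply: sub_sigma_algebra; exists B. Qed.

Lemma measurable_fun_coords d (T : measurableType d) (f : T -> V) :
  (forall i, measurable_fun setT (fun w => f w i)) -> measurable_fun setT f.
Proof.
move=> mf; apply: measurability => // _ [_ [B [mB ->]] <-].
rewrite setTI.
have -> : f @^-1` [set v | forall i, B i (v i)] =
    \bigcap_(i in setT) ((fun w => f w i) @^-1` B i).
  by apply/seteqP; split => [w h i _|w h i]; [exact: h|exact: h i Logic.I].
apply: fin_bigcap_measurable => // i _.
by rewrite -[X in measurable X]setTI; exact: mf.
Qed.

Lemma measurable_upd (i : I) :
  measurable_fun setT ((fun vr => upd vr.1 i vr.2) : V * measurableTypeR R -> V).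
Proof.
apply: measurable_fun_coords => k; rewrite /upd.
case: eqP => _; first exact: measurable_snd.
exact: (measurableT_comp (measurable_coord k) measurable_fst).
Qed.

(* Coordinate [i] has law [L] and is independent of the other ones. *)
Definition resamples (Q : probability V R) (i : I) (L : probability (measurableTypeR R) R) :=
  forall B : I -> set R, (forall k, measurable (B k)) ->
    Q [set v : V | forall k, B k (v k)] =
    (Q [set v : V | forall k, (k != i) -> B k (v k)] * L (B i))%E.

Variables (Q : probability V R) (i : I) (L : probability (measurableTypeR R) R).
Hypothesis QL : resamples Q i L.

(** Updating coordinate [i] by an independent draw from [L] maps the product measure to a measure
    that agrees with [Q] on rectangles. These form a pi-system generating the sigma-algebra, so the
    two measures are equal, and Tonelli's theorem gives the iterated integral. *)
Lemma integral_resample (F : V -> \bar R) :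
  measurable_fun setT F -> (forall v, 0 <= F v)%E ->
  (\int[Q]_v F v = \int[Q]_v \int[L]_r F (upd v i r))%E.
Proof.
move=> mF F0.
pose phi : V * measurableTypeR R -> V := fun vr => upd vr.1 i vr.2.
have mphi : measurable_fun setT phi := measurable_upd i.
pose mphi_pack : {mfun (V * measurableTypeR R)%type >-> V} :=
  HB.pack phi (isMeasurableFun.Build _ _ _ _ _ mphi).
have mupd : measurable_fun setT (F \o phi) by exact: measurableT_comp.
have -> : (\int[Q]_v \int[L]_r F (upd v i r))%E =
    (\int[Q \x L]_z (F \o phi) z)%E.
  by rewrite fubini_tonelli1//= => z; exact: F0.
transitivity (\int[pushforward (Q \x L)%E mphi_pack]_v F v)%E; last first.
  by rewrite ge0_integral_pushforward.
apply: eq_measure_integral => A mA _.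
apply: (@g_sigma_algebra_measure_unique _ R V (@rectangles R I) _ (fun=> setT)) => //.
- by move=> _ [B [mB ->]]; exact: measurable_rectangle.
- move=> _; exists (fun=> setT); split=> //.
  by apply/seteqP; split.
- by apply/seteqP; split => // v _; exists 0%N.
- move=> _ _ [B [mB ->]] [C [mC ->]]; exists (fun k => B k `&` C k); split.
    by move=> k; exact: measurableI.
  apply/seteqP; split => v /=; first by move=> [h1 h2] k; split.
  by move=> h; split => k; have [] := h k.
- move=> _ [B [mB ->]]; rewrite -[LHS]/(Q [set v : V | forall k, B k (v k)]) (QL mB).
  rewrite [RHS](_ : _ = (Q \x L)%E
      ([set v : V | forall k, (k != i) -> B k (v k)] `*` B i)); last first.
    rewrite /pushforward; congr ((Q \x L)%E _).
    apply/seteqP; split => -[v r] /=; rewrite /phi/upd/=.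
      move=> h; split; last by have := h i; rewrite eqxx.
      by move=> k ki; have := h k; rewrite (negbTE ki).
    by move=> [h Bi] k; case: eqP => [->//|/eqP ki]; exact: h.
  rewrite product_measure1E; [by []| |exact: (mB i)].
  rewrite [X in measurable X](_ : _ =
      [set v : V | forall k, (if k == i then setT else B k) (v k)]).
    by apply: (@measurable_rectangle (fun k => if k == i then setT else B k)) => k; case: ifP.
  apply/seteqP; split => v /= h k; first by case: eqP => // /eqP; exact: h.
  by move=> ki; have := h k; rewrite (negbTE ki).
- by move=> _; rewrite [X in (X < _)%E](_ : _ = 1%E) ?ltry//; exact: probability_setT.
Qed.

End resampling.

(** * Gaussian integrals and tail bounds *)

Section normal_integral.
Context (R : realType).
Local Notation mu := (@lebesgue_measure R).
Import HBNNSimple.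

(** [normal_prob] is defined on sets by integrating the density; the formula passes from indicators
    to simple functions and then to monotone limits. *)
Lemma ge0_integral_normal_prob (m s : R) (f : measurableTypeR R -> \bar R) :
  measurable_fun setT f -> (forall x, 0 <= f x)%E ->
  (\int[normal_prob m s]_x f x = \int[mu]_x (f x * (normal_pdf m s x)%:E))%E.
Proof.
move=> mf f0.
have pdf0 x : (0 <= (normal_pdf m s x)%:E)%E by rewrite lee_fin normal_pdf_ge0.
have mpdf : measurable_fun setT (fun x => (normal_pdf m s x)%:E).
  by apply/measurable_EFinP; exact: measurable_normal_pdf.
have sfun (g : {nnsfun (measurableTypeR R) >-> R}) : (\int[normal_prob m s]_x (g x)%:E =
    \int[mu]_x ((g x)%:E * (normal_pdf m s x)%:E))%E.
  under [LHS]eq_integral do rewrite fimfunE -fsumEFin//.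
  rewrite [LHS]ge0_integral_fsum//; last 2 first.
  - by move=> r; exact/measurable_EFinP/measurableT_comp.
  - by move=> n x _; rewrite EFinM nnfun_muleindic_ge0.
  under [RHS]eq_integral.
    move=> x xD; rewrite fimfunE -fsumEFin// muleC ge0_mule_fsumr; last first.
      by move=> r; rewrite EFinM nnfun_muleindic_ge0.
    over.
  rewrite [RHS]ge0_integral_fsum//; last 2 first.
  - move=> r; apply: emeasurable_funM => //.
    exact/measurable_EFinP/measurableT_comp.
  - by move=> n x _; rewrite EFinM mule_ge0// nnfun_muleindic_ge0.
  apply: eq_fsbigr => r _.
  have [r0|r0] := ltP r 0.
    rewrite (preimage_nnfun0 g r0).
    rewrite [LHS]integral0_eq ?[RHS]integral0_eq// => x _; by
      rewrite indicE in_set0 mulr0 ?mule0.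
  rewrite integralZl_indic_nnsfun//= integral_indic//= setIT.
  rewrite /normal_prob integral_mkcond -ge0_integralZl//=.
  - apply: eq_integral => x _; rewrite patchE indicE EFinM.
    by case: (_ \in _); rewrite ?mul1e ?mule1 ?mule0// muleC.
  - by apply/(measurable_restrictT _ _).1 => //; exact: measurable_funTS.
  - by move=> x _; apply: erestrict_ge0.
pose f_ := nnsfun_approx measurableT mf.
transitivity (lim (\int[normal_prob m s]_x (f_ n x)%:E @[n --> \oo])%E).
  rewrite -monotone_convergence//=.
  - apply: eq_integral => ? /[!inE] xD; apply/esym/cvg_lim => //=.
    exact: cvg_nnsfun_approx.
  - by move=> n; exact/measurable_EFinP/measurable_funTS.
  - by move=> n ? _; rewrite lee_fin.
  - by move=> ? _ ? ? mn; rewrite lee_fin; exact/lefP/nd_nnsfun_approx.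
under eq_fun do rewrite sfun.
rewrite -monotone_convergence//=.
- apply: eq_integral => x /[!inE] xD; apply/cvg_lim => //=.
  apply: cvgeZr => //; exact: cvg_nnsfun_approx.
- move=> n; apply: emeasurable_funM => //.
  exact/measurable_EFinP/measurable_funTS.
- by move=> n ? _; rewrite mule_ge0// lee_fin.
- move=> x _ ? ? mn; apply: lee_wpmul2r => //.
  rewrite lee_fin; exact/lefP/nd_nnsfun_approx.
Qed.

(** Completing the square: with [v = 1 - 2 * u], the integrand times the standard density is a
    constant times the normal density of mean [b / v] and variance [1 / v]. *)
Lemma integral_normal_expR_quad (u b c : R) : 2 * u < 1 ->
  (\int[normal_prob 0 1]_r (expR (u * r ^+ 2 + b * r + c))%:E =
   ((Num.sqrt (1 - 2 * u))^-1 * expR (c + b ^+ 2 / (2 * (1 - 2 * u))))%:E)%E.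
Proof.
move=> u1; set v := 1 - 2 * u.
have v0 : 0 < v by rewrite subr_gt0.
pose s := (Num.sqrt v)^-1.
have s0 : 0 < s by rewrite invr_gt0 sqrtr_gt0.
have s2 : s ^+ 2 = v^-1 by rewrite exprVn sqr_sqrtr// ltW.
pose K := s * expR (c + b ^+ 2 / (2 * v)).
have K0 : 0 <= K by rewrite mulr_ge0 ?expR_ge0// ltW.
rewrite ge0_integral_normal_prob; last 2 first.
- apply/measurable_EFinP; apply: measurableT_comp => //.
  by apply: measurable_funD => //; apply: measurable_funD => //; apply: measurable_funM.
- by move=> r; rewrite lee_fin expR_ge0.
under eq_integral => r _.
  rewrite -EFinM (_ : _ * _ = K * normal_pdf (b / v) s r); last first.
    rewrite !normal_pdfE ?oner_neq0 ?gt_eqF// /normal_peak /normal_fun.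
    rewrite [in RHS]s2 /K !expr1n.
    rewrite (_ : Num.sqrt (v^-1 * pi *+ 2) = s * Num.sqrt (1 * pi *+ 2)); last first.
      by rewrite -mulrnAr mul1r sqrtrM ?invr_ge0 ?ltW// sqrtrV// ltW.
    rewrite [(s * _)^-1]invfM; set N := (Num.sqrt (1 * _ *+ _))^-1; set eC := expR (c + _).
    set A := expR (_ + _ + c); set B := expR _; set D := expR _.
    have h : A * B = eC * D.
      rewrite -!expRD; congr expR; rewrite /v; field.
      by rewrite -/v gt_eqF.
    transitivity (N * (A * B)); first by ring.
    by rewrite h; field; rewrite gt_eqF.
  rewrite EFinM; over.
rewrite ge0_integralZl//; last first.
  - by move=> r _; rewrite lee_fin normal_pdf_ge0.
  - by apply/measurable_EFinP; exact: measurable_normal_pdf.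
by rewrite integral_normal_pdf mule1.
Qed.

End normal_integral.

(** Pointwise counterpart of independence: a function that does not read coordinate [i] is unchanged
    when that coordinate is resampled. It is checked by computation, without sub-sigma-algebras. *)
Definition free_of (R : realType) (I : finType) (A : Type) (i : I)
  (f : (I -> R) -> A) := forall v r, f (upd v i r) = f v.

Section elimination.
Context (R : realType) (I : finType).
Local Notation V := (coordsType R I).
Implicit Types (Q : probability V R) (F g c : V -> R) (i : I) (s : seq I).

Lemma free_ofM i (f g : V -> R) :
  free_of i f -> free_of i g -> free_of i (fun v => f v * g v).
Proof. by move=> hf hg v r; rewrite hf hg. Qed.

Lemma free_of_comp (A B : Type) i (h : A -> B) (f : V -> A) :
  free_of i f -> free_of i (fun v => h (f v)).
Proof. by move=> hf v r; rewrite hf. Qed.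

Lemma free_of_coord i k : k != i -> free_of i (fun v : V => v k).
Proof. by move=> ki v r; rewrite /upd (negbTE ki). Qed.

Lemma free_of_sum (J : eqType) (t : seq J) i (f : J -> V -> R) :
  (forall j, j \in t -> free_of i (f j)) ->
  free_of i (fun v => \sum_(j <- t) f j v).
Proof.
by move=> hf v r; apply: eq_big_seq => j jt; rewrite hf.
Qed.

(** [c] acts as the conditional expectation of [g] given the coordinates other than [i], and [F]
    factors out because it does not read [i]. *)
Lemma integral_mul_resample Q i (L : probability (measurableTypeR R) R) F g c :
  resamples Q i L ->
  measurable_fun setT F -> measurable_fun setT g ->
  (forall v, 0 <= F v) -> (forall v, 0 <= g v) -> free_of i F ->
  (forall v, \int[L]_r (g (upd v i r))%:E = (c v)%:E)%E ->
  (\int[Q]_v (F v * g v)%:E = \int[Q]_v (F v * c v)%:E)%E.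
Proof.
move=> QL mF mg F0 g0 iF gc.
rewrite (integral_resample QL); last 2 first.
- by apply/measurable_EFinP; exact: measurable_funM.
- by move=> v; rewrite lee_fin mulr_ge0.
apply: eq_integral => v _.
under eq_integral do rewrite iF EFinM.
rewrite ge0_integralZl//= ?lee_fin// ?gc//; last first.
  by move=> r _; rewrite lee_fin.
apply/measurable_EFinP; apply: (measurableT_comp mg).
apply: measurable_fun_coords => k; rewrite /upd.
by case: eqP => _; [exact: measurable_id|exact: measurable_cst].
Qed.

Definition gaussian Q i := resamples Q i ((@normal_prob R 0 1)).

Lemma integral_expR_linear Q s (c : I -> V -> R) F :
  uniq s -> (forall i, i \in s -> gaussian Q i) ->
  (forall i, i \in s -> measurable_fun setT (c i)) ->
  (forall i k, i \in s -> k \in s -> free_of i (c k)) ->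
  measurable_fun setT F -> (forall v, 0 <= F v) ->
  (forall i, i \in s -> free_of i F) ->
  (\int[Q]_v (F v * expR (\sum_(i <- s) c i v * v i))%:E =
   \int[Q]_v (F v * expR (\sum_(i <- s) c i v ^+ 2 / 2))%:E)%E.
Proof.
elim: s F => [|i s IHs] F /= us Gs mc fc mF F0 fF.
  by under eq_integral do rewrite big_nil; under [RHS]eq_integral do rewrite big_nil.
move/andP: us => [/negP is_ us].
have insub k : k \in s -> k \in i :: s by move=> ks; rewrite inE ks orbT.
have mcs : measurable_fun setT (fun v : V => \sum_(k <- s) c k v * v k).
  have -> : (fun v : V => \sum_(k <- s) c k v * v k) =
      (fun v : V => \sum_(k <- s) (if k \in s then c k v else 0) * v k).
    by apply/funext => v; apply: eq_big_seq => k ->.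
  apply: measurable_sum => k; case: (boolP (k \in s)) => ks.
    by apply: measurable_funM; [exact: (mc k (insub _ ks))|exact: measurable_coord].
  by apply: measurable_funM; [exact: measurable_cst|exact: measurable_coord].
transitivity (\int[Q]_v (F v * expR (\sum_(k <- s) c k v * v k) *
    expR (c i v * v i))%:E)%E.
  by apply: eq_integral => v _; rewrite big_cons expRD -mulrA (mulrC (expR _)).
rewrite (@integral_mul_resample Q i ((@normal_prob R 0 1))
  (fun v => F v * expR (\sum_(k <- s) c k v * v k)) (fun v => expR (c i v * v i))
  (fun v => expR (c i v ^+ 2 / 2))); first 1 last.
- by apply: Gs; rewrite mem_head.
- by apply: measurable_funM => //; exact: measurableT_comp.
- apply: measurableT_comp => //; apply: measurable_funM; last exact: measurable_coord.
  by apply: mc; rewrite mem_head.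
- by move=> v; rewrite mulr_ge0 ?expR_ge0.
- by move=> v; exact: expR_ge0.
- apply: free_ofM; first by apply: fF; rewrite mem_head.
  apply: free_of_comp; apply: free_of_sum => k ks; apply: free_ofM.
    by apply: fc; rewrite ?mem_head ?insub.
  by apply: free_of_coord; apply/eqP => ki; rewrite -ki in is_.
- move=> v; under eq_integral => r _.
    rewrite (fc i i) ?mem_head// /upd eqxx.
    rewrite (_ : _ * r = 0 * r ^+ 2 + c i v * r + 0); last by ring.
    over.
  rewrite integral_normal_expR_quad; last by rewrite mulr0 ltr01.
  by rewrite mulr0 subr0 sqrtr1 invr1 mul1r add0r mulr1.
transitivity (\int[Q]_v (F v * expR (c i v ^+ 2 / 2) *
    expR (\sum_(k <- s) c k v * v k))%:E)%E.
  by apply: eq_integral => v _; rewrite -!mulrA (mulrC (expR (\sum_(_ <- _) _))).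
rewrite (IHs (fun v => F v * expR (c i v ^+ 2 / 2)))//.
- by apply: eq_integral => v _; rewrite big_cons expRD mulrA.
- by move=> k /insub; exact: Gs.
- by move=> k /insub; exact: mc.
- by move=> k l /insub ks /insub ls; exact: fc.
- apply: measurable_funM => //; apply: measurableT_comp => //.
  apply: measurable_funM => //; apply: measurable_funX.
  by apply: mc; rewrite mem_head.
- by move=> v; rewrite mulr_ge0 ?expR_ge0.
- move=> k ks; apply: free_ofM; first exact: (fF k (insub _ ks)).
  apply: (@free_of_comp _ _ k (fun x => expR (x ^+ 2 / 2)) (c i)); apply: fc; rewrite ?mem_head//.
  exact: insub.
Qed.

(** Integrating out [v i] turns [h] into [h / (1 - 2 * h * c i ^ 2)], so the induction is over all
    [h]; the square-root factors of the successive steps telescope. *)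
Lemma integral_expR_square Q s (c : I -> R) (h : R) (a F : V -> R) :
  uniq s -> (forall i, i \in s -> gaussian Q i) ->
  2 * h * (\sum_(i <- s) c i ^+ 2) < 1 ->
  measurable_fun setT a -> (forall i, i \in s -> free_of i a) ->
  measurable_fun setT F -> (forall v, 0 <= F v) ->
  (forall i, i \in s -> free_of i F) ->
  (\int[Q]_v (F v * expR (h * (a v + \sum_(i <- s) c i * v i) ^+ 2))%:E =
   ((Num.sqrt (1 - 2 * h * (\sum_(i <- s) c i ^+ 2)))^-1)%:E *
   \int[Q]_v (F v * expR (h / (1 - 2 * h * (\sum_(i <- s) c i ^+ 2)) * a v ^+ 2))%:E)%E.
Proof.
elim: s h a F => [|i s IHs] h a F /= us Gs h1 ma fa mF F0 fF.
  rewrite !big_nil mulr0 subr0 sqrtr1 invr1 mul1e mulr1.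
  by under eq_integral do rewrite big_nil addr0.
move/andP: us => [/negP is_ us].
have insub k : k \in s -> k \in i :: s by move=> ks; rewrite inE ks orbT.
have mcs : measurable_fun setT (fun v : V => \sum_(k <- s) c k * v k).
  apply: measurable_sum => k.
  by apply: measurable_funM; [exact: measurable_cst|exact: measurable_coord].
have S0 : 0 <= \sum_(k <- s) c k ^+ 2 by apply: sumr_ge0 => k _; exact: sqr_ge0.
move: h1; rewrite big_cons; set S := \sum_(k <- s) _ in S0 *; move=> h1.
have u1 : 2 * (h * c i ^+ 2) < 1.
  have [h0|h0] := leP 0 h.
    apply: le_lt_trans h1; rewrite mulrDr mulrA lerDl.
    by rewrite mulr_ge0// mulr_ge0.
  apply: le_lt_trans ltr01; rewrite pmulr_rle0// nmulr_rle0 ?sqr_ge0//.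
set w := 1 - 2 * (h * c i ^+ 2).
have w0 : 0 < w by rewrite subr_gt0.
transitivity (\int[Q]_v (F v * expR (h * (a v + \sum_(k <- s) c k * v k + c i * v i) ^+ 2))%:E)%E.
  by apply: eq_integral => v _; rewrite big_cons (addrC (c i * v i)) addrA.
rewrite (@integral_mul_resample Q i ((@normal_prob R 0 1)) F
  (fun v => expR (h * (a v + \sum_(k <- s) c k * v k + c i * v i) ^+ 2))
  (fun v => (Num.sqrt w)^-1 * expR (h / w * (a v + \sum_(k <- s) c k * v k) ^+ 2)));
  first 1 last.
- by apply: Gs; rewrite mem_head.
- exact: mF.
- apply: measurableT_comp => //; apply: measurable_funM => //; apply: measurable_funX.
  apply: measurable_funD; first exact: measurable_funD.
  by apply: measurable_funM; [exact: measurable_cst|exact: measurable_coord].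
- exact: F0.
- by move=> v; exact: expR_ge0.
- by apply: fF; rewrite mem_head.
- move=> v; set A := a v + \sum_(k <- s) c k * v k.
  have fA r : a (upd v i r) + \sum_(k <- s) c k * upd v i r k = A.
    rewrite fa ?mem_head//; congr (_ + _); apply: eq_big_seq => k ks.
    by rewrite free_of_coord//; apply/eqP => ki; rewrite -ki in is_.
  under eq_integral => r _.
    rewrite fA {1}/upd eqxx.
    rewrite (_ : h * _ = (h * c i ^+ 2) * r ^+ 2 + (2 * h * A * c i) * r + h * A ^+ 2); last by ring.
    over.
  rewrite integral_normal_expR_quad//; congr ((_ * expR _)%:E).
  by rewrite -/w /w; field; rewrite -/w gt_eqF.
transitivity ((Num.sqrt w)^-1%:E * \int[Q]_v
    (F v * expR (h / w * (a v + \sum_(k <- s) c k * v k) ^+ 2))%:E)%E.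
  rewrite -ge0_integralZl//=.
  - by apply: eq_integral => v _; rewrite -EFinM; congr EFin; ring.
  - apply/measurable_EFinP; apply: measurable_funM => //.
    apply: measurableT_comp => //; apply: measurable_funM => //; apply: measurable_funX.
    exact: measurable_funD.
  - by move=> v _; rewrite lee_fin mulr_ge0 ?expR_ge0.
have hw : 2 * (h / w) * S < 1.
  by rewrite -mulrA mulrAC mulrA ltr_pdivrMr// mul1r /w; move: h1; nra.
have ww : 1 - 2 * (h / w) * S = (1 - 2 * h * (c i ^+ 2 + S)) / w.
  by rewrite /w; field; rewrite -/w gt_eqF.
have W0 : 0 < 1 - 2 * h * (c i ^+ 2 + S) by rewrite subr_gt0.
rewrite (IHs (h / w))//.
- rewrite muleA -EFinM -/S ww; congr ((_)%:E * _)%E.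
    rewrite sqrtrM ?ltW// sqrtrV ?ltW// invfM invrK mulrC mulfK//.
    by rewrite gt_eqF// sqrtr_gt0.
  by rewrite invfM invrK mulrACA mulVf ?mulr1// gt_eqF.
- by move=> k /insub; exact: Gs.
- by move=> k /insub; exact: fa.
- by move=> k /insub; exact: fF.
Qed.

End elimination.

(** * Chernoff bounds for Gaussian, chi-square and Bernoulli sums *)

Section tails.
Context (R : realType) (I : finType).
Local Notation V := (coordsType R I).
Implicit Types (Q : probability V R) (F g c : V -> R) (i : I) (s : seq I).

Lemma measure_le_integral Q (A : set V) (f : V -> R) :
  measurable A -> measurable_fun setT f -> (forall v, 0 <= f v) ->
  (forall v, A v -> 1 <= f v) -> (Q A <= \int[Q]_v (f v)%:E)%E.
Proof.
move=> mA mf f0 fA.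
rewrite -[A in X in (X <= _)%E]setIT -(integral_indic Q measurableT mA).
apply: ge0_le_integral => //.
- by apply/measurable_EFinP; exact: measurable_indic.
- exact/measurable_EFinP.
- move=> v _; rewrite lee_fin indicE; case: (boolP (v \in A)) => // vA.
  by apply: fA; move: vA; rewrite inE.
Qed.

Lemma measurable_ler_fun (f g : V -> R) :
  measurable_fun setT f -> measurable_fun setT g ->
  measurable [set v | f v <= g v].
Proof.
move=> mf mg.
have -> : [set v | f v <= g v] = (fun v => g v - f v) @^-1` `[0, +oo[%classic.
  by apply/seteqP; split => v /=; rewrite in_itv/= subr_ge0 andbT.
rewrite -[X in measurable X]setTI.
by apply: (measurable_funB mg mf) => //; exact: measurable_itv.
Qed.

Lemma measurable_linear s (c : I -> V -> R) :
  (forall i, i \in s -> measurable_fun setT (c i)) ->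
  measurable_fun setT (fun v : V => \sum_(i <- s) c i v * v i).
Proof.
move=> mc.
have -> : (fun v : V => \sum_(k <- s) c k v * v k) =
    (fun v : V => \sum_(k <- s) (if k \in s then c k v else 0) * v k).
  by apply/funext => v; apply: eq_big_seq => k ->.
apply: measurable_sum => k; case: (boolP (k \in s)) => ks.
  by apply: measurable_funM; [exact: mc|exact: measurable_coord].
by apply: measurable_funM; [exact: measurable_cst|exact: measurable_coord].
Qed.

(** Chernoff bound with parameter [t], which is optimal when the coefficients have norm one. *)
Lemma gaussian_linear_tail1 Q s (c : I -> V -> R) (t : R) :
  uniq s -> (forall i, i \in s -> gaussian Q i) ->
  (forall i, i \in s -> measurable_fun setT (c i)) ->
  (forall i k, i \in s -> k \in s -> free_of i (c k)) ->
  (forall v, \sum_(i <- s) c i v ^+ 2 <= 1) -> 0 <= t ->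
  (Q [set v : V | (t <= \sum_(i <- s) c i v * v i)%R]
    <= (expR (- (t ^+ 2 / 2)))%:E)%E.
Proof.
move=> us Gs mc fc c1 t0.
pose f (v : V) := expR (- t ^+ 2) * expR (\sum_(i <- s) (t * c i v) * v i).
have mtc i : i \in s -> measurable_fun setT (fun v => t * c i v).
  by move=> si; apply: measurable_funM => //; exact: mc.
have mf : measurable_fun setT f.
  by apply: measurable_funM => //; apply: measurableT_comp => //; exact: measurable_linear.
apply: (le_trans (measure_le_integral _ _ mf _ _)).
- by apply: measurable_ler_fun => //; exact: measurable_linear.
- by move=> v; rewrite /f mulr_ge0 ?expR_ge0.
- move=> v /= tv; rewrite /f -expRD -expR0 ler_expR.
  under eq_bigr do rewrite -mulrA.
  by rewrite -mulr_sumr addrC subr_ge0 expr2 ler_wpM2l.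
rewrite (integral_expR_linear (F := fun=> expR (- t ^+ 2)) us Gs mtc)//; last first.
- by move=> i k si sk v r; rewrite fc.
apply: (@le_trans _ _ (\int[Q]_v (expR (- (t ^+ 2 / 2)))%:E)%E).
  apply: ge0_le_integral => //.
  - apply/measurable_EFinP; apply: measurable_funM => //; apply: measurableT_comp => //.
    have -> : (fun v : V => \sum_(k <- s) (t * c k v) ^+ 2 / 2) =
      (fun v : V => \sum_(k <- s) (if k \in s then t * c k v else 0) ^+ 2 / 2).
      by apply/funext => v; apply: eq_big_seq => k ->.
    apply: measurable_sum => k; apply: measurable_funM => //; apply: measurable_funX.
    by case: (boolP (k \in s)) => // ks; exact: mtc.
  - move=> v _; rewrite lee_fin -expRD ler_expR.
    under eq_bigr do rewrite exprMn -mulrA (mulrC (_ ^+ 2) 2^-1) mulrA.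
    rewrite -mulr_sumr; have := c1 v; set S := \sum_(_ <- _) _ => S1.
    have : t ^+ 2 / 2 * S <= t ^+ 2 / 2 * 1 by rewrite ler_wpM2l// divr_ge0 ?sqr_ge0.
    by lra.
by rewrite integral_cst//= probability_setT mule1.
Qed.

Lemma gaussian_linear_tail Q s (c : I -> V -> R) (t : R) :
  uniq s -> (forall i, i \in s -> gaussian Q i) ->
  (forall i, i \in s -> measurable_fun setT (c i)) ->
  (forall i k, i \in s -> k \in s -> free_of i (c k)) ->
  (forall v, \sum_(i <- s) c i v ^+ 2 <= 1) -> 0 <= t ->
  (Q [set v : V | (t <= `|\sum_(i <- s) c i v * v i|)%R]
    <= (2 * expR (- (t ^+ 2 / 2)))%:E)%E.
Proof.
move=> us Gs mc fc c1 t0.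
have mL := measurable_linear mc.
have mN i : i \in s -> measurable_fun setT (fun v => - c i v).
  by move=> si; apply: measurableT_comp => //; exact: mc.
have mLN := measurable_linear mN.
have -> : [set v : V | t <= `|\sum_(i <- s) c i v * v i|] =
    [set v : V | t <= \sum_(i <- s) c i v * v i] `|`
    [set v : V | t <= \sum_(i <- s) - c i v * v i].
  apply/seteqP; split => v /=; under [X in _ \/ _ <= X]eq_bigr do rewrite mulNr.
    by rewrite sumrN ler_normr => /orP.
  by rewrite sumrN ler_normr => /orP.
apply: le_trans (measureU2 _ _ _) _; [exact: measurable_ler_fun..|].
rewrite mulrDl mul1r EFinD; apply: leeD; first exact: gaussian_linear_tail1.
apply: gaussian_linear_tail1 => //.
- by move=> i k si sk v r; rewrite fc.
- by move=> v; under eq_bigr do rewrite sqrrN.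
Qed.

(** Blocks on disjoint coordinates with unit variance give independent chi-square variables, each
    contributing one factor. A block will be a weighted column of the noise or a single entry. *)
Lemma integral_expR_blocks Q (K : eqType) (ks : seq K) (s : K -> seq I)
    (c : I -> R) (h : R) (F : V -> R) :
  uniq ks -> (forall k, k \in ks -> uniq (s k)) ->
  (forall k i, k \in ks -> i \in s k -> gaussian Q i) ->
  (forall k k' i, k \in ks -> k' \in ks -> i \in s k -> i \in s k' -> k = k') ->
  (forall k, k \in ks -> \sum_(i <- s k) c i ^+ 2 = 1) -> 2 * h < 1 ->
  measurable_fun setT F -> (forall v, 0 <= F v) ->
  (forall k i, k \in ks -> i \in s k -> free_of i F) ->
  (\int[Q]_v (F v * expR (h * \sum_(k <- ks) (\sum_(i <- s k) c i * v i) ^+ 2))%:E =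
   ((Num.sqrt (1 - 2 * h))^-1 ^+ size ks)%:E * \int[Q]_v (F v)%:E)%E.
Proof.
elim: ks F => [|k ks IH] F /= uks us Gs ds cs h1 mF F0 fF.
  by rewrite expr0 mul1e; under eq_integral do rewrite big_nil mulr0 expR0 mulr1.
move/andP: uks => [/negP k_ks uks].
have ins l : l \in ks -> l \in k :: ks by move=> lk; rewrite inE lk orbT.
have kk : k \in k :: ks by exact: mem_head.
have msq l : measurable_fun setT (fun v : V => (\sum_(i <- s l) c i * v i) ^+ 2).
  apply: measurable_funX; apply: measurable_sum => i.
  by apply: measurable_funM; [exact: measurable_cst|exact: measurable_coord].
have msum l : measurable_fun setT
    (fun v : V => expR (h * \sum_(k <- l) (\sum_(i <- s k) c i * v i) ^+ 2)).
  by apply: measurableT_comp => //; apply: measurable_funM => //; exact: measurable_sum.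
transitivity (\int[Q]_v (F v * expR (h * \sum_(l <- ks) (\sum_(i <- s l) c i * v i) ^+ 2) *
   expR (h * ((fun=> 0) v + \sum_(i <- s k) c i * v i) ^+ 2))%:E)%E.
  by apply: eq_integral => v _; rewrite big_cons mulrDr expRD add0r -mulrA (mulrC (expR _)).
rewrite (integral_expR_square (a := fun=> 0) (us k kk))//; first last.
- move=> i si; apply: free_ofM; first exact: (fF k).
  move=> v r; congr (expR (h * _)); apply: eq_big_seq => l lk; congr (_ ^+ 2).
  apply: eq_big_seq => i' si'; congr (_ * _).
  apply: free_of_coord; apply/eqP => ii'.
  by apply: k_ks; rewrite (ds k l i)// ?ins// -ii'.
- by move=> v; rewrite mulr_ge0 ?expR_ge0.
- exact: measurable_funM.
- by rewrite cs ?mulr1.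
- by move=> i; exact: Gs.
rewrite cs// !mulr1.
under eq_integral do rewrite expr0n/= mulr0 expR0 mulr1.
rewrite IH//.
- by rewrite muleA -EFinM -exprS.
- by move=> l /ins; exact: us.
- by move=> l i /ins; exact: Gs.
- by move=> l l' i /ins ? /ins ?; exact: ds.
- by move=> l /ins; exact: cs.
- by move=> l i /ins; exact: fF.
Qed.

(* The moment generating function of a centred chi-square variable is subgaussian near [0]. *)
Lemma invsqrt_le_expR (h : R) : `|h| <= 1 / 10 ->
  (Num.sqrt (1 - 2 * h))^-1 <= expR (h + 5 / 2 * h ^+ 2).
Proof.
rewrite ler_norml => /andP[h1 h2].
have w0 : 0 < 1 - 2 * h by lra.
rewrite -(@ler_pXn2r _ 2)// ?nnegrE ?invr_ge0 ?sqrtr_ge0 ?expR_ge0//.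
rewrite exprVn sqr_sqrtr ?(ltW w0)// -expRM_natl.
have e1 : 1 + (2 * (h + 5 / 2 * h ^+ 2)) <= expR (2 * (h + 5 / 2 * h ^+ 2)) by exact: expR_ge1Dx.
rewrite -[leLHS]mul1r ler_pdivrMr//.
by nra.
Qed.

Lemma gaussian_chi2_tail Q (K : eqType) (ks : seq K) (s : K -> seq I)
    (c : I -> R) (kap : R) :
  uniq ks -> (forall k, k \in ks -> uniq (s k)) ->
  (forall k i, k \in ks -> i \in s k -> gaussian Q i) ->
  (forall k k' i, k \in ks -> k' \in ks -> i \in s k -> i \in s k' -> k = k') ->
  (forall k, k \in ks -> \sum_(i <- s k) c i ^+ 2 = 1) ->
  (0 < size ks)%N -> 0 <= kap <= (size ks)%:R / 2 ->
  (Q [set v : V | (kap <= `|\sum_(k <- ks) (\sum_(i <- s k) c i * v i) ^+ 2 - (size ks)%:R|)%R ]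
   <= (2 * expR (- (kap ^+ 2 / (10 * (size ks)%:R))))%:E)%E.
Proof.
move=> uks us Gs ds cs s0 /andP[kap0 kapm].
set m : R := (size ks)%:R in kapm *.
have m0 : 0 < m by rewrite ltr0n.
pose S (v : V) := \sum_(k <- ks) (\sum_(i <- s k) c i * v i) ^+ 2.
have mS : measurable_fun setT S.
  apply: measurable_sum => l; apply: measurable_funX; apply: measurable_sum => i.
  by apply: measurable_funM; [exact: measurable_cst|exact: measurable_coord].
(* One estimate serves both tails, the sign of [h] selecting the tail. The modulus [kap / (5 * m)]
   minimises [5 / 2 * m * h ^ 2 - |h| * kap], and [kap <= m / 2] keeps it within [1 / 10]. *)
have chernoff (h : R) : `|h| = kap / (5 * m) -> h * h * (5 * m) = `|h| * kap ->
    (Q [set v : V | (h * m + `|h| * kap <= h * S v)%R] <=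
      (expR (- (kap ^+ 2 / (10 * m))))%:E)%E.
  move=> hE h2.
  have h10 : `|h| <= 1 / 10.
    by rewrite hE ler_pdivrMr ?mulr_gt0//; move: kapm; lra.
  pose f (v : V) := expR (- (h * m + `|h| * kap)) * expR (h * S v).
  have mf : measurable_fun setT f.
    by apply: measurable_funM => //; apply: measurableT_comp => //; exact: measurable_funM.
  apply: (le_trans (measure_le_integral _ _ mf _ _)).
  - by apply: measurable_ler_fun => //; exact: measurable_funM.
  - by move=> v; rewrite /f mulr_ge0 ?expR_ge0.
  - by move=> v /= hv; rewrite /f -expRD -expR0 ler_expR addrC subr_ge0.
  rewrite (integral_expR_blocks (F := fun=> expR (- (h * m + `|h| * kap))) uks us Gs ds cs)//; last first.
  - by move: h10; rewrite ler_norml; lra.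
  rewrite integral_cst//= probability_setT mule1 -EFinM lee_fin.
  apply: (@le_trans _ _ (expR (h + 5 / 2 * h ^+ 2) ^+ size ks * expR (- (h * m + `|h| * kap)))).
    rewrite ler_wpM2r ?expR_ge0//; apply: lerXn2r; rewrite ?nnegrE ?invr_ge0 ?sqrtr_ge0 ?expR_ge0//.
    exact: invsqrt_le_expR.
  rewrite -expRM_natl -expRD ler_expR -/m.
  have -> : kap ^+ 2 / (10 * m) = `|h| * kap / 2 by rewrite hE; field; rewrite gt_eqF.
  by move: h2; rewrite expr2; lra.
pose h := kap / (5 * m).
have h0 : 0 <= h by rewrite divr_ge0// mulr_ge0// ltW.
have hm : h * h * (5 * m) = h * kap by rewrite /h; field; rewrite gt_eqF.
(* For [kap = 0] the parameter [h] vanishes and cannot be cancelled below, but the claimed bound is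
   then 2. *)
have [kap_eq0|kap_neq0] := eqVneq kap 0.
  rewrite kap_eq0 expr0n/= mul0r oppr0 expR0 mulr1.
  apply: (le_trans (probability_le1 Q _)); last by rewrite lee_fin; lra.
  apply: measurable_ler_fun => //; apply: measurableT_comp => //.
  exact: measurable_funB.
have hp : 0 < h by rewrite divr_gt0// ?mulr_gt0// lt_neqAle eq_sym kap_neq0.
apply: (@le_trans _ _ (Q ([set v : V | (h * m + `|h| * kap <= h * S v)%R] `|`
   [set v : V | (- h * m + `|- h| * kap <= - h * S v)%R]))).
  apply: le_measure; rewrite ?inE.
  - apply: measurable_ler_fun => //; apply: measurableT_comp => //.
    exact: measurable_funB.
  - by apply: measurableU; apply: measurable_ler_fun => //; exact: measurable_funM.
  move=> v /=; rewrite ler_normr normrN ger0_norm// -/(S v) => /orP[H|H].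
    by left; rewrite -mulrDr ler_pM2l//; lra.
  by right; rewrite !mulNr; have : h * kap <= h * - (S v - m); [rewrite ler_pM2l|lra].
apply: le_trans (measureU2 _ _ _) _.
- by apply: measurable_ler_fun => //; exact: measurable_funM.
- by apply: measurable_ler_fun => //; exact: measurable_funM.
rewrite mulrDl mul1r EFinD; apply: leeD; apply: chernoff; rewrite ?normrN ?ger0_norm//.
by rewrite mulrNN.
Qed.

Lemma measurable_coord_eq (t : R) i :
  measurable_fun setT (fun v : V => (v i == t)%:R : R).
Proof.
rewrite (_ : (fun v : V => _) = \1_[set t] \o (fun v : V => v i)).
  by apply: measurableT_comp; [exact: measurable_indic|exact: measurable_coord].
apply/funext => v /=; rewrite indicE; congr ((nat_of_bool _)%:R).
by apply/idP/idP; rewrite inE => /eqP.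
Qed.

(** Chernoff bound with parameter [-2]: each factor [1 - eps * (1 - exp (-2))] is at most
    [exp (- 2 * eps / 3)], and the level costs [exp (eps / 2)] per term, which leaves the rate
    [2 / 3 - 1 / 2 = 1 / 6]. *)
Lemma bernoulli_count_tail Q (s : seq I) (L : I -> probability (measurableTypeR R) R)
    (t eps : R) :
  uniq s -> (forall i, i \in s -> resamples Q i (L i)) ->
  (forall i, i \in s -> L i [set t] = eps%:E) ->
  (Q [set v : V | (\sum_(i <- s) (v i == t)%:R <= (size s)%:R * eps / 4)%R] <=
   (expR (- ((size s)%:R * eps / 6)))%:E)%E.
Proof.
move=> us Ls Lt.
have mb i := measurable_coord_eq t i.
pose y : R := expR (- 2).
have y13 : y <= 1 / 3.
  rewrite /y expRN -div1r ler_pdivrMr ?expR_gt0//.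
  by have := expR_ge1Dx (2 : R); lra.
have y0 : 0 < y by exact: expR_gt0.
have E l (F : V -> R) : {subset l <= s} -> uniq l -> measurable_fun setT F -> (forall v, 0 <= F v) ->
   (forall i, i \in l -> free_of i F) ->
  (\int[Q]_v (F v * expR (- 2 * \sum_(i <- l) (v i == t)%:R))%:E =
   ((1 - eps * (1 - y)) ^+ size l)%:E * \int[Q]_v (F v)%:E)%E.
  elim: l F => [|i l IH] F /= ls ul mF F0 fF.
    by rewrite expr0 mul1e; under eq_integral do rewrite big_nil mulr0 expR0 mulr1.
  move/andP: ul => [/negP i_l ul].
  have ins k : k \in l -> k \in i :: l by move=> kl; rewrite inE kl orbT.
  have si : i \in s by apply: ls; exact: mem_head.
  have msum : measurable_fun setT (fun v : V => expR (- 2 * \sum_(k <- l) (v k == t)%:R : R)).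
    by apply: measurableT_comp => //; apply: measurable_funM => //; exact: measurable_sum.
  transitivity (\int[Q]_v (F v * expR (- 2 * \sum_(k <- l) (v k == t)%:R) *
     expR (- 2 * (v i == t)%:R))%:E)%E.
    by apply: eq_integral => v _; rewrite big_cons mulrDr expRD -mulrA (mulrC (expR _)).
  rewrite (@integral_mul_resample _ _ Q i (L i)
    (fun v => F v * expR (- 2 * \sum_(k <- l) (v k == t)%:R))
    (fun v => expR (- 2 * (v i == t)%:R)) (fun=> 1 - eps * (1 - y))); first 1 last.
  - exact: Ls.
  - exact: measurable_funM.
  - by apply: measurableT_comp => //; exact: measurable_funM.
  - by move=> v; rewrite mulr_ge0 ?expR_ge0.
  - by move=> v; exact: expR_ge0.
  - apply: free_ofM; first by apply: fF; exact: mem_head.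
    move=> v r; congr (expR (_ * _)); apply: eq_big_seq => k kl.
    by rewrite free_of_coord//; apply/eqP => ki; rewrite ki in kl.
  - move=> v; rewrite /upd eqxx.
    (* Only the mass of [L i] at [t] is given, so the integrand is split over [[set t]] and its
       complement. *)
    transitivity (\int[L i]_r (y%:E * (\1_[set t] r)%:E + (\1_(~` [set t]) r)%:E))%E.
      apply: eq_integral => r _; rewrite -EFinM -EFinD; congr EFin.
      rewrite !indicE in_setC; have -> : (r \in [set t]) = (r == t).
        by apply/idP/idP; rewrite inE => /eqP.
      by case: eqP => _ /=; rewrite ?mulr1 ?mulr0 ?expR0 ?addr0 ?add0r.
    have mt : measurable ([set t] : set (measurableTypeR R)) by exact: measurable_set1.
    rewrite ge0_integralD//=; last first.
    - by apply/measurable_EFinP; apply: measurable_indic; exact: measurableC.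
    - by apply: measurable_funeM; apply/measurable_EFinP; exact: measurable_indic.
    - by move=> r _; rewrite -EFinM lee_fin mulr_ge0 ?(ltW y0).
    rewrite ge0_integralZl//; last 2 first.
    - by apply/measurable_EFinP; exact: measurable_indic.
    - by rewrite lee_fin ltW.
    rewrite !integral_indic//; last exact: measurableC.
    have LC : L i (~` [set t]) = (1 - eps%:E)%E by rewrite -(Lt i si); exact: probability_setC.
    transitivity (y%:E * L i [set t] + L i (~` [set t]))%E; first by rewrite !setIT.
    by rewrite LC (Lt i si) -EFinM -EFinB -EFinD; congr EFin; ring.
  transitivity (\int[Q]_v ((1 - eps * (1 - y)) * F v * expR (- 2 * \sum_(k <- l) (v k == t)%:R))%:E)%E.
    by apply: eq_integral => v _; congr EFin; ring.
  have eps1 : 0 <= 1 - eps * (1 - y).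
    have : (L i [set t] <= 1)%E by apply: probability_le1; exact: measurable_set1.
    have : (0 <= L i [set t])%E by [].
    by rewrite Lt// !lee_fin; nra.
  rewrite (IH (fun v => (1 - eps * (1 - y)) * F v))//.
  - under eq_integral do rewrite EFinM.
    rewrite ge0_integralZl//; last 2 first.
    + exact/measurable_EFinP.
    + by move=> v _; rewrite lee_fin.
    by rewrite muleA -EFinM mulrC -exprS.
  - by move=> k /ins; exact: ls.
  - exact: measurable_funM.
  - by move=> v; rewrite mulr_ge0.
  - by move=> k /ins kl v r; rewrite fF.
have [s0|s0] := posnP (size s).
  rewrite s0 mul0r mul0r mul0r oppr0 expR0; apply: probability_le1.
  by apply: measurable_ler_fun => //; exact: measurable_sum.
have eps01 : 0 <= eps <= 1.
  case: s s0 us Ls Lt {E} => // i s _ _ _ Lt.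
  have : (L i [set t] <= 1)%E by apply: probability_le1; exact: measurable_set1.
  have : (0 <= L i [set t])%E by [].
  by rewrite Lt ?mem_head// !lee_fin => -> ->.
pose m : R := (size s)%:R.
pose f (v : V) := expR (m * eps / 2) * expR (- 2 * \sum_(k <- s) (v k == t)%:R).
have mf : measurable_fun setT f.
  apply: measurable_funM => //; apply: measurableT_comp => //.
  by apply: measurable_funM => //; exact: measurable_sum.
apply: (le_trans (measure_le_integral _ _ mf _ _)).
- by apply: measurable_ler_fun => //; exact: measurable_sum.
- by move=> v; rewrite /f mulr_ge0 ?expR_ge0.
- move=> v /=; rewrite -/m /f -expRD -[X in _ -> X <= _](@expR0 R) ler_expR.
  set S := \sum_(_ <- _) _; set me := m * eps; lra.
rewrite (E s (fun=> expR (m * eps / 2)))//.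
rewrite integral_cst//= probability_setT mule1 -EFinM lee_fin.
apply: (@le_trans _ _ (expR (- (2 / 3) * eps) ^+ size s * expR (m * eps / 2))).
  rewrite ler_wpM2r ?expR_ge0//; apply: lerXn2r; rewrite ?nnegrE ?expR_ge0//.
    by move: eps01 => /andP[]; nra.
  apply: le_trans (expR_ge1Dx _); move: eps01 => /andP[]; nra.
rewrite -expRM_natl -expRD ler_expR -/m; lra.
Qed.

End tails.

(** * Singular vectors and power iteration *)

Section dot_product.
Context (R : realType).
Implicit Types n p : nat.

Definition dot n (x y : 'cV[R]_n) : R := \sum_i x i 0 * y i 0.

Lemma dotE n (x y : 'cV[R]_n) : dot x y = (x^T *m y) 0 0.
Proof. by rewrite mxE; apply: eq_bigr => i _; rewrite mxE. Qed.

Lemma dotC n (x y : 'cV[R]_n) : dot x y = dot y x.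
Proof. by apply: eq_bigr => i _; rewrite mulrC. Qed.

Lemma dotDl n (x y z : 'cV[R]_n) : dot (x + y) z = dot x z + dot y z.
Proof. by rewrite -big_split; apply: eq_bigr => i _; rewrite mxE mulrDl. Qed.

Lemma dotZl n a (x y : 'cV[R]_n) : dot (a *: x) y = a * dot x y.
Proof. by rewrite mulr_sumr; apply: eq_bigr => i _; rewrite mxE mulrA. Qed.

Lemma dotDr n (x y z : 'cV[R]_n) : dot z (x + y) = dot z x + dot z y.
Proof. by rewrite dotC dotDl !(dotC z). Qed.

Lemma dotZr n a (x y : 'cV[R]_n) : dot x (a *: y) = a * dot x y.
Proof. by rewrite dotC dotZl dotC. Qed.

Lemma dotNr n (x y : 'cV[R]_n) : dot x (- y) = - dot x y.
Proof. by rewrite -scaleN1r dotZr mulN1r. Qed.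

Lemma dotNl n (x y : 'cV[R]_n) : dot (- x) y = - dot x y.
Proof. by rewrite dotC dotNr dotC. Qed.

Lemma dotBl n (x y z : 'cV[R]_n) : dot (x - y) z = dot x z - dot y z.
Proof. by rewrite dotDl dotNl. Qed.

Lemma dotBr n (x y z : 'cV[R]_n) : dot z (x - y) = dot z x - dot z y.
Proof. by rewrite dotDr dotNr. Qed.

Lemma dot_mulmxl n p (A : 'M[R]_(n, p)) (x : 'cV[R]_p) (y : 'cV[R]_n) :
  dot (A *m x) y = dot x (A^T *m y).
Proof. by rewrite !dotE trmx_mul mulmxA. Qed.

Lemma dot_ge0 n (x : 'cV[R]_n) : 0 <= dot x x.
Proof. by apply: sumr_ge0 => i _; rewrite -expr2 sqr_ge0. Qed.

Lemma dot_eq0 n (x : 'cV[R]_n) : dot x x = 0 -> x = 0.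
Proof.
move=> /eqP; rewrite psumr_eq0; last by move=> i _; rewrite -expr2 sqr_ge0.
move=> /allP x0; apply/matrixP => i j; rewrite ord1 mxE.
by have := x0 i (mem_index_enum i); rewrite -expr2 sqrf_eq0 => /eqP.
Qed.

Lemma dot_gt0 n (x : 'cV[R]_n) : x != 0 -> 0 < dot x x.
Proof.
move=> x0; rewrite lt_neqAle dot_ge0 andbT eq_sym; apply/eqP => /dot_eq0 x_0.
by rewrite x_0 eqxx in x0.
Qed.

Lemma dot_CS n (x y : 'cV[R]_n) : dot x y ^+ 2 <= dot x x * dot y y.
Proof.
have [->|y0] := eqVneq y 0.
  rewrite -(scale0r (0 : 'cV[R]_n)) !dotZr !mul0r expr0n/= mulr0 //.
have := dot_ge0 (dot y y *: x - dot x y *: y).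
rewrite dotBl !dotBr !dotZl !dotZr (dotC y x).
have yy := dot_gt0 y0; set a := dot x x; set b := dot x y; set c := dot y y in yy *.
rewrite (_ : _ - _ = c * (a * c - b ^+ 2)); last by ring.
by rewrite pmulr_rge0// subr_ge0.
Qed.

(** With [y = G x], the form at [x + a y] is [2 a |y|^2 + a^2 <y, G y>], which is negative for some
    small negative [a] unless [y = 0]. *)
Lemma psd_kernel n (G : 'M[R]_n) (x : 'cV[R]_n) : G^T = G ->
  (forall y, 0 <= dot y (G *m y)) -> dot x (G *m x) = 0 -> G *m x = 0.
Proof.
move=> Gsym pos x0; apply: dot_eq0; set y := G *m x.
have h a : 0 <= 2 * a * dot y y + a ^+ 2 * dot y (G *m y).
  have := pos (x + a *: y); rewrite mulmxDr -scalemxAr dotDl !dotDr !dotZl !dotZr x0.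
  by rewrite -/y (dotC x) (dot_mulmxl G y x) Gsym -/y; lra.
move: h; set b := dot y y; set c := dot y (G *m y) => h.
have c0 : 0 <= c by exact: pos.
(* The denominator [c + 1] instead of [c] avoids a division by zero. *)
have := h (- b / (c + 1)).
have c1 : 0 < c + 1 by lra.
have -> : 2 * (- b / (c + 1)) * b + (- b / (c + 1)) ^+ 2 * c =
   - (b ^+ 2 * (c + 2) / (c + 1) ^+ 2) by field; rewrite gt_eqF.
rewrite oppr_ge0 pmulr_lle0 ?invr_gt0 ?exprn_gt0// pmulr_lle0; last by lra.
by move=> b2; apply/eqP; rewrite -sqrf_eq0 eq_le b2 sqr_ge0.
Qed.

(** The norm of [X^T y] attains its maximum on the compact unit sphere, and homogeneity extends the
    bound to all [y]. Row vectors match [rV_compact] and [EVT_max_rV]. *)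
Lemma top_right_direction n p (X : 'M[R]_(n.+1, p)) :
  exists2 x : 'cV[R]_n.+1, dot x x = 1 &
    forall y, dot (X^T *m y) (X^T *m y) <=
              dot (X^T *m x) (X^T *m x) * dot y y.
Proof.
pose S := [set v : 'rV[R]_n.+1 | dot v^T v^T = 1].
have coordc i : continuous (fun v : 'rV[R]_n.+1 => v 0 i) by exact: coord_continuous.
have sumc (I : finType) (f : I -> 'rV[R]_n.+1 -> R) :
    (forall i, continuous (f i)) -> continuous (fun v => \sum_i f i v).
  by move=> fc; apply: (@continuous_big _ _ +%R 0 _ add_continuous) => i _; exact: fc.
have dotc : continuous (fun v : 'rV[R]_n.+1 => dot v^T v^T).
  apply: (sumc) => i.
  have -> : (fun v : 'rV[R]_n.+1 => v^T i 0 * v^T i 0) = (fun v => v 0 i * v 0 i).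
    by apply/funext => v; rewrite !mxE.
  by move=> v; apply: continuousM; exact: coordc.
have qc : continuous (fun v : 'rV[R]_n.+1 => dot (X^T *m v^T) (X^T *m v^T)).
  apply: (sumc) => j; have lc : continuous (fun v : 'rV[R]_n.+1 => (X^T *m v^T) j 0).
    have -> : (fun v : 'rV[R]_n.+1 => (X^T *m v^T) j 0) = (fun v => \sum_i X i j * v 0 i).
      by apply/funext => v; rewrite mxE; apply: eq_bigr => i _; rewrite !mxE.
    by apply: (sumc) => i v; apply: continuousM; [exact: cst_continuous|exact: coordc].
  by move=> v; apply: continuousM; exact: lc.
have cS : compact S.
  apply: (@subclosed_compact _ S [set v : 'rV[R]_n.+1 | forall i, `[(-1 : R), 1]%classic (v ord0 i)]).
  - have := @preimage_closed _ _ (fun v : 'rV[R]_n.+1 => dot v^T v^T : R^o) [set x : R^o | x = 1].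
    by apply; [move=> v _; exact: dotc|exact: (@closed_eq R 1)].
  - by apply: (@rV_compact _ _ (fun=> `[(-1 : R), 1]%classic)) => i; exact: segment_compact.
  - move=> v /= v1 i; rewrite in_itv/= -ler_norml -(@expr_le1 _ 2)// real_normK ?num_real//.
    rewrite -v1 /dot (bigD1 i)//= !mxE -expr2 lerDl sumr_ge0// => k _.
    by rewrite -expr2 sqr_ge0.
have S0 : S !=set0.
  exists (delta_mx 0 0); rewrite /S/= /dot (bigD1 ord0)//= !mxE !eqxx mulr1 big1 ?addr0//.
  by move=> i /negbTE i0; rewrite !mxE i0 mulr0.
have [v vS vmax] := EVT_max_rV S0 cS (continuous_subspaceT qc).
exists v^T; first by move: vS; rewrite inE.
move=> y; have [->|y0] := eqVneq y 0.
  rewrite mulmx0 -(scale0r (0 : 'cV[R]_p)) -(scale0r (0 : 'cV[R]_n.+1)) !dotZl !mul0r mulr0 //.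
have yy := dot_gt0 y0.
pose s := Num.sqrt (dot y y).
have s0 : 0 < s by rewrite sqrtr_gt0.
have s2 : s ^+ 2 = dot y y by rewrite sqr_sqrtr// ltW.
have /vmax : (s^-1 *: y)^T \in S.
  by rewrite inE /S/= trmxK dotZl dotZr mulrA -expr2 exprVn s2 mulVf// gt_eqF.
rewrite trmxK -scalemxAr dotZl dotZr mulrA -expr2 exprVn s2.
by rewrite mulrC ler_pdivrMr.
Qed.

(** The definition compares [s] with singular values only. The maximiser [x] of the Rayleigh
    quotient lies in the kernel of the semidefinite matrix [M I - X X^T], hence is an eigenvector
    and yields a competing triple of value [sqrt M]; so [s ^ 2] bounds all Rayleigh quotients. *)
Lemma first_left_singular_vector_max n p (X : 'M[R]_(n, p)) (u : 'cV[R]_n) :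
  first_left_singular_vector X u ->
  exists lam, [/\ dot u u = 1, X *m (X^T *m u) = lam *: u &
    forall y, dot (X^T *m y) (X^T *m y) <= lam * dot y y].
Proof.
case: n X u => [|n] X u.
  move=> [s [v [[_ /matrixP/(_ 0 0) + _ _ _] _]]].
  by rewrite !mxE big_ord0 => /esym/eqP; rewrite oner_eq0.
move=> [s [v [[s0 uu vv Xv Xu] smax]]].
exists (s ^+ 2); split.
- by rewrite dotE uu mxE.
- by rewrite Xu -scalemxAr Xv scalerA -expr2.
have [x xx xmax] := top_right_direction X.
set M := dot (X^T *m x) (X^T *m x) in xmax.
have M0 : 0 <= M by exact: dot_ge0.
suff sM : M <= s ^+ 2.
  by move=> y; apply: le_trans (xmax y) _; rewrite ler_wpM2r// dot_ge0.
have eig : X *m (X^T *m x) = M *: x.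
  apply/esym/eqP; rewrite -subr_eq0 -mul_scalar_mx mulmxA -mulmxBl.
  apply/eqP/psd_kernel.
  - by rewrite linearB/= tr_scalar_mx trmx_mul trmxK.
  - move=> y; rewrite mulmxBl mul_scalar_mx dotBr dotZr -mulmxA dotC.
    by rewrite dot_mulmxl subr_ge0 dotC.
  - rewrite mulmxBl mul_scalar_mx dotBr dotZr -mulmxA xx (dotC x) dot_mulmxl mulr1.
    by rewrite subrr.
(* For [M = 0] the right vector cannot be normalised, but the inequality is trivial. *)
have [M_0|M_neq0] := eqVneq M 0; first by rewrite M_0 sqr_ge0.
have Mp : 0 < M by rewrite lt_neqAle eq_sym M_neq0.
pose r := Num.sqrt M.
have r0 : 0 < r by rewrite sqrtr_gt0.
have r2 : r ^+ 2 = M by rewrite sqr_sqrtr.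
suff rs : r <= s by rewrite -r2 ler_pXn2r// nnegrE ltW.
apply: (smax r x (r^-1 *: (X^T *m x))); split; first exact: ltW.
- by apply/matrixP => i j; rewrite !ord1 -dotE xx mxE.
- apply/matrixP => i j; rewrite !ord1 -dotE dotZl dotZr -/M -r2 mxE.
  by rewrite mulrA -expr2 exprVn mulVf// gt_eqF// exprn_gt0.
- rewrite -scalemxAr eig -r2 scalerA expr2 mulrA mulVf ?mul1r// gt_eqF//.
- by rewrite scalerA divff ?scale1r// gt_eqF.
Qed.

End dot_product.

Section power_iteration.
Context (R : realType) (n p : nat).
Variables (Y : 'M[R]_(n, p)) (u0 : 'cV[R]_n).

(** Left unnormalised, so that the entries are polynomials in those of [Y] and [u0]. *)
Definition power_iter k : 'cV[R]_n := iter k (fun u => Y *m (Y^T *m u)) u0.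

Lemma power_iterS k : power_iter k.+1 = Y *m (Y^T *m power_iter k).
Proof. by []. Qed.

(** With [M = Y Y^T], [a k] and [q k] are the moments [<u0, M^(2k) u0>] and [<u0, M^(2k+1) u0>].
    Cauchy-Schwarz makes the moment sequence log-convex, which is the content of [qq] and [aa]; this
    is why [q k / a k] increases and positivity propagates. *)
Let a k := dot (power_iter k) (power_iter k).
Let q k := dot (Y^T *m power_iter k) (Y^T *m power_iter k).

Let qE k : q k = dot (power_iter k) (power_iter k.+1).
Proof. by rewrite power_iterS /q dot_mulmxl trmxK. Qed.

Let aE k : a k.+1 = dot (Y^T *m power_iter k) (Y^T *m power_iter k.+1).
Proof. by rewrite /a {1}power_iterS dot_mulmxl. Qed.

Let qq k : q k ^+ 2 <= a k * a k.+1.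
Proof. by rewrite qE; exact: dot_CS. Qed.

Let aa k : a k.+1 ^+ 2 <= q k * q k.+1.
Proof. by rewrite aE; exact: dot_CS. Qed.

(* The Rayleigh quotients [q k / a k] increase and are bounded by [lam], so one of the first
   [K] increments is at most [lam / K]; that increment controls the residual. *)
Lemma power_iter_residual (lam : R) (K : nat) : (0 < K)%N ->
  (forall y, dot (Y^T *m y) (Y^T *m y) <= lam * dot y y) -> 0 < q 0 ->
  exists k, [/\ (k < K)%N, 0 < a k, q 0 * a k <= q k * a 0,
    0 <= dot u0 (power_iter k) &
    dot (power_iter k.+1 - (q k / a k) *: power_iter k)
        (power_iter k.+1 - (q k / a k) *: power_iter k) <= a k * (lam ^+ 2 / K%:R)].
Proof.
move=> K0 lamP q0.
have pos k : 0 < a k /\ 0 < q k.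
  elim: k => [|k [ak qk]].
    split=> //; rewrite lt_neqAle dot_ge0 andbT eq_sym; apply/eqP => /dot_eq0 u0_0.
    by move: q0; rewrite /q u0_0 mulmx0 -(scale0r (0 : 'cV[R]_p)) dotZl mul0r ltxx.
  have ak1 : 0 < a k.+1.
    rewrite lt_neqAle dot_ge0 andbT eq_sym; apply/eqP => a0.
    by have := qq k; rewrite (a0 : a k.+1 = 0) mulr0; have := exprn_gt0 2 qk; lra.
  split=> //; rewrite lt_neqAle dot_ge0 andbT eq_sym; apply/eqP => q_0.
  by have := aa k; rewrite (q_0 : q k.+1 = 0) mulr0; have := exprn_gt0 2 ak1; lra.
pose rho k := q k / a k.
have rho_le k : rho k <= rho k.+1.
  have [ak qk] := pos k; have [ak1 qk1] := pos k.+1.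
  rewrite /rho ler_pdivrMr// mulrAC ler_pdivlMr//.
  rewrite -(ler_pM2l qk) -(ler_pM2r ak1).
  have -> : q k * (q k * a k.+1) * a k.+1 = q k ^+ 2 * a k.+1 ^+ 2 by ring.
  have -> : q k * (q k.+1 * a k) * a k.+1 = (a k * a k.+1) * (q k * q k.+1) by ring.
  by apply: ler_pM => //; rewrite sqr_ge0.
have rho_mon j k : (j <= k)%N -> rho j <= rho k.
  elim: k => [|k IH]; first by rewrite leqn0 => /eqP ->.
  by rewrite leq_eqVlt => /predU1P[->//|/IH]; move/le_trans; apply.
have rho_ge0 k : 0 <= rho k by have [ak qk] := pos k; rewrite divr_ge0// ltW.
have rho_lam k : rho k <= lam.
  by have [ak qk] := pos k; rewrite /rho ler_pdivrMr//; exact: lamP.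
have KR : 0 < (K%:R : R) by rewrite ltr0n.
have [k kK hk] : exists2 k, (k < K)%N & rho k.+1 - rho k <= lam / K%:R.
  apply: contrapT => no.
  have big k : (k < K)%N -> lam / K%:R < rho k.+1 - rho k.
    by move=> kK; rewrite ltNge; apply/negP => h; apply: no; exists k.
  have : \sum_(0 <= k < K) (rho k.+1 - rho k) > \sum_(0 <= k < K) lam / K%:R.
    by apply: ltr_sum_nat => // k /andP[_]; exact: big.
  rewrite telescope_sumr// big_const_nat subn0 iter_addr_0 -[(lam / _) *+ K]mulr_natr divfK ?gt_eqF//.
  by have := rho_lam K; have := rho_ge0 0; lra.
(* As [Y Y^T] is symmetric, inner products of iterates depend only on the sum of the indices. *)
have dots j m : dot (power_iter j) (power_iter m) = dot u0 (power_iter (j + m)).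
  elim: j m => [//|j IH] m; rewrite addSnnS -IH !power_iterS.
  by rewrite [LHS]dot_mulmxl [RHS]dotC [RHS]dot_mulmxl dotC.
have [ak qk] := pos k; have [ak1 qk1] := pos k.+1.
exists k; split=> //.
- have [a0 _] := pos 0%N.
  by have := rho_mon 0%N k isT; rewrite /rho ler_pdivrMr// mulrAC ler_pdivlMr.
(* Halving [k] exhibits the product as one of the squared norms [a m] and [q m]. *)
- have [m [->|->]] : exists m, k = (m + m)%N \/ k = (m + m.+1)%N.
    exists k./2; rewrite addnS addnn -{1 3}(odd_double_half k).
    by case: (odd k); [right|left].
  + by rewrite -dots dot_ge0.
  + by rewrite -dots -qE dot_ge0.
(* The residual has squared norm [a k.+1 - rho k ^ 2 * a k], which [aa] bounds by
   [a k * (rho k * (rho k.+1 - rho k))]. *)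
rewrite -/(rho k) dotBl !dotBr !dotZl !dotZr -qE (dotC (power_iter k.+1)) -qE -/(a k) -/(a k.+1).
have -> : a k.+1 - rho k * q k - (rho k * q k - rho k * (rho k * a k)) =
    a k.+1 - rho k ^+ 2 * a k.
  have -> : q k = rho k * a k by rewrite /rho divfK// gt_eqF.
  by ring.
have a1 : a k.+1 <= a k * (rho k * rho k.+1).
  rewrite -(ler_pM2r ak1) -expr2; apply: le_trans (aa k) _.
  rewrite /rho; have -> : a k * (q k / a k * (q k.+1 / a k.+1)) * a k.+1 = q k * q k.+1 => //.
  by field; rewrite !gt_eqF.
apply: (@le_trans _ _ (a k * (rho k * (rho k.+1 - rho k)))); first by move: a1; rewrite expr2; lra.
rewrite ler_wpM2l ?(ltW ak)// expr2 -mulrA.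
have l0 : 0 <= lam by apply: le_trans (rho_lam 0%N).
by apply: ler_pM => //; rewrite subr_ge0.
Qed.
End power_iteration.

(** * Label recovery by leave-one-out *)

Section row_deletion.
Context (R : realType) (n p : nat).

(** Zeroing row [i] instead of removing it keeps all vectors of length [n]; the iterates vanish at
    [i], so [X^T] and [(zrow i X)^T] agree on them. *)
Definition zrow q (i : 'I_n) (X : 'M[R]_(n, q)) : 'M[R]_(n, q) :=
  \matrix_(k, j) if k == i then 0 else X k j.

Lemma zrow_tr_mul i (X : 'M[R]_(n, p)) (u : 'cV[R]_n) :
  u i 0 = 0 -> (zrow i X)^T *m u = X^T *m u.
Proof.
move=> ui; apply/matrixP => j k; rewrite !mxE ord1; apply: eq_bigr => m _.
by rewrite !mxE; case: eqP => // ->; rewrite ui !mulr0.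
Qed.

Lemma zrow_mul i (X : 'M[R]_(n, p)) (v : 'cV[R]_p) : zrow i X *m v = zrow i (X *m v).
Proof.
apply/matrixP => k j; rewrite !mxE; case: eqP => [->|/eqP ki].
  by rewrite big1// => m _; rewrite !mxE eqxx mul0r.
by apply: eq_bigr => m _; rewrite !mxE (negbTE ki).
Qed.

Lemma tr_zrow_mul i (X : 'M[R]_(n, p)) (u : 'cV[R]_n) :
  (zrow i X)^T *m u = X^T *m zrow i u.
Proof.
apply/matrixP => j k; rewrite !mxE; apply: eq_bigr => m _.
by rewrite !mxE; case: eqP; rewrite ?mul0r ?mulr0 ?ord1.
Qed.

Lemma dot_zrow i (x y : 'cV[R]_n) : dot x y = x i 0 * y i 0 + dot x (zrow i y).
Proof.
rewrite /dot (bigD1 i)//= [in RHS](bigD1 i)//= mxE eqxx mulr0 add0r; congr (_ + _).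
by apply: eq_bigr => k ki; rewrite mxE (negbTE ki).
Qed.

(** The start is the true label vector without entry [i]. The iterates are a tool of the analysis,
    not an estimator: they are well aligned with [l] from step 0 on. *)
Definition loo_iter (X : 'M[R]_(n, p)) (l : 'cV[R]_n) i k :=
  power_iter (zrow i X) (zrow i l) k.

Lemma loo_iter_diag X l i k : loo_iter X l i k i 0 = 0.
Proof.
case: k => [|k]; first by rewrite /loo_iter /= mxE eqxx.
by rewrite /loo_iter power_iterS zrow_mul mxE eqxx.
Qed.

End row_deletion.

Section label_recovery.
Context (R : realType) (n p : nat).
(** [D] bounds Gaussian linear forms, [kap] the deviation of [Z Z^T] from [p I], and [K] counts
    power steps. The spike [n * S] has to dominate the cross terms ([DS]), the spectrum of the noise
    ([kapS]) and the noise of a single row ([DpS]), while [hK] makes the residual of the power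
    method negligible. *)
Variables (l : 'cV[R]_n) (m : 'cV[R]_p) (Z : 'M[R]_(n, p)) (D kap : R) (K : nat).
Let X := l *m m^T + Z.
Let N : R := n%:R.
Let S := dot m m.
Hypothesis l1 : forall i, l i 0 ^+ 2 = 1.
Hypothesis Z_spectrum : forall x : 'cV[R]_n,
  `|dot (Z^T *m x) (Z^T *m x) - p%:R * dot x x| <= kap * dot x x.
Hypothesis Zm_small : dot (Z *m m) (Z *m m) <= N * S * D ^+ 2.
Hypothesis loo_small : forall i k, (k < K)%N ->
  dot (row i Z)^T ((zrow i X)^T *m loo_iter X l i k) ^+ 2 <=
  D ^+ 2 * dot ((zrow i X)^T *m loo_iter X l i k) ((zrow i X)^T *m loo_iter X l i k).
Hypotheses (n8 : (8 <= n)%N) (D0 : 0 <= D) (DS : 64 * D <= Num.sqrt S)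
  (kapS : 32 * kap <= N * S) (DpS : 32 * D ^+ 2 * p%:R <= S ^+ 2 * N)
  (S0 : 0 < S) (K0 : (0 < K)%N)
  (hK : 256 * (2 * S * N + p%:R) ^+ 4 < K%:R * (N ^+ 2 * S ^+ 4)).

Let q x := dot (X^T *m x) (X^T *m x).
Let w := Z *m m.
Let r := Num.sqrt S.
Let N8 : 8 <= N. Proof. by rewrite /N (ler_nat R 8 n). Qed.
Let r0 : 0 < r. Proof. by rewrite sqrtr_gt0. Qed.
Let r2 : r ^+ 2 = S. Proof. by rewrite sqr_sqrtr// ltW. Qed.

Let ll : dot l l = N.
Proof.
rewrite /dot; under eq_bigr do rewrite -expr2 l1.
by rewrite sumr_const card_ord.
Qed.

Let XtE x : X^T *m x = dot l x *: m + Z^T *m x.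
Proof.
rewrite /X linearD/= mulmxDl trmx_mul trmxK -mulmxA; congr (_ + _).
have -> : l^T *m x = (dot l x)%:M by apply/matrixP => i j; rewrite !ord1 -dotE mxE eqxx.
by rewrite mul_mx_scalar.
Qed.

Let qE x : q x = S * dot l x ^+ 2 + 2 * (dot l x * dot w x) + dot (Z^T *m x) (Z^T *m x).
Proof.
rewrite /q XtE dotDl !dotDr !dotZl !dotZr (dotC _ m) /w (dot_mulmxl Z m x) -/S; ring.
Qed.

(** Operator-norm bound for [X X^T - p I - S l l^T]: the cross terms plus the noise. By [deltaS] it
    is at most a sixteenth of the eigenvalue [N * S] of the spike. *)
Let delta := 2 * N * r * D + kap.
Let deltaS : 16 * delta <= N * S.
Proof.
have h : 64 * D * (N * r) <= r * (N * r) by rewrite ler_wpM2r// mulr_ge0 ?ltW// (lt_le_trans _ N8).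
have -> : N * S = N * r ^+ 2 by rewrite r2.
by move: h kapS; rewrite -r2 /delta !expr2; lra.
Qed.

Let cs_l x : dot l x ^+ 2 <= N * dot x x.
Proof. by rewrite -ll dot_CS. Qed.

Let cs_w x : dot w x ^+ 2 <= N * S * D ^+ 2 * dot x x.
Proof. by apply: le_trans (dot_CS _ _) _; rewrite ler_wpM2r// dot_ge0. Qed.

Let cross x : `|dot l x * dot w x| <= N * r * D * dot x x.
Proof.
rewrite -(@ler_pXn2r _ 2)// ?nnegrE ?normr_ge0//; last first.
  by rewrite !mulr_ge0 ?dot_ge0 ?(ltW r0)// ler0n.
rewrite real_normK ?num_real// exprMn.
have -> : (N * r * D * dot x x) ^+ 2 = (N * dot x x) * (N * S * D ^+ 2 * dot x x).
  by rewrite -r2; ring.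
by apply: ler_pM; rewrite ?sqr_ge0.
Qed.

Let qapprox x : `|q x - (S * dot l x ^+ 2 + p%:R * dot x x)| <= delta * dot x x.
Proof.
have := Z_spectrum x; have := cross x; rewrite qE /delta !ler_norml => /andP[c1 c2] /andP[z1 z2].
by apply/andP; split; lra.
Qed.

(** A Rayleigh quotient at least that of an aligned vector forces alignment: the comparison costs
    [2 * delta <= N * S / 8], which takes [7 / 8] to [3 / 4]. *)
Let aligned x y : 0 < dot x x -> 0 < dot y y -> q y * dot x x <= q x * dot y y ->
  7 / 8 * N * dot y y <= dot l y ^+ 2 -> 3 / 4 * N * dot x x <= dot l x ^+ 2.
Proof.
move=> x0 y0 hq hy.
have := qapprox x; have := qapprox y; rewrite !ler_norml => /andP[y1 _] /andP[_ x2].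
have a1 : (S * dot l y ^+ 2 + p%:R * dot y y - delta * dot y y) * dot x x <= q y * dot x x.
  by rewrite ler_pM2r//; lra.
have a2 : q x * dot y y <= (S * dot l x ^+ 2 + p%:R * dot x x + delta * dot x x) * dot y y.
  by rewrite ler_pM2r//; lra.
have a3 : 7 / 8 * N * dot y y * (S * dot x x) <= dot l y ^+ 2 * (S * dot x x).
  by rewrite ler_wpM2r// mulr_ge0 ?dot_ge0// ltW.
have a4 : 16 * delta * (dot x x * dot y y) <= N * S * (dot x x * dot y y).
  by rewrite ler_wpM2r// mulr_ge0 ?dot_ge0.
have : 3 / 4 * N * dot x x * (S * dot y y) <= dot l x ^+ 2 * (S * dot y y).
  have := le_trans a1 (le_trans hq a2); lra.
by rewrite ler_pM2r// mulr_gt0.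
Qed.

(** Both vectors lie in a cone around [l]. Cauchy-Schwarz for [l] and [x + y] gives
    [3 * N * |x|^2 <= N * |x + y|^2], which leaves [|x|^2 / 2] for the inner product. *)
Let aligned_pos x y : 0 < dot x x -> 0 < dot y y ->
  3 / 4 * N * dot x x <= dot l x ^+ 2 -> 3 / 4 * N * dot y y <= dot l y ^+ 2 ->
  0 <= dot l x -> 0 <= dot l y -> dot x x = dot y y -> dot x x / 2 <= dot x y.
Proof.
move=> x0 y0 hx hy lx ly xy.
have := cs_l (x + y); rewrite dotDr dotDl !dotDr (dotC y x) -xy.
have N0 : 0 < N by apply: lt_le_trans N8.
have : 3 / 4 * N * dot x x <= dot l x * dot l y.
  rewrite -(@ler_pXn2r _ 2)// ?nnegrE ?mulr_ge0 ?(ltW x0) ?(ltW N0)//.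
  rewrite [leRHS]exprMn expr2; apply: ler_pM => //; last by rewrite xy.
    by rewrite !mulr_ge0 ?(ltW N0) ?(ltW x0).
  by rewrite !mulr_ge0 ?(ltW N0) ?(ltW x0).
rewrite -xy in hy; move=> h1 h2.
have : N * (3 * dot x x) <= N * (2 * dot x x + 2 * dot x y).
  move: h2; rewrite sqrrD; set a := dot l x ^+ 2 in hx *; set b := dot l y ^+ 2 in hy *.
  set c := dot l x * dot l y in h1 *; rewrite -mulr_natl; lra.
rewrite ler_pM2l//; lra.
Qed.

(* With [v] the normalised leave-one-out iterate and [beta = (X X' v)_i], the eigenvalue equation
   reads [xi_i beta = (lam - q v) <xi, v> - <xi, e>], where [e] is the residual of [v].  Testing the
   maximality of [lam] on [v + (beta / lam) e_i] gives [lam - q v >= beta^2 / lam], which beats the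
   residual; hence [xi_i] has the sign of [beta], which is that of [l_i]. *)
Lemma label_recovery_oriented (xi : 'cV[R]_n) (lam : R) :
  dot xi xi = 1 -> X *m (X^T *m xi) = lam *: xi ->
  (forall y, q y <= lam * dot y y) -> 0 <= dot l xi ->
  forall i, 0 < xi i 0 * l i 0.
Proof.
move=> xi1 xieig lamP lxi i.
have hN8 := N8; have hdelta := deltaS; have hr0 := r0.
have N0 : 0 < N by apply: lt_le_trans N8.
have p0 : 0 <= (p%:R : R) by [].
have SN0 : 0 < S * N by rewrite mulr_gt0.
have qxi : q xi = lam by rewrite /q dot_mulmxl trmxK xieig dotZr xi1 mulr1.
have axi : 3 / 4 * N <= dot l xi ^+ 2.
  have := @aligned xi l; rewrite xi1 ll qxi !mulr1; apply => //.
    by have := lamP l; rewrite ll.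
  by rewrite expr2; nra.
pose u0 := zrow i l.
have lu0 : dot l u0 = N - 1.
  by have := dot_zrow i l l; rewrite ll -expr2 l1 -/u0; lra.
have u0u0 : dot u0 u0 = N - 1.
  by have := dot_zrow i u0 l; rewrite mxE eqxx mul0r add0r (dotC u0 l) lu0 -/u0.
have u0p : 0 < dot u0 u0 by rewrite u0u0; lra.
have qu0 : 0 < q u0.
  have := qapprox u0; rewrite lu0 u0u0 ler_norml => /andP[h _].
  have h1 : 16 * delta * (N - 1) <= N * S * (N - 1) by rewrite ler_wpM2r//; lra.
  have h2 : 0 <= p%:R * (N - 1) by rewrite mulr_ge0//; lra.
  have h3 : 0 < S * (N - 1) * (15 * N - 16) by rewrite !mulr_gt0//; lra.
  lra.
(* Zeroing a row does not raise the top eigenvalue, so [lam] also bounds the power iteration of the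
   reduced matrix. *)
have lamP' y : dot ((zrow i X)^T *m y) ((zrow i X)^T *m y) <= lam * dot y y.
  rewrite tr_zrow_mul; apply: le_trans (lamP _) _; rewrite ler_wpM2l//.
    by rewrite -qxi dot_ge0.
  rewrite (dot_zrow i y y) (dotC y) (dot_zrow i (zrow i y) y) mxE eqxx mul0r add0r.
  by rewrite lerDr -expr2 sqr_ge0.
have qloo k : dot ((zrow i X)^T *m loo_iter X l i k) ((zrow i X)^T *m loo_iter X l i k)
   = q (loo_iter X l i k).
  by rewrite zrow_tr_mul// loo_iter_diag.
have qu0' : 0 < dot ((zrow i X)^T *m power_iter (zrow i X) u0 0) ((zrow i X)^T *m power_iter (zrow i X) u0 0).
  by rewrite (qloo 0%N).
have [k [kK]] := power_iter_residual K0 lamP' qu0'.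
rewrite -/(loo_iter X l i k) -/(loo_iter X l i k.+1) -/(loo_iter X l i 0) !qloo.
have loo0 : loo_iter X l i 0 = u0 by [].
rewrite loo0.
have lookS : loo_iter X l i k.+1 = zrow i (X *m (X^T *m loo_iter X l i k)).
  by rewrite /loo_iter power_iterS zrow_mul zrow_tr_mul ?loo_iter_diag.
have hsmall := loo_small i kK; rewrite zrow_tr_mul ?loo_iter_diag// in hsmall.
have ui := loo_iter_diag X l i k.
rewrite lookS; move: (loo_iter X l i k) ui hsmall => u ui hsmall a0 hq lu he.
(* Here [<l, u0>^2 = (N - 1)^2] is at least [7 / 8 * N * |u0|^2] because [N >= 8], and the Rayleigh
   quotient of the iterate is no smaller than that of [u0]. *)
have au : 3 / 4 * N * dot u u <= dot l u ^+ 2.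
  apply: (@aligned u u0) => //; rewrite lu0 u0u0 expr2 ler_wpM2r//; lra.
have {}lu : 0 <= dot l u.
  by have := dot_zrow i u l; rewrite ui mul0r add0r dotC => ->; rewrite dotC.
pose t := Num.sqrt (dot u u).
have t0 : 0 < t by rewrite sqrtr_gt0.
have t2 : t ^+ 2 = dot u u by rewrite sqr_sqrtr// ltW.
have tn0 : t != 0 by rewrite gt_eqF.
pose v := t^-1 *: u.
have v1 : dot v v = 1 by rewrite dotZl dotZr mulrA -expr2 exprVn t2 mulVf// gt_eqF.
have vi : v i 0 = 0 by rewrite mxE ui mulr0.
have lv : 0 <= dot l v by rewrite dotZr mulr_ge0// invr_ge0 ltW.
have av : 3 / 4 * N <= dot l v ^+ 2.
  by rewrite dotZr exprMn exprVn [leRHS]mulrC ler_pdivlMr ?exprn_gt0// t2.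
have Xv : X^T *m v = t^-1 *: (X^T *m u) by rewrite -scalemxAr.
have qv : q v = q u / dot u u by rewrite /q Xv dotZl dotZr mulrA -expr2 exprVn t2 mulrC.
pose e := zrow i (X *m (X^T *m v)) - q v *: v.
have ee : dot e e <= lam ^+ 2 / K%:R.
  have -> : e = t^-1 *: (zrow i (X *m (X^T *m u)) - (q u / dot u u) *: u).
    rewrite /e Xv -scalemxAr qv scalerBr !scalerA (mulrC t^-1); congr (_ - _).
    by apply/matrixP => a b; rewrite !mxE; case: eqP; rewrite ?mulr0.
  by rewrite dotZl dotZr mulrA -expr2 exprVn t2 [leLHS]mulrC ler_pdivrMr// [leRHS]mulrC.
have {}hsmall : dot (row i Z)^T (X^T *m v) ^+ 2 <= D ^+ 2 * q v.
  rewrite Xv dotZr exprMn exprVn t2 qv mulrA [leRHS]mulrC ler_pM2l ?invr_gt0//.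
pose beta := (X *m (X^T *m v)) i 0.
have betaE : beta = l i 0 * (S * dot l v + dot w v) + dot (row i Z)^T (X^T *m v).
  have -> : beta = dot (row i X)^T (X^T *m v).
    by rewrite /beta dotE trmxK -row_mul [RHS]mxE.
  have -> : (row i X)^T = l i 0 *: m + (row i Z)^T.
    by apply/matrixP => a b; rewrite /X !mxE big_ord1 !mxE !ord1.
  rewrite dotDl dotZl; congr (_ * _ + _).
  by rewrite XtE dotDr dotZr -/S /w (dot_mulmxl Z m) mulrC.
clearbody v.
have qv_le : q v <= 2 * S * N + p%:R.
  have := qapprox v; have := cs_l v; rewrite v1 !mulr1 ler_norml => h /andP[_ h2].
  have h3 : S * dot l v ^+ 2 <= S * N by rewrite ler_wpM2l// ltW.
  by move: hdelta SN0; rewrite (mulrC N S); lra.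
have lam_le : lam <= 2 * S * N + p%:R.
  rewrite -qxi; have := qapprox xi; have := cs_l xi; rewrite xi1 !mulr1 ler_norml => h /andP[_ h2].
  have h3 : S * dot l xi ^+ 2 <= S * N by rewrite ler_wpM2l// ltW.
  by move: hdelta SN0; rewrite (mulrC N S); lra.
have qv_gt0 : 0 < q v.
  have := qapprox v; rewrite v1 !mulr1 ler_norml => /andP[h2 _].
  have h3 : S * (3 / 4 * N) <= S * dot l v ^+ 2 by rewrite ler_wpM2l// ltW.
  by move: hdelta SN0; rewrite (mulrC N S); lra.
have qv_lam : q v <= lam by have := lamP v; rewrite v1 mulr1.
have lam0 : 0 < lam by apply: lt_le_trans qv_gt0 _.
pose s := Num.sqrt N.
have s0 : 0 < s by rewrite sqrtr_gt0.
have s2 : s ^+ 2 = N by rewrite sqr_sqrtr// ltW.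
have lvs : 4 / 5 * s <= dot l v.
  rewrite -(@ler_pXn2r _ 2)// ?nnegrE ?mulr_ge0 ?(ltW s0)// exprMn s2.
  by apply: le_trans av; rewrite ler_wpM2r ?(ltW N0)//; lra.
have srS : 64 * (s * r * D) <= s * S.
  have h : 64 * D * (s * r) <= r * (s * r) by rewrite ler_wpM2r// mulr_ge0 ?ltW.
  have -> : s * S = r * (s * r) by rewrite -[X in s * X]r2; ring.
  by lra.
have wv : `|dot w v| <= s * r * D.
  rewrite -(@ler_pXn2r _ 2)// ?nnegrE ?normr_ge0 ?mulr_ge0 ?(ltW s0) ?(ltW r0)//.
  by rewrite real_normK ?num_real// !exprMn s2 r2; have := cs_w v; rewrite v1 mulr1.
have zv : `|dot (row i Z)^T (X^T *m v)| <= s * S / 4.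
  rewrite -(@ler_pXn2r _ 2)// ?nnegrE ?normr_ge0 ?divr_ge0 ?mulr_ge0 ?(ltW s0) ?(ltW S0)//.
  rewrite real_normK ?num_real//; apply: le_trans hsmall _.
  have h1 : D ^+ 2 * q v <= D ^+ 2 * (2 * S * N + p%:R) by rewrite ler_wpM2l ?sqr_ge0.
  have h2 : (64 * D) ^+ 2 <= S by rewrite -r2; apply: lerXn2r; rewrite ?nnegrE ?mulr_ge0// ltW.
  have h3 : (64 * D) ^+ 2 * (S * N) <= S * (S * N) by rewrite ler_wpM2r// ltW.
  have h4 : 0 <= S * (S * N) by rewrite !mulr_ge0 ?(ltW S0) ?(ltW N0).
  have -> : (s * S / 4) ^+ 2 = S * (S * N) / 16 by rewrite -s2; field.
  by move: DpS h3; rewrite !expr2; lra.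
have Ss : 0 < s * S by rewrite mulr_gt0.
(* The signal gives [4 / 5] of [s * S], the cross term takes at most [1 / 64] and the noise of row
   [i] at most [1 / 4]. *)
have lbeta : s * S / 2 <= l i 0 * beta.
  rewrite betaE mulrDr mulrA -expr2 l1 mul1r.
  have : `|l i 0 * dot (row i Z)^T (X^T *m v)| <= s * S / 4.
    have -> : `|l i 0 * dot (row i Z)^T (X^T *m v)| = `|dot (row i Z)^T (X^T *m v)|.
      have l1' : `|l i 0| = 1.
        by apply/eqP; rewrite -(@eqrXn2 _ 2)// real_normK ?num_real// l1 expr1n.
      by rewrite normrM l1' mul1r.
    exact: zv.
  have : S * (4 / 5 * s) <= S * dot l v by rewrite ler_wpM2l// ltW.
  by move: wv; rewrite !ler_norml => /andP[w1 w2] h /andP[z1 z2]; lra.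
have beta2 : (s * S / 2) ^+ 2 <= beta ^+ 2.
  have h : 0 <= s * S / 2 by rewrite divr_ge0// ltW.
  have -> : beta ^+ 2 = (l i 0 * beta) ^+ 2 by rewrite exprMn l1 mul1r.
  by apply: lerXn2r; rewrite ?nnegrE ?h ?(le_trans h lbeta).
have beta2p : 0 < beta ^+ 2.
  by apply: lt_le_trans beta2; rewrite exprn_gt0// divr_gt0.
have gap : beta ^+ 2 / lam <= lam - q v.
  pose c := beta / lam.
  have := lamP (v + c *: delta_mx i 0).
  have de x : dot x (delta_mx i 0) = x i 0.
    rewrite /dot (bigD1 i)//= mxE !eqxx mulr1 big1 ?addr0// => k' /negbTE ki.
    by rewrite mxE ki mulr0.
  have -> : q (v + c *: delta_mx i 0) = q v + 2 * c * beta + c ^+ 2 * q (delta_mx i 0).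
    rewrite /q mulmxDr -(scalemxAr c) dotDl !dotDr !dotZl !dotZr (dotC _ (X^T *m v)).
    have -> : dot (X^T *m v) (X^T *m delta_mx i 0) = beta.
      by rewrite dotC dot_mulmxl trmxK dotC de.
    by ring.
  rewrite dotDl !dotDr !dotZl !dotZr v1 !de (dotC (delta_mx i 0)) de vi mxE !eqxx.
  have : 0 <= c ^+ 2 * q (delta_mx i 0) by rewrite mulr_ge0 ?sqr_ge0// dot_ge0.
  have -> : beta ^+ 2 / lam = c * beta by rewrite /c; field; rewrite gt_eqF.
  have : lam * (c * c) = c * beta by rewrite /c; field; rewrite gt_eqF.
  by rewrite !mulr0 !mulr1 addr0 add0r mulrDr; lra.
have xiv : 1 / 2 <= dot xi v.
  have := @aligned_pos xi v; rewrite xi1 v1 !mulr1 => h.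
  by have := h ltr01 ltr01 axi av lxi lv erefl; lra.
have key : xi i 0 * beta = (lam - q v) * dot xi v - dot xi e.
  have h1 : lam * dot xi v = dot xi (X *m (X^T *m v)).
    by rewrite -dotZl -xieig !dot_mulmxl trmxK.
  rewrite mulrBl h1 (dot_zrow i) /e dotBr dotZr -/beta; ring.
(* The residual is at most [lam / sqrt K] in norm and [beta ^ 2 >= N * S ^ 2 / 4]; [hK] is the
   resulting condition with [lam] replaced by its upper bound. *)
have xe : `|dot xi e| <= beta ^+ 2 / lam / 4.
  rewrite -(@ler_pXn2r _ 2)// ?nnegrE ?normr_ge0//; last by rewrite !divr_ge0// ltW.
  rewrite real_normK ?num_real//; apply: le_trans (dot_CS _ _) _; rewrite xi1 mul1r.
  apply: le_trans ee _; rewrite ler_pdivrMr ?ltr0n//.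
  have -> : (beta ^+ 2 / lam / 4) ^+ 2 * K%:R = (beta ^+ 2) ^+ 2 * K%:R / (16 * lam ^+ 2).
    by field; rewrite gt_eqF.
  rewrite ler_pdivlMr ?mulr_gt0 ?exprn_gt0//.
  have B4 : ((s * S / 2) ^+ 2) ^+ 2 <= (beta ^+ 2) ^+ 2.
    by apply: lerXn2r; rewrite ?nnegrE ?sqr_ge0.
  have L4 : lam ^+ 4 <= (2 * S * N + p%:R) ^+ 4.
    by apply: lerXn2r; rewrite ?nnegrE ?(ltW lam0)// (le_trans (ltW lam0)).
  have : ((s * S / 2) ^+ 2) ^+ 2 * K%:R <= (beta ^+ 2) ^+ 2 * K%:R by rewrite ler_wpM2r.
  have -> : ((s * S / 2) ^+ 2) ^+ 2 * K%:R = K%:R * (N ^+ 2 * S ^+ 4) / 16.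
    by rewrite -s2; field.
  have -> : lam ^+ 2 * (16 * lam ^+ 2) = 16 * lam ^+ 4 by ring.
  by move: hK; lra.
(* Since [<xi, v> >= 1 / 2], the gap contributes at least [beta ^ 2 / (2 * lam)], and the residual
   takes at most half of that. *)
have : 0 < xi i 0 * beta.
  rewrite key.
  have h1 : beta ^+ 2 / lam * (1 / 2) <= (lam - q v) * dot xi v.
    by apply: ler_pM => //; rewrite ?divr_ge0// ltW.
  have h2 : 0 < beta ^+ 2 / lam by rewrite divr_gt0.
  by move: xe; rewrite ler_norml => /andP[]; lra.
have lb : 0 < l i 0 * beta by apply: lt_le_trans lbeta; rewrite divr_gt0.
have -> : xi i 0 * beta = (xi i 0 * l i 0) * (l i 0 * beta).
  by rewrite -[LHS]mul1r -[X in X * _](l1 i); ring.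
by rewrite pmulr_lgt0.
Qed.

(** The oriented case applies to [xi] or to [- xi], whichever has a nonnegative product with [l]. *)
Lemma label_recovery_sign (xi : 'cV[R]_n) : first_left_singular_vector X xi ->
  label_if xi = l \/ label_if xi = - l.
Proof.
move=> /first_left_singular_vector_max [lam [xi1 xieig lamP]].
have sgl i : Num.sg (l i 0) = l i 0.
  have : `|l i 0| = 1.
    by apply/eqP; rewrite -(@eqrXn2 _ 2)// real_normK ?num_real// l1 expr1n.
  by move=> h; rewrite [RHS]numEsg h mulr1.
have sg x i : 0 < x * l i 0 -> Num.sg x = l i 0.
  move=> h; have : Num.sg (x * l i 0) = 1 by rewrite gtr0_sg.
  rewrite sgrM sgl => e; rewrite -[LHS]mulr1 -(l1 i) expr2 mulrA e mul1r //.
have [lxi|lxi] := leP 0 (dot l xi).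
  left; apply/matrixP => i j; rewrite ord1 mxE; apply: sg.
  exact: (label_recovery_oriented xi1 xieig lamP).
right; apply/matrixP => i j; rewrite ord1 !mxE.
apply/eqP; rewrite -eqr_oppLR -sgrN; apply/eqP/sg.
have -> : - xi i 0 = (- xi) i 0 by rewrite mxE.
apply: (@label_recovery_oriented (- xi) lam) => //.
- by rewrite dotNl dotNr opprK.
- by rewrite !mulmxN xieig scalerN.
- by rewrite dotNr oppr_ge0 ltW.
Qed.

End label_recovery.

(** * Events of high probability in the model *)

Section whp.
Context (R : realType) d (T : measurableType d) (P : probability T R).
Implicit Types (b : R) (A : T -> Prop).

(* [A] fails at most on a measurable set of probability [b]; [A] itself need not be measurable. *)
Definition whp b A := exists B : set T,
  [/\ measurable B, (P B <= b%:E)%E & forall w, ~ B w -> A w].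

Lemma whp_weaken b b' A A' : whp b A -> b <= b' -> (forall w, A w -> A' w) -> whp b' A'.
Proof.
move=> [B [mB PB BA]] bb' AA'; exists B; split=> // [|w /BA/AA'//].
by apply: le_trans PB _; rewrite lee_fin.
Qed.

Lemma whp_and b b' A A' : whp b A -> whp b' A' -> whp (b + b') (fun w => A w /\ A' w).
Proof.
move=> [B [mB PB BA]] [B' [mB' PB' BA']]; exists (B `|` B'); split.
- exact: measurableU.
- by apply: le_trans (measureU2 P mB mB') _; rewrite EFinD leeD.
- by move=> w /not_orP[/BA ? /BA' ?].
Qed.

Lemma whp_forall (I : finType) b (A : I -> T -> Prop) :
  (forall i, whp b (A i)) -> whp (#|I|%:R * b) (fun w => forall i, A i w).
Proof.
move=> h.
suff /(_ (enum I)) : forall s : seq I,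
    whp ((size s)%:R * b) (fun w => forall i, i \in s -> A i w).
  rewrite -cardE => H; apply: (whp_weaken H) => // w Aw i; apply: Aw.
  by rewrite mem_enum.
elim=> [|i s IH]; first by exists set0; split=> //; rewrite measure0 mul0r.
rewrite /= -addn1 natrD mulrDl mul1r addrC.
apply: (whp_weaken (whp_and (h i) IH)) => // w [? Aw] k.
by rewrite inE => /predU1P[->//|/Aw].
Qed.

Lemma whp_measurable b (A : set T) : measurable A -> (P (~` A) <= b%:E)%E -> whp b A.
Proof.
move=> mA PA; exists (~` A); split=> //; first exact: measurableC.
by move=> w /contrapT.
Qed.

Lemma whp_compl b (A : T -> Prop) (B : set T) : measurable B -> (P B <= b%:E)%E ->
  (forall w, ~ A w -> B w) -> whp b A.
Proof.
by move=> mB PB AB; exists B; split=> // w nB; apply: contrapT => /AB.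
Qed.

End whp.

Lemma whp_pushforward (R : realType) d d' (T : measurableType d) (V : measurableType d')
    (P : probability T R) (Q : probability V R) (phi : T -> V) b A :
  measurable_fun setT phi -> (forall B, measurable B -> Q B = P (phi @^-1` B)) ->
  whp Q b A -> whp P b (A \o phi).
Proof.
move=> mphi PQ [B [mB QB BA]]; exists (phi @^-1` B); split.
- by rewrite -[X in measurable X]setTI; exact: mphi.
- by rewrite -PQ.
- by move=> w /BA.
Qed.

Section hamming_loss.
Context (R : realType) d (T : measurableType d) (P : probability T R).
Import HBNNSimple.

(* No measurability of [f] is needed: the integral of a nonnegative function is a supremum
   over the simple functions below it. *)
Lemma ge0_le_integral_majorant (f g : T -> \bar R) : (forall x, 0 <= f x)%E ->
  measurable_fun setT g -> (forall x, f x <= g x)%E ->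
  (\int[P]_x f x <= \int[P]_x g x)%E.
Proof.
move=> f0 mg fg.
rewrite !ge0_integralTE//; last by move=> x; apply: le_trans (fg x).
apply: ereal_sup_le => _ [h hf <-]; exists h => // x.
exact: le_trans (hf x) (fg x).
Qed.

(** The size of the symmetric difference is at most the number of columns whose exceptional set
    contains [w], so its expectation is at most [p * c]. *)
Lemma hamm_le p (eps c : R) (mu : 'I_p -> {RV P >-> R}) (S : T -> {set 'I_p}) :
  (0 < p)%N -> 0 < eps ->
  (forall j, whp P c (fun w => (j \in S w) = (mu j w != 0))) ->
  (0 <= hamm eps mu S <= (c / eps)%:E)%E.
Proof.
move=> p0 eps0 h.
have pe0 : 0 < p%:R * eps by rewrite mulr_gt0 ?ltr0n.
rewrite /hamm unlock; apply/andP; split.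
  apply: mule_ge0; first by rewrite lee_fin invr_ge0 ltW.
  by apply: integral_ge0 => w _; rewrite lee_fin.
have /choice[B Bh] : forall j, exists B : set T,
  [/\ measurable B, (P B <= c%:E)%E & forall w, ~ B w -> (j \in S w) = (mu j w != 0)] by [].
have le1 : (\int[P]_w (#|((S w :\: arw_support mu w) :|: (arw_support mu w :\: S w))%SET|%:R)%:E
   <= (p%:R * c)%:E)%E.
  apply: (@le_trans _ _ (\int[P]_w (\sum_(j < p) (\1_(B j) w)%:E))%E).
    apply: ge0_le_integral_majorant.
    - by move=> w; rewrite lee_fin.
    - apply: emeasurable_sum => j; apply/measurable_EFinP; apply: measurable_indic.
      by have [] := Bh j.
    - move=> w; rewrite sumEFin lee_fin -sum1_card natr_sum big_mkcond/=.
      apply: ler_sum => j _; rewrite !inE.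
      have [_ _ Bj] := Bh j; rewrite indicE.
      case: (boolP (w \in B j)) => wB; first by case: ifP.
      by rewrite Bj; [case: (mu j w != 0)|move=> Bw; rewrite mem_set in wB].
  rewrite ge0_integral_sum//; last first.
    by move=> j; apply/measurable_EFinP; apply: measurable_indic; have [] := Bh j.
  apply: (@le_trans _ _ (\sum_(j < p) c%:E)%E).
    apply: lee_sum => j _; have [mB PB _] := Bh j.
    by rewrite integral_indic// setIT.
  by rewrite sumEFin sumr_const card_ord mulr_natl.
apply: (@le_trans _ _ (((p%:R * eps)^-1)%:E * (p%:R * c)%:E)%E).
  by apply: lee_wpmul2l => //; rewrite lee_fin invr_ge0 ltW.
rewrite -EFinM lee_fin invfM mulrACA mulVf ?mul1r ?pnatr_eq0 -?lt0n// mulrC //.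
Qed.

End hamming_loss.

Section events.
Context (R : realType) (I : finType).
Local Notation V := (coordsType R I).
Implicit Types (Q : probability V R) (F g c : V -> R) (i : I) (s : seq I).

(** Dividing [y] by its norm gives coefficients of norm at most one that still do not read the
    coordinates in [s], so random coefficients obey the same tail bound as fixed ones. *)
Lemma whp_self_normalized Q (s : seq I) (y : I -> V -> R) (t : R) :
  uniq s -> (forall i, i \in s -> gaussian Q i) ->
  (forall i, i \in s -> measurable_fun setT (y i)) ->
  (forall i k, i \in s -> k \in s -> free_of i (y k)) -> 0 <= t ->
  whp Q (2 * expR (- (t ^+ 2 / 2))) (fun v =>
    0 < \sum_(i <- s) y i v ^+ 2 ->
    (\sum_(i <- s) y i v * v i) ^+ 2 < t ^+ 2 * \sum_(i <- s) y i v ^+ 2).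
Proof.
move=> us Gs my fy t0.
(* The inverse norm, as a power, is measurable everywhere; where the norm is zero all [y i] vanish,
   whatever value it takes. *)
pose nrm (v : V) := (\sum_(i <- s) y i v ^+ 2) `^ (- (1 / 2)).
pose c i (v : V) := y i v * nrm v.
have mnrm : measurable_fun setT nrm.
  apply: (measurableT_comp (measurable_powR _)).
  have -> : (fun v : V => \sum_(k <- s) y k v ^+ 2) =
      (fun v : V => \sum_(k <- s) (if k \in s then y k v else 0) ^+ 2).
    by apply/funext => v; apply: eq_big_seq => k ->.
  apply: measurable_sum => k; apply: measurable_funX.
  by case: (boolP (k \in s)) => // ks; exact: my.
have mc i : i \in s -> measurable_fun setT (c i).
  by move=> si; apply: measurable_funM => //; exact: my.
have fc i k : i \in s -> k \in s -> free_of i (c k).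
  move=> si sk; apply: free_ofM; first exact: fy.
  move=> v r; congr (_ `^ _); apply: eq_big_seq => k' sk'.
  by rewrite fy.
have nrm2 v : 0 < \sum_(i <- s) y i v ^+ 2 -> nrm v ^+ 2 = (\sum_(i <- s) y i v ^+ 2)^-1.
  move=> S0; rewrite -powR_mulrn ?powR_ge0// -powRrM.
  by rewrite mulNr mulrC mulrA mulr1 divff// powR_inv1// ltW.
have c2 v : \sum_(i <- s) c i v ^+ 2 = nrm v ^+ 2 * \sum_(i <- s) y i v ^+ 2.
  by rewrite mulr_sumr; apply: eq_bigr => i _; rewrite exprMn mulrC.
have S_ge0 v : 0 <= \sum_(i <- s) y i v ^+ 2 by apply: sumr_ge0 => i _; exact: sqr_ge0.
have c1 v : \sum_(i <- s) c i v ^+ 2 <= 1.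
  rewrite c2; have [S0|S0] := ltP 0 (\sum_(i <- s) y i v ^+ 2).
    by rewrite nrm2// mulVf// gt_eqF.
  have -> : \sum_(i <- s) y i v ^+ 2 = 0 by apply/eqP; rewrite eq_le S0 S_ge0.
  by rewrite mulr0.
apply: (whp_compl _ (gaussian_linear_tail us Gs mc fc c1 t0)).
  apply: measurable_ler_fun => //; apply: measurableT_comp => //.
  exact: measurable_linear.
move=> v /= /not_implyP[S0 /negP]; rewrite -leNgt => h.
rewrite -(@ler_pXn2r _ 2)// ?nnegrE// real_normK ?num_real//.
have -> : \sum_(i <- s) c i v * v i = nrm v * \sum_(i <- s) y i v * v i.
  by rewrite mulr_sumr; apply: eq_bigr => i _; rewrite /c mulrAC mulrC.
by rewrite exprMn nrm2// mulrC ler_pdivlMr.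
Qed.

End events.

Notation arw_index n p := ('I_n + 'I_p + 'I_n * 'I_p)%type.

Section arw_law.
Context (R : realType) (d : measure_display) (T : measurableType d).
Context (P : probability T R) (n p : nat) (eps t : R).
Context (ell : 'I_n -> {RV P >-> R}) (mu : 'I_p -> {RV P >-> R})
  (Z : 'I_n -> 'I_p -> {RV P >-> R}).
Local Notation V := (coordsType R (arw_index n p)).

Definition arw_coords (w : T) : V := fun k => arw_variable ell mu Z k w.

Lemma measurable_arw_coords : measurable_fun setT arw_coords.
Proof. by apply: measurable_fun_coords => k; exact: measurable_funP. Qed.

(** Mutual independence over all indices, divided by that over all indices but [k], is the
    factorisation required by [resamples]. *)
Lemma arw_law : arw_model eps t ell mu Z -> exists Q : probability V R,
  [/\ (forall B, measurable B -> Q B = P (arw_coords @^-1` B)),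
      (forall ij, gaussian Q (inr ij)) &
      (forall j, exists2 L, resamples Q (inl (inr j)) L & L [set t] = eps%:E)].
Proof.
move=> H.
pose X : {RV P >-> V} := HB.pack arw_coords (isMeasurableFun.Build _ _ _ _ _ measurable_arw_coords).
exists (distribution P X).
have res k (L : probability (measurableTypeR R) R) :
    (forall B, measurable B -> L B = P (arw_variable ell mu Z k @^-1` B)) ->
    resamples (distribution P X) k L.
  move=> Lk B mB.
  have e1 := arw_indep H [set: arw_index n p]%SET mB.
  have e2 := arw_indep H [set~ k]%SET mB.
  set S1 := [set w | _] in e1; set S2 := [set w | _] in e2.
  have E : P S1 = (P S2 * L (B k))%E.
    rewrite e1 e2 (Lk _ (mB k)) (bigD1 k) ?inE//= muleC; congr (_ * _)%E.
    by apply: eq_bigl => i; rewrite !inE.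
  apply: etrans (etrans E _).
    rewrite /distribution/pushforward; congr (P _); apply/seteqP; split => w /= h i //.
    by apply: h; rewrite inE.
  congr (_ * _)%E; rewrite /distribution/pushforward; congr (P _).
  apply/seteqP; split => w /= h i hi.
    by apply: h; rewrite !inE.
  by apply: h; move: hi; rewrite !inE.
split.
- by [].
- move=> [i j]; apply: res => B mB.
  exact: esym (arw_Z_normal H i j mB).
- move=> j.
  pose muj : {RV P >-> measurableTypeR R} :=
    HB.pack (mu j : T -> measurableTypeR R)
      (isMeasurableFun.Build _ _ T (measurableTypeR R) _ (measurable_funP (mu j))).
  exists (distribution P muj); first by apply: res.
  exact: arw_mu_signal H j.
Qed.

Lemma whp_two_points (X : {RV P >-> R}) (a b : R) (x : R) : a != b ->
  P [set w | X w = a] = x%:E -> P [set w | X w = b] = (1 - x)%:E ->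
  whp P 0 (fun w => X w = a \/ X w = b).
Proof.
move=> ab Pa Pb.
have mX c : measurable [set w | X w = c].
  by have := measurable_funP X measurableT [set c] (measurable_set1 c); rewrite setTI.
apply: (@whp_measurable _ _ _ P 0 ([set w | X w = a] `|` [set w | X w = b])).
  exact: measurableU (mX a) (mX b).
rewrite probability_setC; last exact: measurableU.
rewrite measureU//; last first.
  by apply/seteqP; split => w //= [-> /eqP]; rewrite (negbTE ab).
by rewrite [X in (_ - (X + _))%E]Pa [X in (_ - (_ + X))%E]Pb -EFinD subrKC subrr.
Qed.

Lemma arw_two_valued : t != 0 -> arw_model eps t ell mu Z ->
  whp P 0 (fun w => (forall i, ell i w ^+ 2 = 1) /\ (forall j, mu j w = 0 \/ mu j w = t)).
Proof.
move=> t0 H.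
have hell i : whp P 0 (fun w => ell i w ^+ 2 = 1).
  have h : (-1 : R) != 1 by rewrite lt_eqF//; lra.
  apply: (whp_weaken (whp_two_points (X := ell i) (x := 1 / 2) h _ _)) => //.
  - exact: arw_ell_neg H i.
  - by rewrite (_ : 1 - 1 / 2 = 1 / 2); [exact: arw_ell_pos H i|lra].
  - by move=> w [->|->]; rewrite ?sqrrN expr1n.
have hmu j : whp P 0 (fun w => mu j w = 0 \/ mu j w = t).
  have h := whp_two_points t0 (arw_mu_signal H j) (arw_mu_null H j).
  by apply: (whp_weaken h) => // w [->|->]; [right|left].
by apply: (whp_weaken (whp_and (whp_forall hell) (whp_forall hmu))); rewrite ?mulr0 ?addr0.
Qed.

End arw_law.

(** * Net argument for the spectrum of the noise *)

Section net.
Context (R : realType) (n p : nat).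

(** The net is the cubic grid of mesh [1 / N] in [[-1, 1]^n]. For [N] polynomial in [p], the
    logarithm of its size [(2 * N + 1) ^ n] is only of order [n * log p]. *)
Definition grid_vector (N : nat) (g : {ffun 'I_n -> 'I_(2 * N).+1}) : 'cV[R]_n :=
  \col_i ((g i)%:R / N%:R - 1).

Lemma grid_approx (N : nat) (x : R) : (0 < N)%N -> `|x| <= 1 ->
  exists k : 'I_(2 * N).+1, 0 <= x - (k%:R / N%:R - 1) <= N%:R^-1.
Proof.
move=> N0; rewrite ler_norml => /andP[x1 x2].
have NR : 0 < (N%:R : R) by rewrite ltr0n.
have y0 : 0 <= N%:R * (x + 1) by rewrite mulr_ge0 ?(ltW NR)//; lra.
have /andP[t1 t2] := truncn_itv y0.
have tN : (Num.truncn (N%:R * (x + 1)) < (2 * N).+1)%N.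
  rewrite ltnS -(ler_nat R) (le_trans t1)// natrM.
  have : N%:R * (x + 1) <= N%:R * 2 by rewrite ler_pM2l//; lra.
  by rewrite (mulrC 2).
exists (Ordinal tN) => /=; set k := Num.truncn _ in t1 t2 *.
have -> : x - (k%:R / N%:R - 1) = (N%:R * (x + 1) - k%:R) / N%:R.
  by field; rewrite gt_eqF.
apply/andP; split; first by rewrite divr_ge0 ?subr_ge0 ?(ltW NR).
rewrite ler_pdivrMr// mulVf ?gt_eqF//; move: t2; rewrite -natr1; lra.
Qed.

Lemma norm_dot_le (x y : 'cV[R]_n) (a b : R) : 0 <= a -> 0 <= b ->
  (forall i, `|x i 0| <= a) -> (forall i, `|y i 0| <= b) -> `|dot x y| <= n%:R * (a * b).
Proof.
move=> a0 b0 xa yb; apply: le_trans (ler_norm_sum _ _ _) _.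
apply: (@le_trans _ _ (\sum_(i < n) a * b)).
  by apply: ler_sum => i _; rewrite normrM ler_pM.
by rewrite sumr_const card_ord mulr_natl.
Qed.

(** At mesh [1 / (9 * p ^ 5)] the entrywise bound on [Z] suffices to pass from the grid to the
    sphere, and the error is absorbed by doubling [kap]. *)
Lemma net_spectrum (Z : 'M[R]_(n, p)) (N : nat) (D kap : R) :
  (0 < N)%N -> (n <= p)%N -> 1 <= D <= p%:R -> 1 <= kap <= p%:R ->
  9 * (p%:R : R) ^+ 5 <= N%:R -> (forall i j, `|Z i j| <= D) ->
  (forall g : {ffun 'I_n -> 'I_(2 * N).+1}, `|dot (Z^T *m grid_vector g) (Z^T *m grid_vector g) -
     p%:R * dot (grid_vector g) (grid_vector g)| <=
     kap * dot (grid_vector g) (grid_vector g)) ->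
  forall x, `|dot (Z^T *m x) (Z^T *m x) - p%:R * dot x x| <= 2 * kap * dot x x.
Proof.
move=> N0 np /andP[D1 Dp] /andP[k1 kp] Np ZD Hg.
have NR : 0 < (N%:R : R) by rewrite ltr0n.
have p1 : 1 <= (p%:R : R) by apply: le_trans Dp.
have npR : (n%:R : R) <= p%:R by rewrite ler_nat.
have unit x : dot x x = 1 -> `|dot (Z^T *m x) (Z^T *m x) - p%:R * dot x x| <= 2 * kap * dot x x.
  move=> x1.
  have xi i : `|x i 0| <= 1.
    rewrite -(@expr_le1 _ 2)// real_normK ?num_real//.
    rewrite -x1 /dot (bigD1 i)//= -expr2 lerDl sumr_ge0// => k _.
    by rewrite -expr2 sqr_ge0.
  have /choice[g0 hg0] := fun i => grid_approx N0 (xi i).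
  pose g := [ffun i => g0 i].
  set y := grid_vector g.
  have dxy i : `|(x - y) i 0| <= N%:R^-1.
    have := hg0 i; rewrite !mxE ffunE => /andP[h1 h2].
    by rewrite ger0_norm.
  have N1 : (N%:R : R)^-1 <= 1 by rewrite invf_le1// ler1n.
  have sxy i : `|(x + y) i 0| <= 3.
    have : `|2 * x i 0 - (x - y) i 0| <= 3.
      apply: le_trans (ler_normB _ _) _; have := dxy i; have := xi i.
      by rewrite normrM ger0_norm//; lra.
    by rewrite !mxE; congr (`|_| <= _); lra.
  (* Difference of squares, [|x|^2 - |y|^2 = <x - y, x + y>], for the vectors and for their images
     under [Z^T]. *)
  have cross a b c : dot (Z^T *m (x - y)) (Z^T *m (x + y)) = a -> dot (x - y) (x + y) = b ->
      c = kap * dot y y -> `|a| <= p%:R * (n%:R * (D * N%:R^-1) * (n%:R * (D * 3))) ->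
      `|b| <= n%:R * (N%:R^-1 * 3) ->
      `|dot (Z^T *m x) (Z^T *m x) - p%:R * dot x x| <= `|a| + p%:R * `|b| + kap * (dot x x + `|b|).
    move=> ha hb hc _ _.
    have ea : dot (Z^T *m x) (Z^T *m x) = dot (Z^T *m y) (Z^T *m y) + a.
      rewrite -ha mulmxBr mulmxDr dotBl !dotDr (dotC (Z^T *m y) (Z^T *m x)); ring.
    have eb : dot x x = dot y y + b.
      by rewrite -hb dotBl !dotDr (dotC y x); ring.
    have h := Hg g; rewrite -/y in h.
    rewrite ea eb.
    have -> : dot (Z^T *m y) (Z^T *m y) + a - p%:R * (dot y y + b) =
      (dot (Z^T *m y) (Z^T *m y) - p%:R * dot y y) + (a - p%:R * b) by ring.
    apply: le_trans (ler_normD _ _) _; rewrite addrC; apply: lerD.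
      by apply: le_trans (ler_normB _ _) _; rewrite normrM ger0_norm.
    apply: le_trans h _; rewrite ler_wpM2l ?(le_trans _ k1)//.
    by have := ler_norm (- b); rewrite normrN; lra.
  have Ni0 : 0 <= (N%:R : R)^-1 by rewrite invr_ge0 ltW.
  have D0 : 0 <= D by apply: le_trans D1.
  have hb : `|dot (x - y) (x + y)| <= n%:R * (N%:R^-1 * 3).
    exact: norm_dot_le.
  have row_le (u : 'cV[R]_n) (e : R) : 0 <= e -> (forall i, `|u i 0| <= e) ->
      forall j, `|(Z^T *m u) j 0| <= n%:R * (D * e).
    move=> e0 ue j.
    have -> : (Z^T *m u) j 0 = dot (col j Z) u.
      by rewrite mxE; apply: eq_bigr => i _; rewrite !mxE.
    by apply: norm_dot_le => // i; rewrite mxE; exact: ZD.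
  have ha : `|dot (Z^T *m (x - y)) (Z^T *m (x + y))| <= p%:R * (n%:R * (D * N%:R^-1) * (n%:R * (D * 3))).
    apply: le_trans (ler_norm_sum _ _ _) _.
    apply: (@le_trans _ _ (\sum_(j < p) n%:R * (D * N%:R^-1) * (n%:R * (D * 3)))).
      by apply: ler_sum => j _; rewrite normrM; apply: ler_pM => //; apply: row_le.
    by rewrite sumr_const card_ord -[leLHS]mulr_natl.
  apply: le_trans (cross _ _ _ erefl erefl erefl ha hb) _.
  rewrite x1 mulr1; set q : R := p%:R in p1 Dp kp Np npR ha *; set e := N%:R^-1 in Ni0 ha hb *.
  have q0 : 0 <= q by apply: le_trans p1.
  have qe : 9 * (q ^+ 5 * e) <= 1.
    by rewrite mulrA /e ler_pdivrMr// mul1r.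
  have q25 : q ^+ 2 * e <= q ^+ 5 * e by rewrite ler_wpM2r// ler_weXn2l.
  have b2 : q * (n%:R * (e * 3)) <= 3 * (q ^+ 2 * e).
    have -> : 3 * (q ^+ 2 * e) = q * (q * (e * 3)) by ring.
    by rewrite ler_wpM2l// ler_wpM2r// mulr_ge0.
  have b3 : kap * (n%:R * (e * 3)) <= q * (n%:R * (e * 3)).
    by rewrite ler_wpM2r// !mulr_ge0.
  have a2 : q * (n%:R * (D * e) * (n%:R * (D * 3))) <= 3 * (q ^+ 5 * e).
    have -> : 3 * (q ^+ 5 * e) = q * (q * (q * e) * (q * (q * 3))) by ring.
    rewrite ler_wpM2l//; apply: ler_pM; rewrite ?mulr_ge0//.
      by apply: ler_pM; rewrite ?mulr_ge0// ler_wpM2r.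
    by apply: ler_pM; rewrite ?mulr_ge0// ler_wpM2r.
  have b4 : q * `|dot (x - y) (x + y)| <= q * (n%:R * (e * 3)) by rewrite ler_wpM2l.
  have b5 : kap * `|dot (x - y) (x + y)| <= kap * (n%:R * (e * 3)).
    by rewrite ler_wpM2l// (le_trans _ k1).
  (* Each of the three errors is at most [3 * p ^ 5 / N <= 1 / 3], so together they are at most
     [1 <= kap]. *)
  by rewrite mulrDr mulr1; lra.
have n0 : 0 <= (n%:R : R) by [].
move=> x.
have [->|x0] := eqVneq x 0.
  by rewrite mulmx0 -(scale0r (0 : 'cV[R]_p)) -(scale0r (0 : 'cV[R]_n)) !dotZl !mul0r !mulr0 subrr normr0.
have xx := dot_gt0 x0.
pose s := Num.sqrt (dot x x).
have s2 : s ^+ 2 = dot x x by rewrite sqr_sqrtr// ltW.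
have s0 : 0 < s by rewrite sqrtr_gt0.
have h : dot (s^-1 *: x) (s^-1 *: x) = 1.
  by rewrite dotZl dotZr mulrA -expr2 exprVn s2 mulVf// gt_eqF.
have := unit _ h; rewrite h !mulr1 -scalemxAr dotZl dotZr mulrA -expr2 exprVn s2.
set a := dot (Z^T *m x) _; set b := dot x x in xx *.
have -> : a - p%:R * b = (b^-1 * a - p%:R) * b by field; rewrite gt_eqF.
by rewrite normrM (gtr0_norm xx) ler_pM2r.
Qed.

End net.

Lemma eq_measurable_coords (R : realType) (I : finType) (f g : coordsType R I -> R) :
  f =1 g -> measurable_fun setT g -> measurable_fun setT f.
Proof. by move=> /funext ->. Qed.

Section arw_events.
Context (R : realType) (n p : nat).
Local Notation V := (coordsType R (arw_index n p)).
Variable Q : probability V R.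
Hypothesis Zgauss : forall ij, gaussian Q (inr ij).

Definition ell_of (v : V) : 'cV[R]_n := \col_i v (inl (inl i)).
Definition mu_of (v : V) : 'cV[R]_p := \col_j v (inl (inr j)).
Definition noise_of (v : V) : 'M[R]_(n, p) := \matrix_(i, j) v (inr (i, j)).
Definition data_of (v : V) : 'M[R]_(n, p) := ell_of v *m (mu_of v)^T + noise_of v.

Definition mx_measurable a b (M : V -> 'M[R]_(a, b)) :=
  forall i j, measurable_fun setT (fun v => M v i j).

Lemma mx_measurableM a b c (M : V -> 'M[R]_(a, b)) (N : V -> 'M[R]_(b, c)) :
  mx_measurable M -> mx_measurable N -> mx_measurable (fun v => M v *m N v).
Proof.
move=> mM mN i j.
apply: (@eq_measurable_coords _ _ _ (fun v => \sum_k M v i k * N v k j)) => [v|].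
  by rewrite mxE.
by apply: measurable_sum => k; apply: measurable_funM.
Qed.

Lemma mx_measurable_tr a b (M : V -> 'M[R]_(a, b)) :
  mx_measurable M -> mx_measurable (fun v => (M v)^T).
Proof.
by move=> mM i j; apply: (@eq_measurable_coords _ _ _ (fun v => M v j i)) => // v; rewrite mxE.
Qed.

Lemma mx_measurable_zrow q i (M : V -> 'M[R]_(n, q)) :
  mx_measurable M -> mx_measurable (fun v => zrow i (M v)).
Proof.
move=> mM k j.
apply: (@eq_measurable_coords _ _ _ (fun v => if k == i then 0 else M v k j)) => [v|].
  by rewrite mxE.
by case: eqP => _; [exact: measurable_cst|exact: mM].
Qed.

Lemma mx_measurable_ell : mx_measurable ell_of.
Proof.
move=> i j; apply: (@eq_measurable_coords _ _ _ (fun v => v (inl (inl i)))) => [v|].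
  by rewrite mxE.
exact: measurable_coord.
Qed.

Lemma mx_measurable_mu : mx_measurable mu_of.
Proof.
move=> i j; apply: (@eq_measurable_coords _ _ _ (fun v => v (inl (inr i)))) => [v|].
  by rewrite mxE.
exact: measurable_coord.
Qed.

Lemma mx_measurable_data : mx_measurable data_of.
Proof.
move=> i j; apply: (@eq_measurable_coords _ _ _
    (fun v => (ell_of v *m (mu_of v)^T) i j + v (inr (i, j)))) => [v|].
  by rewrite mxE [X in _ + X = _]mxE.
apply: measurable_funD; last exact: measurable_coord.
apply: mx_measurableM; first exact: mx_measurable_ell.
by apply: mx_measurable_tr; exact: mx_measurable_mu.
Qed.

Lemma mx_measurable_loo i k : mx_measurable (fun v => loo_iter (data_of v) (ell_of v) i k).
Proof.
elim: k => [|k IH]; first by apply: mx_measurable_zrow; exact: mx_measurable_ell.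
have mz := mx_measurable_zrow i mx_measurable_data.
apply: (mx_measurableM mz); apply: mx_measurableM IH.
exact: mx_measurable_tr.
Qed.

Lemma free_of_zrow_data i j : free_of (inr (i, j)) (fun v : V => zrow i (data_of v)).
Proof.
move=> v r; apply/matrixP => a b; rewrite !mxE; case: eqP => // /eqP ai.
congr (_ + _).
by rewrite /upd; case: eqP => // -[ai']; rewrite ai' eqxx in ai.
Qed.

Lemma free_of_loo i j k :
  free_of (inr (i, j)) (fun v : V => loo_iter (data_of v) (ell_of v) i k).
Proof.
move=> v r; rewrite /loo_iter free_of_zrow_data.
by congr (power_iter _ (zrow _ _) _); apply/matrixP => a b; rewrite !mxE.
Qed.

(** Self-normalised bound with row [i] of the noise as the Gaussian block; the coefficients may
    depend on everything outside that row. *)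
Lemma whp_row_linear (i : 'I_n) (y : 'I_p -> V -> R) (t : R) : 0 <= t ->
  (forall j, measurable_fun setT (y j)) ->
  (forall j k, free_of (inr (i, j)) (y k)) ->
  whp Q (2 * expR (- (t ^+ 2 / 2))) (fun v =>
    0 < \sum_j y j v ^+ 2 ->
    (\sum_j y j v * v (inr (i, j))) ^+ 2 < t ^+ 2 * \sum_j y j v ^+ 2).
Proof.
move=> t0 my fy.
pose s := [seq (inr (i, j) : arw_index n p) | j <- enum 'I_p].
(* Label and mean indices do not occur in [s]; their coefficient is a default value. *)
pose y' (k : arw_index n p) (v : V) := if k is inr ij then y ij.2 v else 0.
have sumE (F : arw_index n p -> R) : \sum_(k <- s) F k = \sum_j F (inr (i, j)).
  by rewrite big_map big_enum.
have in_s k : k \in s -> exists j, k = inr (i, j).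
  by move=> /mapP[j _ ->]; exists j.
have us : uniq s by rewrite map_inj_uniq ?enum_uniq// => a b [].
have := @whp_self_normalized R _ Q s y' t us _ _ _ t0; move=> H.
apply: (whp_weaken (H _ _ _)) => //.
- by move=> k /in_s[j ->]; exact: Zgauss.
- by move=> k /in_s[j ->]; exact: my.
- by move=> k k' /in_s[j ->] /in_s[j' ->]; exact: fy.
- by move=> v; rewrite !sumE.
Qed.

Lemma whp_col_linear (j : 'I_p) (y : 'I_n -> V -> R) (t : R) : 0 <= t ->
  (forall i, measurable_fun setT (y i)) ->
  (forall i k, free_of (inr (i, j)) (y k)) ->
  whp Q (2 * expR (- (t ^+ 2 / 2))) (fun v =>
    0 < \sum_i y i v ^+ 2 ->
    (\sum_i y i v * v (inr (i, j))) ^+ 2 < t ^+ 2 * \sum_i y i v ^+ 2).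
Proof.
move=> t0 my fy.
pose s := [seq (inr (i, j) : arw_index n p) | i <- enum 'I_n].
pose y' (k : arw_index n p) (v : V) := if k is inr ij then y ij.1 v else 0.
have sumE (F : arw_index n p -> R) : \sum_(k <- s) F k = \sum_i F (inr (i, j)).
  by rewrite big_map big_enum.
have in_s k : k \in s -> exists i, k = inr (i, j).
  by move=> /mapP[i _ ->]; exists i.
have us : uniq s by rewrite map_inj_uniq ?enum_uniq// => a b [].
have := @whp_self_normalized R _ Q s y' t us _ _ _ t0; move=> H.
apply: (whp_weaken (H _ _ _)) => //.
- by move=> k /in_s[i ->]; exact: Zgauss.
- by move=> k /in_s[i ->]; exact: my.
- by move=> k k' /in_s[i ->] /in_s[i' ->]; exact: fy.
- by move=> v; rewrite !sumE.
Qed.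

Lemma whp_entries (D : R) : 0 <= D ->
  whp Q (n%:R * (p%:R * (2 * expR (- (D ^+ 2 / 2)))))
    (fun v => forall i j, `|noise_of v i j| <= D).
Proof.
move=> D0.
have h i j : whp Q (2 * expR (- (D ^+ 2 / 2))) (fun v => `|noise_of v i j| <= D).
  have := @whp_row_linear i (fun k => fun=> (k == j)%:R) D D0.
  move=> /(_ (fun _ => measurable_cst _) (fun _ _ _ _ => erefl)).
  move=> H; apply: (whp_weaken H) => // v.
  have -> : \sum_j0 (j0 == j)%:R ^+ 2 = 1 :> R.
    by rewrite (bigD1 j)//= eqxx expr1n big1 ?addr0// => k /negbTE ->; rewrite expr0n.
  have -> : \sum_j0 (j0 == j)%:R * v (inr (i, j0)) = noise_of v i j.
    rewrite (bigD1 j)//= eqxx mul1r big1 ?addr0 ?mxE// => k /negbTE ->.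
    by rewrite mul0r.
  move=> /(_ ltr01); rewrite mulr1 => /ltW h.
  by rewrite -(@ler_pXn2r _ 2)// ?nnegrE// real_normK ?num_real.
have := whp_forall (fun i => whp_forall (h i)).
by rewrite !card_ord.
Qed.

Lemma whp_noise_mu (D : R) : 0 <= D ->
  whp Q (n%:R * (2 * expR (- (D ^+ 2 / 2)))) (fun v =>
    0 < dot (mu_of v) (mu_of v) ->
    dot (noise_of v *m mu_of v) (noise_of v *m mu_of v)
      <= n%:R * dot (mu_of v) (mu_of v) * D ^+ 2).
Proof.
move=> D0.
have H i := @whp_row_linear i (fun j v => v (inl (inr j))) D D0
  (fun j => measurable_coord _) (fun _ _ _ _ => erefl).
have := whp_forall H; rewrite card_ord => {}H.
apply: (whp_weaken H) => // v hv m0.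
have mE : \sum_j v (inl (inr j)) ^+ 2 = dot (mu_of v) (mu_of v).
  by apply: eq_bigr => j _; rewrite mxE expr2.
rewrite {1}/dot -mulrA mulr_natl.
have -> : (dot (mu_of v) (mu_of v) * D ^+ 2) *+ n =
    \sum_(i < n) dot (mu_of v) (mu_of v) * D ^+ 2 by rewrite sumr_const card_ord.
apply: ler_sum => i _; rewrite -expr2 mxE.
have := hv i; rewrite mE => /(_ m0) /ltW; rewrite mulrC; apply: le_trans.
by rewrite le_eqVlt; apply/orP; left; apply/eqP; congr (_ ^+ 2); apply: eq_bigr => j _;
  rewrite !mxE mulrC.
Qed.

Lemma whp_loo (D : R) (K : nat) : 0 <= D ->
  whp Q (n%:R * (K%:R * (2 * expR (- (D ^+ 2 / 2))))) (fun v =>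
    forall i k, (k < K)%N ->
    dot (row i (noise_of v))^T ((zrow i (data_of v))^T *m loo_iter (data_of v) (ell_of v) i k) ^+ 2 <=
    D ^+ 2 * dot ((zrow i (data_of v))^T *m loo_iter (data_of v) (ell_of v) i k)
                 ((zrow i (data_of v))^T *m loo_iter (data_of v) (ell_of v) i k)).
Proof.
move=> D0.
pose y i k (v : V) := (zrow i (data_of v))^T *m loo_iter (data_of v) (ell_of v) i k.
have H i (k : 'I_K) := @whp_row_linear i (fun j v => y i k v j 0) D D0.
have {}H i (k : 'I_K) : whp Q (2 * expR (- (D ^+ 2 / 2))) (fun v =>
    dot (row i (noise_of v))^T (y i k v) ^+ 2 <= D ^+ 2 * dot (y i k v) (y i k v)).
  apply: (whp_weaken (H i k _ _)) => //.
  - move=> j; apply: mx_measurableM; last exact: mx_measurable_loo.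
    by apply: mx_measurable_tr; apply: mx_measurable_zrow; exact: mx_measurable_data.
  - by move=> j j' v r; rewrite /y free_of_loo free_of_zrow_data.
  - move=> v.
    have -> : \sum_j y i k v j 0 ^+ 2 = dot (y i k v) (y i k v).
      by apply: eq_bigr => j _; rewrite expr2.
    have -> : \sum_j y i k v j 0 * v (inr (i, j)) = dot (row i (noise_of v))^T (y i k v).
      by apply: eq_bigr => j _; rewrite !mxE mulrC.
    have [y0 h|y0 _] := ltP 0 (dot (y i k v) (y i k v)); first by apply: ltW; exact: h.
    have -> : y i k v = 0 by apply: dot_eq0; apply/eqP; rewrite eq_le y0 dot_ge0.
    by rewrite -(scale0r (0 : 'cV[R]_p)) !dotZr !mul0r expr0n/= mulr0.
have := whp_forall (fun i => whp_forall (H i)); rewrite !card_ord => {}H.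
by apply: (whp_weaken H) => // v hv i k kK; exact: (hv i (Ordinal kK)).
Qed.

End arw_events.

Lemma whp_chi2 (R : realType) (I K : finType) (Q : probability (coordsType R I) R)
    (s : K -> seq I) (c : I -> R) (kap : R) :
  (forall k, uniq (s k)) -> (forall k i, i \in s k -> gaussian Q i) ->
  (forall k k' i, i \in s k -> i \in s k' -> k = k') ->
  (forall k, \sum_(i <- s k) c i ^+ 2 = 1) ->
  (0 < #|K|)%N -> 0 <= kap <= #|K|%:R / 2 ->
  whp Q (2 * expR (- (kap ^+ 2 / (10 * #|K|%:R))))
    (fun v => `|\sum_k (\sum_(i <- s k) c i * v i) ^+ 2 - #|K|%:R| < kap).
Proof.
move=> us Gs ds cs K0 hk; rewrite cardE in K0 hk *.
have := @gaussian_chi2_tail R I Q K (enum K) s c kap (enum_uniq _) (fun k _ => us k)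
  (fun k i _ => Gs k i) (fun k k' i _ _ => ds k k' i) (fun k _ => cs k) K0 hk.
move=> H; apply: (whp_compl _ H).
  apply: measurable_ler_fun => //; apply: measurableT_comp => //.
  apply: measurable_funB => //; apply: measurable_sum => k; apply: measurable_funX.
  by apply: measurable_sum => i; apply: measurable_funM => //; exact: measurable_coord.
by move=> v /negP; rewrite -leNgt/= big_enum.
Qed.

Section arw_spectrum.
Context (R : realType) (n p : nat).
Local Notation V := (coordsType R (arw_index n p)).
Variable Q : probability V R.
Hypothesis Zgauss : forall ij, gaussian Q (inr ij).

(** For fixed [c] the entries of [Z^T c] come from distinct columns, so they are independent centred
    normals of variance [|c|^2]: one block per column after scaling. *)
Lemma whp_quadratic_form (c : 'cV[R]_n) (kap : R) : (0 < p)%N -> 0 <= kap <= p%:R / 2 ->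
  whp Q (2 * expR (- (kap ^+ 2 / (10 * p%:R)))) (fun v =>
    `|dot ((noise_of v)^T *m c) ((noise_of v)^T *m c) - p%:R * dot c c| <= kap * dot c c).
Proof.
move=> p0 hk; have [->|c0] := eqVneq c 0.
  apply: (@whp_compl _ _ _ _ _ _ set0) => //.
    by rewrite measure0 lee_fin mulr_ge0 ?expR_ge0.
  move=> v []; rewrite mulmx0 -(scale0r (0 : 'cV[R]_p)) -(scale0r (0 : 'cV[R]_n)).
  by rewrite !dotZl !mul0r !mulr0 subrr normr0.
have cc := dot_gt0 c0.
pose t := Num.sqrt (dot c c).
have t2 : t ^+ 2 = dot c c by rewrite sqr_sqrtr// ltW.
have t0 : 0 < t by rewrite sqrtr_gt0.
pose s j := [seq (inr (i, j) : arw_index n p) | i <- enum 'I_n].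
pose c' (k : arw_index n p) := if k is inr ij then c ij.1 0 / t else 0.
have := @whp_chi2 R _ 'I_p Q s c' kap; rewrite card_ord => H.
apply: (whp_weaken (H _ _ _ _ p0 hk)) => //.
- by move=> j; rewrite map_inj_uniq ?enum_uniq// => a b [].
- by move=> j k /mapP[i _ ->]; exact: Zgauss.
- by move=> j j' k /mapP[i _ ->] /mapP[i' _ [_ ->]].
- move=> j; rewrite big_map big_enum/=.
  under eq_bigr do rewrite exprMn expr2.
  by rewrite -mulr_suml exprVn t2 -/(dot c c) mulfV// gt_eqF.
move=> v.
have -> : \sum_j (\sum_(i <- s j) c' i * v i) ^+ 2 =
    dot ((noise_of v)^T *m c) ((noise_of v)^T *m c) / dot c c.
  rewrite mulr_suml; apply: eq_bigr => j _; rewrite big_map big_enum/=.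
  have -> : \sum_i c i 0 / t * v (inr (i, j)) = ((noise_of v)^T *m c) j 0 / t.
    by rewrite mxE mulr_suml; apply: eq_bigr => i _; rewrite !mxE; ring.
  by rewrite exprMn exprVn t2 expr2.
set a := dot (_ *m c) _; move=> /ltW h.
have -> : a - p%:R * dot c c = (a / dot c c - p%:R) * dot c c by field; rewrite gt_eqF.
by rewrite normrM (gtr0_norm cc) ler_pM2r.
Qed.

Lemma whp_spectrum (N : nat) (D kap : R) :
  (0 < N)%N -> (0 < p)%N -> (n <= p)%N -> 1 <= D <= p%:R -> 1 <= kap <= p%:R / 2 ->
  9 * (p%:R : R) ^+ 5 <= N%:R ->
  whp Q (n%:R * (p%:R * (2 * expR (- (D ^+ 2 / 2)))) +
      ((2 * N).+1 ^ n)%:R * (2 * expR (- (kap ^+ 2 / (10 * p%:R))))) (fun v =>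
    forall x, `|dot ((noise_of v)^T *m x) ((noise_of v)^T *m x) - p%:R * dot x x|
      <= 2 * kap * dot x x).
Proof.
move=> N0 p0 np hD hk hN; have /andP[D1 _] := hD; have /andP[k1 kp] := hk.
have p0R : 0 < (p%:R : R) by rewrite ltr0n.
have hk' : 0 <= kap <= p%:R / 2 by rewrite kp (le_trans _ k1).
have H1 := whp_entries Zgauss (le_trans ler01 D1).
have H2 := whp_forall (fun g : {ffun 'I_n -> 'I_(2 * N).+1} =>
  whp_quadratic_form (grid_vector R g) p0 hk').
rewrite card_ffun !card_ord in H2.
apply: (whp_weaken (whp_and H1 H2)) => // v [h1 h2].
apply: (net_spectrum N0 np hD) => //.
by rewrite k1 (le_trans kp)//; lra.
Qed.

Lemma whp_col_chi2 (j : 'I_p) (kap : R) : (0 < n)%N -> 0 <= kap <= n%:R / 2 ->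
  whp Q (2 * expR (- (kap ^+ 2 / (10 * n%:R)))) (fun v =>
    `|\sum_i noise_of v i j ^+ 2 - n%:R| < kap).
Proof.
move=> n0 hk.
pose s (i : 'I_n) := [:: inr (i, j) : arw_index n p].
have := @whp_chi2 R _ 'I_n Q s (fun=> 1) kap; rewrite card_ord => H.
apply: (whp_weaken (H _ _ _ _ n0 hk)) => //.
- by move=> i k; rewrite inE => /eqP ->.
- by move=> i i' k; rewrite !inE => /eqP -> /eqP[].
- by move=> i; rewrite big_seq1 expr1n.
move=> v; rewrite (eq_bigr (fun i => noise_of v i j ^+ 2))// => i _.
by rewrite big_seq1 mul1r mxE.
Qed.

Lemma whp_count (L : 'I_p -> probability (measurableTypeR R) R) (t eps : R) :
  (forall j, resamples Q (inl (inr j)) (L j)) -> (forall j, L j [set t] = eps%:E) ->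
  whp Q (expR (- (p%:R * eps / 6))) (fun v =>
    p%:R * eps / 4 < \sum_j (mu_of v j 0 == t)%:R).
Proof.
move=> HL Lt.
pose s := [seq (inl (inr j) : arw_index n p) | j <- enum 'I_p].
have ss : size s = p by rewrite size_map size_enum_ord.
(* The normal law only fills the indices that do not occur in [s]. *)
pose L' (k : arw_index n p) : probability (measurableTypeR R) R :=
  if k is inl (inr j) then L j else (@normal_prob R 0 1 : probability (measurableTypeR R) R).
have us : uniq s by rewrite map_inj_uniq ?enum_uniq// => a b [].
have := @bernoulli_count_tail R _ Q s L' t eps us.
rewrite ss; move=> H; apply: (whp_compl _ (H _ _)).
- apply: measurable_ler_fun => //; apply: measurable_sum => i.
  exact: measurable_coord_eq.
- by move=> k /mapP[j _ ->].
- by move=> k /mapP[j _ ->]; exact: Lt.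
move=> v /negP; rewrite -leNgt/= big_map big_enum/=.
by under eq_bigr do rewrite mxE.
Qed.

(** On the coordinate space labels are arbitrary reals, so their being signs is a premise inside the
    event, supplied later by [arw_two_valued]. *)
Lemma whp_projection (j : 'I_p) (t : R) : 0 <= t -> (0 < n)%N ->
  whp Q (2 * expR (- (t ^+ 2 / 2))) (fun v =>
    (forall i, ell_of v i 0 ^+ 2 = 1) ->
    (\sum_i ell_of v i 0 * noise_of v i j) ^+ 2 < t ^+ 2 * n%:R).
Proof.
move=> t0 n0.
have H := @whp_col_linear R n p Q Zgauss j (fun i v => v (inl (inl i))) t t0
  (fun j => measurable_coord _) (fun _ _ _ _ => erefl).
apply: (whp_weaken H) => // v hv l1; move: hv.
have -> : \sum_i v (inl (inl i)) ^+ 2 = n%:R.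
  transitivity (\sum_(i < n) (1 : R)); last by rewrite sumr_const card_ord.
  by apply: eq_bigr => i _; rewrite -(l1 i) mxE.
rewrite ltr0n => /(_ n0).
by rewrite (eq_bigr (fun i => ell_of v i 0 * noise_of v i j))// => i _; rewrite !mxE.
Qed.

Lemma whp_row_sums (t : R) : 0 <= t -> (0 < p)%N ->
  whp Q (n%:R * (2 * expR (- (t ^+ 2 / 2)))) (fun v =>
    forall i, (\sum_j noise_of v i j) ^+ 2 < t ^+ 2 * p%:R).
Proof.
move=> t0 p0.
have H i := @whp_row_linear R n p Q Zgauss i (fun j => fun=> 1) t t0
  (fun j => measurable_cst _) (fun _ _ _ _ => erefl).
have := whp_forall H; rewrite card_ord => {}H.
apply: (whp_weaken H) => // v hv i; move: (hv i).
have -> : \sum_(j < p) 1 ^+ 2 = p%:R :> R.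
  by under eq_bigr do rewrite expr1n; rewrite sumr_const card_ord.
rewrite ltr0n => /(_ p0).
by rewrite (eq_bigr (fun j => noise_of v i j))// => j _; rewrite !mxE mul1r.
Qed.

End arw_spectrum.

(** * Support recovery for fixed [p] *)

Section support_recovery.
Context (R : realType) (n p : nat).
Variables (l : 'cV[R]_n) (m : 'cV[R]_p) (Z : 'M[R]_(n, p)) (tau : R) (j : 'I_p).
Let X := l *m m^T + Z.
Hypothesis l1 : forall i, l i 0 ^+ 2 = 1.
Hypothesis m01 : m j 0 = 0 \/ m j 0 = tau.
Hypothesis tau0 : 0 < tau.
Hypothesis n0 : (0 < n)%N.
Let N : R := n%:R.
Let N0 : 0 < N. Proof. by rewrite ltr0n. Qed.
Let G := \sum_i l i 0 * Z i j.

Let XE i : X i j = l i 0 * m j 0 + Z i j.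
Proof. by rewrite !mxE big_ord1 !mxE. Qed.

Let suml2 : \sum_i l i 0 ^+ 2 = N.
Proof. by rewrite (eq_bigr (fun=> 1))// sumr_const card_ord. Qed.

(** Up to sign the score is [sqrt N * m j + G / sqrt N], with noise below [t]. A signal is at least
    [2 * t], so the threshold [t] separates the two cases. *)
Lemma support_of_label_recovery (lhat : 'cV[R]_n) (t : R) : lhat = l \/ lhat = - l ->
  t = Num.sqrt (2 * ln p%:R) -> 2 * t <= Num.sqrt N * tau -> G ^+ 2 < t ^+ 2 * N ->
  (j \in support_of_label X lhat) = (m j 0 != 0).
Proof.
move=> hl tE ht hG; have sN : 0 < Num.sqrt N by rewrite sqrtr_gt0.
have sN2 : Num.sqrt N ^+ 2 = N by rewrite sqr_sqrtr// ltW.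
have t0 : 0 <= t by rewrite tE sqrtr_ge0.
have sc : `|score X lhat j 0| = `|Num.sqrt N * m j 0 + G / Num.sqrt N|.
  have e : (X^T *m l) j 0 = N * m j 0 + G.
    rewrite mxE -suml2 mulr_suml /G -big_split/=; apply: eq_bigr => i _.
    by rewrite [X^T _ _]mxE XE; ring.
  have e' : `|(X^T *m lhat) j 0| = `|N * m j 0 + G|.
    case: hl => ->; first by rewrite e.
    have -> : (X^T *m - l) j 0 = - (X^T *m l) j 0 by rewrite mulmxN mxE.
    by rewrite normrN e.
  rewrite /score mxE normrM e' -normrM; congr `|_|.
  by rewrite -[in LHS]sN2; field; rewrite gt_eqF.
have g : `|G / Num.sqrt N| < t.
  rewrite -(@ltr_pXn2r _ 2)// ?nnegrE// real_normK ?num_real// exprMn exprVn sN2.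
  by rewrite ltr_pdivrMr.
rewrite inE -tE sc; case: m01 => ->.
  by rewrite mulr0 add0r eqxx; apply/negbTE; rewrite -ltNge.
rewrite gt_eqF//=; move: g; rewrite ltr_norml => /andP[g1 g2].
by rewrite ger0_norm; lra.
Qed.

(** [kap] is the threshold before normalisation and also bounds the chi-square deviation. A signal
    adds [N * tau ^ 2], less the cross term, and this must make up for [2 * kap]. *)
Lemma support_q_recovery (q t kap : R) : t = Num.sqrt (2 * q * ln p%:R) ->
  kap = Num.sqrt (2 * N) * t -> 2 * kap + 2 * tau * (Num.sqrt N * t) <= N * tau ^+ 2 ->
  G ^+ 2 < t ^+ 2 * N -> `|\sum_i Z i j ^+ 2 - N| < kap ->
  (j \in support_q q X) = (m j 0 != 0).
Proof.
move=> tE kE hk hG hZ.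
have sN : 0 < Num.sqrt N by rewrite sqrtr_gt0.
have sN2 : Num.sqrt N ^+ 2 = N by rewrite sqr_sqrtr// ltW.
have t0 : 0 <= t by rewrite tE sqrtr_ge0.
have s2N : 0 < Num.sqrt (2 * N) by rewrite sqrtr_gt0 mulr_gt0.
have g : `|G| < Num.sqrt N * t.
  rewrite -(@ltr_pXn2r _ 2)// ?nnegrE ?mulr_ge0 ?(ltW sN)// real_normK ?num_real//.
  by rewrite exprMn sN2 mulrC.
have sumE : \sum_i X i j ^+ 2 = N * m j 0 ^+ 2 + 2 * m j 0 * G + \sum_i Z i j ^+ 2.
  rewrite -suml2 mulr_suml /G mulr_sumr -!big_split/=; apply: eq_bigr => i _.
  by rewrite XE; ring.
rewrite inE -tE /column_stat sumE -/N mulrC ler_pdivlMr// mulrC -kE.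
move: hZ g; rewrite !ltr_norml => /andP[z1 z2] /andP[g1 g2].
case: m01 => ->.
  rewrite eqxx; apply/negbTE; rewrite -ltNge expr0n/=; lra.
rewrite gt_eqF//=.
have h : tau * (- (Num.sqrt N * t)) <= tau * G by rewrite ler_pM2l// ltW.
lra.
Qed.

Lemma label_sa_recovery (u : R) : (forall j, m j 0 = 0 \/ m j 0 = tau) ->
  (forall i, (\sum_j Z i j) ^+ 2 < u ^+ 2 * p%:R) ->
  0 <= u -> u * Num.sqrt p%:R <= tau * (\sum_j (m j 0 == tau)%:R) ->
  label_sa X = l.
Proof.
move=> mm hZ u0 hu; apply/matrixP => i k; rewrite ord1 mxE summxE.
have msum : \sum_j m j 0 = tau * (\sum_j (m j 0 == tau)%:R).
  rewrite mulr_sumr; apply: eq_bigr => j' _; case: (mm j') => ->.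
    by rewrite lt_eqF// mulr0.
  by rewrite eqxx mulr1.
have -> : \sum_j (col j X) i 0 = l i 0 * (\sum_j m j 0) + \sum_j Z i j.
  rewrite mulr_sumr -big_split/=; apply: eq_bigr => j' _.
  by rewrite !mxE big_ord1 !mxE.
have p0 : 0 <= (p%:R : R) by [].
have z : `|\sum_j Z i j| < \sum_j m j 0.
  rewrite msum; apply: lt_le_trans hu.
  rewrite -(@ltr_pXn2r _ 2)// ?nnegrE ?mulr_ge0 ?sqrtr_ge0// real_normK ?num_real//.
  by rewrite exprMn sqr_sqrtr.
have /eqP := l1 i; rewrite sqrf_eq1 => /orP[] /eqP ->.
  by move: z; rewrite ltr_norml mul1r => /andP[z1 z2]; rewrite gtr0_sg//; lra.
by move: z; rewrite ltr_norml mulN1r => /andP[z1 z2]; rewrite ltr0_sg//; lra.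
Qed.

End support_recovery.

Section arw_recovery.
Context (R : realType) (d : measure_display) (T : measurableType d).
Context (P : probability T R) (n p : nat) (eps tau : R).
Context (ell : 'I_n -> {RV P >-> R}) (mu : 'I_p -> {RV P >-> R})
  (Z : 'I_n -> 'I_p -> {RV P >-> R}).
Hypothesis model : arw_model eps tau ell mu Z.
Hypotheses (n0 : (0 < n)%N) (p0 : (0 < p)%N) (eps0 : 0 < eps) (tau01 : 0 < tau <= 1).
Let coords := arw_coords ell mu Z.
Let tau0 : 0 < tau. Proof. by case/andP: tau01. Qed.

Let dataE w : arw_data ell mu Z w = data_of (coords w).
Proof. by apply/matrixP => i j; rewrite !mxE !big_ord1 !mxE. Qed.

Let two_valued : whp P 0 (fun w => (forall i, ell_of (coords w) i 0 ^+ 2 = 1) /\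
  (forall j, mu_of (coords w) j 0 = 0 \/ mu_of (coords w) j 0 = tau)).
Proof.
have := arw_two_valued (lt0r_neq0 tau0) model.
move=> H; apply: (whp_weaken H) => // w [h1 h2]; split => [i|j]; rewrite mxE.
  exact: h1.
exact: h2.
Qed.

Lemma whp_support_q (q t kap : R) (j : 'I_p) : t = Num.sqrt (2 * q * ln p%:R) ->
  kap = Num.sqrt (2 * n%:R) * t -> kap <= n%:R / 2 ->
  2 * kap + 2 * tau * (Num.sqrt n%:R * t) <= n%:R * tau ^+ 2 ->
  whp P (2 * expR (- (kap ^+ 2 / (10 * n%:R))) + 2 * expR (- (t ^+ 2 / 2)))
    (fun w => (j \in support_q q (arw_data ell mu Z w)) = (mu j w != 0)).
Proof.
move=> tE kE kn hk; have [Q [QP Zg _]] := arw_law model.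
have t0 : 0 <= t by rewrite tE sqrtr_ge0.
have kap0 : 0 <= kap <= n%:R / 2 by rewrite kn kE mulr_ge0 ?sqrtr_ge0.
have H := whp_and (whp_col_chi2 Zg j n0 kap0) (whp_projection Zg j t0 n0).
have {}H := whp_pushforward (measurable_arw_coords ell mu Z) QP H.
apply: (whp_weaken (whp_and H two_valued)); first by rewrite addr0.
move=> w [[/= h1 h2] [l1 m01]]; rewrite dataE.
rewrite (support_q_recovery l1 (m01 j) tau0 n0 tE kE hk)//; first by rewrite mxE.
exact: h2.
Qed.

Lemma whp_support_sa (t u : R) (j : 'I_p) : t = Num.sqrt (2 * ln p%:R) ->
  2 * t <= Num.sqrt n%:R * tau -> 0 <= u ->
  u * Num.sqrt p%:R <= tau * (p%:R * eps / 4) ->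
  whp P (2 * expR (- (t ^+ 2 / 2)) + (n%:R * (2 * expR (- (u ^+ 2 / 2))) + expR (- (p%:R * eps / 6))))
    (fun w => (j \in support_sa (arw_data ell mu Z w)) = (mu j w != 0)).
Proof.
move=> tE ht u0 hu; have [Q [QP Zg Qmu]] := arw_law model.
have t0 : 0 <= t by rewrite tE sqrtr_ge0.
have /choice[L HL] : forall j, exists L, resamples Q (inl (inr j)) L /\ L [set tau] = eps%:E.
  by move=> j'; have [L] := Qmu j'; exists L.
have H := whp_and (whp_projection Zg j t0 n0) (whp_and (whp_row_sums Zg u0 p0)
  (whp_count (fun j => (HL j).1) (fun j => (HL j).2))).
have {}H := whp_pushforward (measurable_arw_coords ell mu Z) QP H.
apply: (whp_weaken (whp_and H two_valued)); first by rewrite addr0.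
move=> w [[/= h1 [h2 h3]] [l1 m01]]; rewrite dataE /support_sa.
rewrite (support_of_label_recovery l1 (m01 j) tau0 n0 _ tE ht)//; first by rewrite mxE.
  left; apply: (label_sa_recovery l1 tau0 m01 h2 u0).
  by apply: le_trans hu _; rewrite ler_pM2l// ltW.
exact: h1.
Qed.

Lemma whp_support_if (xi : 'I_n -> {RV P >-> R}) (t D kap s : R) (j : 'I_p) :
  (forall w, first_left_singular_vector (arw_data ell mu Z w) (\col_i xi i w)) ->
  t = Num.sqrt (2 * ln p%:R) -> 2 * t <= Num.sqrt n%:R * tau ->
  (8 <= n)%N -> (n <= p)%N -> 1 <= D <= p%:R -> 1 <= kap <= p%:R / 2 ->
  s = tau ^+ 2 * (p%:R * eps / 4) -> 64 * D <= Num.sqrt s -> 64 * kap <= n%:R * s ->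
  32 * D ^+ 2 * p%:R <= s ^+ 2 * n%:R ->
  whp P (2 * expR (- (t ^+ 2 / 2)) + (expR (- (p%:R * eps / 6)) +
      ((n%:R * (p%:R * (2 * expR (- (D ^+ 2 / 2)))) +
        ((2 * (9 * p ^ 5)).+1 ^ n)%:R * (2 * expR (- (kap ^+ 2 / (10 * p%:R))))) +
      (n%:R * (2 * expR (- (D ^+ 2 / 2))) +
       n%:R * (((13 * p) ^ 4)%:R * (2 * expR (- (D ^+ 2 / 2))))))))
    (fun w => (j \in support_if (\col_i xi i w) (arw_data ell mu Z w)) = (mu j w != 0)).
Proof.
move=> hxi tE ht n8 np hD hk sE Ds ks Dps; have [Q [QP Zg Qmu]] := arw_law model.
have t0 : 0 <= t by rewrite tE sqrtr_ge0.
have /choice[L HL] : forall j, exists L, resamples Q (inl (inr j)) L /\ L [set tau] = eps%:E.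
  by move=> j'; have [L] := Qmu j'; exists L.
have N0 : (0 < 9 * p ^ 5)%N by rewrite muln_gt0 expn_gt0 p0.
(* As [S >= 1], the bound [2 * S * n + p] for [lam] is at most [3 * p * S], and
   [256 * (3 * p * S) ^ 4 = (12 * p * S) ^ 4]; hence [(13 * p) ^ 4] power steps suffice. *)
have K0 : (0 < (13 * p) ^ 4)%N by rewrite expn_gt0 muln_gt0 p0.
have hN : 9 * (p%:R : R) ^+ 5 <= (9 * p ^ 5)%:R by rewrite natrM natrX.
have D0 : 0 <= D by case/andP: hD => D1 _; apply: le_trans D1.
have D1 : 1 <= D by case/andP: hD.
have H := whp_and (whp_projection Zg j t0 n0) (whp_and
  (whp_count (fun j => (HL j).1) (fun j => (HL j).2))
  (whp_and (whp_spectrum Zg N0 p0 np hD hk hN)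
    (whp_and (whp_noise_mu Zg D0) (whp_loo Zg ((13 * p) ^ 4) D0)))).
have {}H := whp_pushforward (measurable_arw_coords ell mu Z) QP H.
apply: (whp_weaken (whp_and H two_valued)); first by rewrite addr0.
move=> w [[/= h1 [h2 [h3 [h4 h5]]]] [l1 m01]]; rewrite /support_if.
have s0 : 0 < s by rewrite sE !mulr_gt0 ?exprn_gt0 ?ltr0n.
set m := mu_of (coords w) in h2 h4 h5 m01 *.
have SE : dot m m = tau ^+ 2 * \sum_j (m j 0 == tau)%:R.
  rewrite mulr_sumr; apply: eq_bigr => j' _; case: (m01 j') => ->.
    by rewrite lt_eqF// !mulr0.
  by rewrite eqxx mulr1 expr2.
have sS : s <= dot m m.
  by rewrite SE sE ler_pM2l ?exprn_gt0// ltW.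
have S0 : 0 < dot m m by apply: lt_le_trans sS.
have nR : 0 < (n%:R : R) by rewrite ltr0n.
have pR : 1 <= (p%:R : R) by rewrite ler1n.
have npR : (n%:R : R) <= p%:R by rewrite ler_nat.
rewrite dataE (support_of_label_recovery l1 (m01 j) tau0 n0 _ tE ht); first by rewrite mxE.
(* The factor 2 on [kap] comes from the net. *)
- have := @label_recovery_sign R n p (ell_of (coords w)) m (noise_of (coords w)) D (2 * kap)
    ((13 * p) ^ 4) l1 h3 (h4 S0) h5 n8 D0.
  apply => //.
  + by apply: le_trans Ds _; rewrite ler_wsqrtr.
  + rewrite mulrA (_ : 32 * 2 = 64); last by ring.
    by apply: le_trans ks _; rewrite ler_pM2l.
  + apply: le_trans Dps _; rewrite ler_pM2r//.
    by apply: lerXn2r; rewrite ?nnegrE ?(ltW s0) ?(ltW S0).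
  + have s1 : 1 <= dot m m.
      apply: le_trans sS; have : 1 <= Num.sqrt s by apply: le_trans Ds; lra.
      move=> h; have : 1 <= Num.sqrt s ^+ 2 by rewrite exprn_ege1.
      by rewrite sqr_sqrtr// ltW.
    set S := dot m m in s1 *.
    have h : 2 * S * n%:R + p%:R <= 3 * p%:R * S.
      have a1 : n%:R * S <= p%:R * S by rewrite ler_pM2r.
      have a2 : p%:R * 1 <= p%:R * S by rewrite ler_pM2l// (lt_le_trans _ pR).
      by lra.
    have x0 : 0 <= 2 * S * n%:R + p%:R by rewrite addr_ge0 ?mulr_ge0 ?(ltW S0) ?(ltW nR).
    have pS0 : 0 < p%:R * S by rewrite mulr_gt0// (lt_le_trans _ pR).
    have -> : 256 * (2 * S * n%:R + p%:R) ^+ 4 = (4 * (2 * S * n%:R + p%:R)) ^+ 4 by ring.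
    have lt13 : (4 * (2 * S * n%:R + p%:R)) ^+ 4 < (13 * p%:R * S) ^+ 4.
      by rewrite ltr_pXn2r ?nnegrE ?mulr_ge0 ?(ltW S0)//; lra.
    apply: lt_le_trans lt13 _; rewrite natrX natrM; set c := 13 * p%:R.
    have -> : c ^+ 4 * (n%:R ^+ 2 * S ^+ 4) = (c * S) ^+ 4 * n%:R ^+ 2 by ring.
    rewrite -[leLHS]mulr1; apply: ler_wpM2l; last by rewrite exprn_ege1 ?ler1n.
    by rewrite exprn_ge0// !mulr_ge0// ltW.
  + by move: (hxi w); rewrite dataE.
- exact: h1.
Qed.

End arw_recovery.

(** * Growth rates in [p] and failure probabilities *)

Section asymptotics.
Context (R : realType).
Implicit Types (p : nat) (a b c M : R).

(** Powers of [p] are rewritten as exponentials so that exponents combine by [expRD]. *)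
Lemma powR_natE p a : (0 < p)%N -> (p%:R : R) `^ a = expR (a * ln p%:R).
Proof. by move=> p0; rewrite /powR pnatr_eq0 eqn0Ngt p0. Qed.

Lemma near_ln M : \forall p \near \oo, M <= ln (p%:R : R).
Proof.
near=> p.
have h : expR M <= p%:R by near: p; exact: nbhs_infty_ger.
by rewrite -[M]expRK ler_ln// ?posrE ?expR_gt0// (lt_le_trans (expR_gt0 M)).
Unshelve. all: by end_near. Qed.

Lemma near_expR c M : 0 < c -> \forall p \near \oo, M <= expR (c * ln (p%:R : R)).
Proof.
move=> c0; near=> p.
have : M / c <= ln (p%:R : R) by near: p; exact: near_ln.
by rewrite ler_pdivrMr// mulrC => h; apply: le_trans (expR_ge1Dx _); lra.
Unshelve. all: by end_near. Qed.

(** Splitting the exponent in two halves, each bounded below by [exp x >= 1 + x], gives growth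
    quadratic in [ln p]. *)
Lemma near_ln_expR c M : 0 < c ->
  \forall p \near \oo, M * ln (p%:R : R) <= expR (c * ln (p%:R : R)).
Proof.
move=> c0; near=> p.
have : 0 <= ln (p%:R : R) by near: p; exact: near_ln.
have : 4 * M / c ^+ 2 <= ln (p%:R : R) by near: p; exact: near_ln.
set L := ln _ => L2 L0.
have -> : c * L = c * L / 2 + c * L / 2 by lra.
rewrite expRD; have e1 : c * L / 2 <= expR (c * L / 2).
  by apply: le_trans (expR_ge1Dx _); lra.
have cL : 0 <= c * L / 2 by rewrite divr_ge0// mulr_ge0// ltW.
apply: (@le_trans _ _ ((c * L / 2) * (c * L / 2))); last exact: ler_pM.
move: L2; rewrite ler_pdivrMr ?exprn_gt0// => L2.
have : 4 * M * L <= L * c ^+ 2 * L by rewrite ler_wpM2r.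
by rewrite expr2; lra.
Unshelve. all: by end_near. Qed.

Lemma near_nsamples (theta : R) : 0 < theta <= 1 -> \forall p \near \oo,
  expR (theta * ln (p%:R : R)) / 2 <= (nsamples theta p)%:R <= expR (theta * ln (p%:R : R)) /\
  (nsamples theta p <= p)%N.
Proof.
move=> /andP[t0 t1]; near=> p.
have p0 : (0 < p)%N by near: p; exact: nbhs_infty_gt.
have p1 : 1 <= (p%:R : R) by rewrite ler1n.
have L0 : 0 <= ln (p%:R : R) by rewrite ln_ge0.
have h2 : 2 <= expR (theta * ln (p%:R : R)) by near: p; exact: near_expR.
have e0 := expR_ge0 (theta * ln (p%:R : R)).
rewrite /nsamples powR_natE//; have /andP[n1 n2] := truncn_itv e0.
split.
  by rewrite n1 andbT; move: n2; rewrite -natr1; lra.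
rewrite -(ler_nat R) (le_trans n1)// -[leRHS]lnK ?posrE ?ltr0n// ler_expR.
by rewrite -[leRHS]mul1r ler_wpM2r.
Unshelve. all: by end_near. Qed.

Lemma cvg_le_expR_ln (f : nat -> \bar R) (C c : R) : 0 < c ->
  (\forall p \near \oo, (0 <= f p <= (C * expR (- (c * ln p%:R)))%:E)%E) ->
  f @ \oo --> 0%E.
Proof.
move=> c0 hf.
have lim0 : (fun p : nat => C * expR (- (c * ln (p%:R : R)))) @ \oo --> (0 : R).
  apply/cvgrPdist_le => e e0; near=> p.
  have h : `|C| / e <= expR (c * ln (p%:R : R)) by near: p; exact: near_expR.
  rewrite sub0r normrN normrM (ger0_norm (expR_ge0 _)) expRN ler_pdivrMr ?expR_gt0//.
  by rewrite mulrC -ler_pdivrMr.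
apply: (@squeeze_cvge _ _ _ _ (fun=> 0%E) _ (fun p => (C * expR (- (c * ln (p%:R : R))))%:E)) => //.
  by apply: cvg_cst.
by apply: cvg_EFin; [near=> p|exact: lim0].
Unshelve. all: by end_near. Qed.

End asymptotics.

(** The chi-square tail at the threshold is of order [exp (- kap ^ 2 / (10 * n)) = p ^ (- 2 * q /
    5)]; with [q >= 3] the exponent is at least [6 / 5], more than any [beta < 1]. *)
Lemma whp_support_q_rate (R : realType) (d : measure_display) (T : measurableType d)
    (P : probability T R) (n p : nat) (alpha theta q eps L : R)
    (ell : 'I_n -> {RV P >-> R}) (mu : 'I_p -> {RV P >-> R})
    (Z : 'I_n -> 'I_p -> {RV P >-> R}) (j : 'I_p) :
  arw_model eps (expR (- (alpha * L))) ell mu Z -> L = ln p%:R -> 0 <= L ->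
  0 <= alpha -> 3 <= q -> 2 <= expR (theta * L) ->
  expR (theta * L) / 2 <= n%:R -> 32 * q * L <= expR (theta * L) ->
  100 * q * L <= expR ((theta - 4 * alpha) * L) ->
  whp P (4 * expR (- (6 / 5 * L)))
    (fun w => (j \in support_q q (arw_data ell mu Z w)) = (mu j w != 0)).
Proof.
move=> model LE L0 al0 q3 e1 n1 e2 e3.
pose t : R := Num.sqrt (2 * q * L).
have t0 : 0 <= t by rewrite sqrtr_ge0.
have t2 : t ^+ 2 = 2 * q * L.
  by rewrite sqr_sqrtr// !mulr_ge0// (le_trans _ q3).
have tauh : expR (theta * L) * expR (- (alpha * L)) ^+ 4 = expR ((theta - 4 * alpha) * L).
  by rewrite -expRM_natl -expRD; congr expR; ring.
have tau01 : 0 < expR (- (alpha * L)) <= 1.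
  by rewrite expR_gt0 -[leRHS]expR0 ler_expR oppr_le0 mulr_ge0.
set tau := expR (- (alpha * L)) in model tauh tau01 *.
have /andP[tau0 tau1] := tau01.
have n0 : 0 < (n%:R : R) by clear -e1 n1; lra.
have n0N : (0 < n)%N by rewrite -(ltr0n R).
pose s := Num.sqrt (n%:R : R).
have s0 : 0 < s by rewrite sqrtr_gt0.
have s2 : s ^+ 2 = n%:R by rewrite sqr_sqrtr// ltW.
have k2 : (Num.sqrt (2 * n%:R) * t) ^+ 2 = 2 * n%:R * (2 * q * L).
  by rewrite exprMn t2 sqr_sqrtr// mulr_ge0// ltW.
have tE : t = Num.sqrt (2 * q * ln p%:R) by rewrite -LE.
have h1 : Num.sqrt (2 * n%:R) <= 3 / 2 * s.
  rewrite -(@ler_pXn2r _ 2)// ?nnegrE ?mulr_ge0 ?sqrtr_ge0 ?(ltW s0)//.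
  by rewrite exprMn s2 sqr_sqrtr ?mulr_ge0 ?(ltW n0)// exprMn exprVn; clear -n0; lra.
(* The factor 5 covers [2 * kap <= 3 * s * t] and the cross term [2 * tau * s * t]. *)
have h2 : 5 * t <= s * tau ^+ 2.
  rewrite -(@ler_pXn2r _ 2)// ?nnegrE ?mulr_ge0 ?exprn_ge0 ?(ltW s0) ?(ltW tau0)//.
  rewrite [leLHS]exprMn [leRHS]exprMn t2 s2 -exprM.
  have h : expR (theta * L) / 2 * tau ^+ 4 <= n%:R * tau ^+ 4.
    by rewrite ler_wpM2r// exprn_ge0// ltW.
  by clear -h tauh e3; lra.
have kn : Num.sqrt (2 * n%:R) * t <= n%:R / 2.
  rewrite -(@ler_pXn2r _ 2)// ?nnegrE ?mulr_ge0 ?sqrtr_ge0 ?divr_ge0 ?(ltW n0)//.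
  rewrite k2; have h : n%:R * (16 * q * L) <= n%:R * n%:R.
    by rewrite ler_pM2l//; clear -e2 n1; lra.
  by rewrite exprMn exprVn !expr2; clear -h; lra.
have hk : 2 * (Num.sqrt (2 * n%:R) * t) + 2 * tau * (s * t) <= n%:R * tau ^+ 2.
  have h3 : Num.sqrt (2 * n%:R) * t <= 3 / 2 * s * t by rewrite ler_wpM2r.
  have h4 : tau * (s * t) <= 1 * (s * t) by rewrite ler_wpM2r// mulr_ge0// ltW.
  have h5 : s * (5 * t) <= n%:R * tau ^+ 2 by rewrite -s2 expr2 -mulrA ler_pM2l.
  by clear -h3 h4 h5; lra.
apply: (whp_weaken (whp_support_q model n0N tau01 j tE erefl kn hk)) => //.
rewrite k2 t2.
have -> : 2 * n%:R * (2 * q * L) / (10 * n%:R) = 2 / 5 * q * L by field; rewrite gt_eqF.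
have a1 : 3 * L <= q * L by rewrite ler_wpM2r.
have b1 : expR (- (2 / 5 * q * L)) <= expR (- (6 / 5 * L)) by rewrite ler_expR; clear -a1; lra.
have b2 : expR (- (2 * q * L / 2)) <= expR (- (6 / 5 * L)).
  by rewrite ler_expR; clear -a1 L0; lra.
by clear -b1 b2; lra.
Qed.

Lemma whp_support_sa_rate (R : realType) (d : measure_display) (T : measurableType d)
    (P : probability T R) (n p : nat) (alpha beta theta L : R)
    (ell : 'I_n -> {RV P >-> R}) (mu : 'I_p -> {RV P >-> R})
    (Z : 'I_n -> 'I_p -> {RV P >-> R}) (j : 'I_p) :
  arw_model (expR (- (beta * L))) (expR (- (alpha * L))) ell mu Z ->
  (0 < p)%N -> L = ln p%:R -> 0 <= L -> 0 <= alpha -> (n <= p)%N -> 2 <= expR (theta * L) ->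
  expR (theta * L) / 2 <= n%:R -> 16 * L <= expR ((theta - 2 * alpha) * L) ->
  64 * L <= expR ((1 - 2 * alpha - 2 * beta) * L) -> 6 * L <= expR ((1 - beta) * L) ->
  whp P (5 * expR (- L))
    (fun w => (j \in support_sa (arw_data ell mu Z w)) = (mu j w != 0)).
Proof.
move=> model p0 LE L0 al0 np e1 n1 e2 e3 e4.
pose t : R := Num.sqrt (2 * L).
(* With this [u] the noise level [u * sqrt p] equals [tau * p * eps / 4], the signal of a row sum
   when the number of signal columns is a quarter of its mean. *)
pose u : R := expR ((1 / 2 - alpha - beta) * L) / 4.
have pE : (p%:R : R) = expR L by rewrite LE lnK// posrE ltr0n.
have t0 : 0 <= t by rewrite sqrtr_ge0.
have t2 : t ^+ 2 = 2 * L by rewrite sqr_sqrtr// mulr_ge0.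
have u0 : 0 <= u by rewrite divr_ge0// expR_ge0.
have u2 : u ^+ 2 = expR ((1 - 2 * alpha - 2 * beta) * L) / 16.
  rewrite exprMn exprVn -expRM_natl (_ : 4 ^+ 2 = 16); last by ring.
  by congr (expR _ / _); field.
have tauh : expR (theta * L) * expR (- (alpha * L)) ^+ 2 = expR ((theta - 2 * alpha) * L).
  by rewrite -expRM_natl -expRD; congr expR; ring.
have pepsE : p%:R * expR (- (beta * L)) = expR ((1 - beta) * L).
  by rewrite pE -expRD; congr expR; ring.
have sp : Num.sqrt (p%:R : R) = expR (L / 2).
  have -> : (p%:R : R) = expR (L / 2) ^+ 2 by rewrite -expRM_natl mulrC divfK// -pE.
  by rewrite sqrtr_sqr ger0_norm// expR_ge0.
have uE : u * Num.sqrt p%:R = expR (- (alpha * L)) * (p%:R * expR (- (beta * L)) / 4).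
  by rewrite sp pepsE /u mulrAC mulrA -!expRD; congr (expR _ / _); field.
have tau01 : 0 < expR (- (alpha * L)) <= 1.
  by rewrite expR_gt0 -[leRHS]expR0 ler_expR oppr_le0 mulr_ge0.
set tau := expR (- (alpha * L)) in model tauh uE tau01 *.
have /andP[tau0 tau1] := tau01.
have n0N : (0 < n)%N by rewrite -(ltr0n R); clear -e1 n1; lra.
have npR : (n%:R : R) <= expR L by rewrite -pE ler_nat.
have tE : t = Num.sqrt (2 * ln p%:R) by rewrite -LE.
have ht : 2 * t <= Num.sqrt n%:R * tau.
  rewrite -(@ler_pXn2r _ 2)// ?nnegrE ?mulr_ge0 ?sqrtr_ge0 ?(ltW tau0)//.
  rewrite [leLHS]exprMn [leRHS]exprMn t2 sqr_sqrtr//.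
  have h : expR (theta * L) / 2 * tau ^+ 2 <= n%:R * tau ^+ 2.
    by rewrite ler_wpM2r// exprn_ge0// ltW.
  by clear -h tauh e2; lra.
have hu : u * Num.sqrt p%:R <= tau * (p%:R * expR (- (beta * L)) / 4) by rewrite uE.
apply: (whp_weaken (whp_support_sa model n0N p0 tau01 j tE ht u0 hu)) => //.
rewrite t2 u2 pepsE.
have b1 : expR (- (2 * L / 2)) = expR (- L) by congr expR; field.
(* Here [u ^ 2 / 2 >= 2 * L], and the union over at most [p] rows gives back one [L]. *)
have b2 : n%:R * (2 * expR (- (expR ((1 - 2 * alpha - 2 * beta) * L) / 16 / 2)))
    <= 2 * expR (- L).
  rewrite mulrCA ler_pM2l//; apply: (@le_trans _ _ (expR L * expR (- (2 * L)))).
    by apply: ler_pM; rewrite ?expR_ge0// ler_expR; clear -e3; lra.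
  by rewrite -expRD ler_expR; clear; lra.
have b3 : expR (- (expR ((1 - beta) * L) / 6)) <= expR (- L).
  by rewrite ler_expR; clear -e4; lra.
by rewrite b1; clear -b2 b3; lra.
Qed.

(** The net has at most [exp (6 * n * L)] points. The choice [kap ^ 2 = n * p * D ^ 2] gives each a
    failure probability of order [exp (- n * D ^ 2 / 10)], at most [exp (- 24 * n * L)] since
    [D ^ 2 >= 240 * L]. The other union bounds set a power of [p] against [exp (- D ^ 2 / 2)]. *)
Lemma support_if_failure_le (R : realType) (n p : nat) (t D kap eps L : R) :
  (8 <= n)%N -> (n <= p)%N -> 19 <= p%:R :> R -> p%:R = expR L :> R -> 0 <= L ->
  t ^+ 2 = 2 * L -> 240 * L <= D ^+ 2 -> kap ^+ 2 = n%:R * p%:R * D ^+ 2 ->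
  6 * L <= p%:R * eps ->
  2 * expR (- (t ^+ 2 / 2)) + (expR (- (p%:R * eps / 6)) +
      ((n%:R * (p%:R * (2 * expR (- (D ^+ 2 / 2)))) +
        ((2 * (9 * p ^ 5)).+1 ^ n)%:R * (2 * expR (- (kap ^+ 2 / (10 * p%:R))))) +
      (n%:R * (2 * expR (- (D ^+ 2 / 2))) +
       n%:R * (((13 * p) ^ 4)%:R * (2 * expR (- (D ^+ 2 / 2))))))) <= 11 * expR (- L).
Proof.
move=> n8 np p19 pE L0 t2 hD k2 f7; rewrite t2 k2.
set z := expR (- (D ^+ 2 / 2)).
have npR : (n%:R : R) <= expR L by rewrite -pE ler_nat.
have n8R : 8 <= (n%:R : R) by rewrite ler_nat.
have n0 : 0 <= (n%:R : R) by rewrite ler0n.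
have b1 : expR (- (2 * L / 2)) = expR (- L) by congr expR; field.
have b2 : expR (- (p%:R * eps / 6)) <= expR (- L).
  by rewrite ler_expR; clear -f7; lra.
have z12 : z <= expR (- (12 * L)) by rewrite ler_expR; clear -L0 hD; lra.
have z0 : 0 <= z by rewrite expR_ge0.
have eL : expR L * expR (- (12 * L)) <= expR (- L).
  by rewrite -expRD ler_expR; clear -L0; lra.
have b3 : n%:R * (2 * z) <= 2 * expR (- L).
  have h : n%:R * z <= expR L * expR (- (12 * L)) by apply: ler_pM.
  by clear -h eL; lra.
have b4 : n%:R * (p%:R * (2 * z)) <= 2 * expR (- L).
  have h : n%:R * (p%:R * z) <= expR L * (expR L * expR (- (12 * L))).
    rewrite pE; apply: ler_pM => //; first by rewrite mulr_ge0 ?expR_ge0.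
    by apply: ler_pM; rewrite ?expR_ge0.
  have h' : expR L * (expR L * expR (- (12 * L))) <= expR (- L).
    by rewrite -!expRD ler_expR; clear -L0; lra.
  by clear -h h'; lra.
have b5 : n%:R * (((13 * p) ^ 4)%:R * (2 * z)) <= 2 * expR (- L).
  have h13 : ((13 * p) ^ 4)%:R <= expR (8 * L).
    rewrite natrX natrM.
    have -> : expR (8 * L) = (p%:R * p%:R) ^+ 4.
      by rewrite pE -expRD -expRM_natl; congr expR; ring.
    apply: lerXn2r; rewrite ?nnegrE ?mulr_ge0//; apply: ler_wpM2r => //.
    by apply: le_trans p19; rewrite ler_nat.
  have h : n%:R * (((13 * p) ^ 4)%:R * z) <= expR L * (expR (8 * L) * expR (- (12 * L))).
    by apply: ler_pM => //; [rewrite mulr_ge0|apply: ler_pM].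
  have h' : expR L * (expR (8 * L) * expR (- (12 * L))) <= expR (- L).
    by rewrite -!expRD ler_expR; clear -L0; lra.
  by clear -h h'; lra.
have b6 : ((2 * (9 * p ^ 5)).+1 ^ n)%:R * (2 * expR (- (n%:R * p%:R * D ^+ 2 / (10 * p%:R))))
    <= 2 * expR (- L).
  (* [2 * (9 * p ^ 5) + 1 <= 19 * p ^ 5 <= p ^ 6], whence the constant 19. *)
  have hb6 : ((2 * (9 * p ^ 5)).+1)%:R <= expR (6 * L).
    rewrite -natr1 natrM (natrM _ 9) natrX.
    have -> : expR (6 * L) = p%:R * p%:R ^+ 5.
      by rewrite [in RHS]pE -expRM_natl -expRD; congr expR; ring.
    have p5 : 1 <= (p%:R : R) ^+ 5 by rewrite exprn_ege1//; clear -p19; lra.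
    have h : 19 * p%:R ^+ 5 <= p%:R * p%:R ^+ 5 :> R by rewrite ler_wpM2r// exprn_ge0.
    by clear -h p5; lra.
  have hn6 : ((2 * (9 * p ^ 5)).+1 ^ n)%:R <= expR (n%:R * (6 * L)).
    by rewrite natrX expRM_natl; apply: lerXn2r; rewrite ?nnegrE ?expR_ge0.
  have -> : n%:R * p%:R * D ^+ 2 / (10 * p%:R) = n%:R * (D ^+ 2 / 10).
    by field; rewrite gt_eqF// pE expR_gt0.
  have hnD : n%:R * (24 * L) <= n%:R * (D ^+ 2 / 10) by rewrite ler_wpM2l//; clear -hD; lra.
  rewrite mulrCA ler_pM2l//.
  apply: (@le_trans _ _ (expR (n%:R * (6 * L)) * expR (- (n%:R * (24 * L))))).
    by apply: ler_pM; rewrite ?expR_ge0// ler_expR; clear -hnD; lra.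
  rewrite -expRD ler_expR; have h : 8 * L <= n%:R * L by rewrite ler_wpM2r.
  by clear -h L0; lra.
by rewrite b1; clear -b2 b3 b4 b5 b6; lra.
Qed.

Lemma whp_support_if_rate (R : realType) (d : measure_display) (T : measurableType d)
    (P : probability T R) (n p : nat) (alpha beta theta del L : R)
    (ell : 'I_n -> {RV P >-> R}) (mu : 'I_p -> {RV P >-> R})
    (Z : 'I_n -> 'I_p -> {RV P >-> R}) (xi : 'I_n -> {RV P >-> R}) (j : 'I_p) :
  arw_model (expR (- (beta * L))) (expR (- (alpha * L))) ell mu Z ->
  (forall w, first_left_singular_vector (arw_data ell mu Z w) (\col_i xi i w)) ->
  (n <= p)%N -> L = ln p%:R -> 0 <= L -> 19 <= p%:R :> R -> 0 <= alpha -> 0 <= theta ->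
  0 < del -> del <= (1 - theta) / 2 -> 16 <= expR (theta * L) ->
  expR (theta * L) / 2 <= n%:R <= expR (theta * L) ->
  16 * L <= expR ((theta - 2 * alpha) * L) ->
  2 <= expR (((1 - theta) / 2 - del) * L) ->
  128 <= expR (((1 - beta - 2 * alpha) / 2 - del) * L) ->
  512 <= expR ((theta / 2 + 1 / 2 - beta - 2 * alpha - del) * L) ->
  240 * L <= expR (2 * del * L) -> 6 * L <= expR ((1 - beta) * L) ->
  whp P (11 * expR (- L))
    (fun w => (j \in support_if (\col_i xi i w) (arw_data ell mu Z w)) = (mu j w != 0)).
Proof.
move=> model hxi np LE L0 p19 al0 th0 del0 d1 f1 /andP[n1 n2] f2 f3 f4 f5 f6 f7.
(* As exponents of [p], [A1] is the size of [sqrt (p / n)], [A2] that of [|mu|] and [A3] that of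
   [|mu| ^ 2 * sqrt (n / p)]. Each must exceed [del], the size of [D]. *)
set A1 := (1 - theta) / 2 in d1 f3; set A2 := (1 - beta - 2 * alpha) / 2 in f4.
pose A3 := theta / 2 + 1 / 2 - beta - 2 * alpha; rewrite -/A3 in f5.
have p0 : (0 < p)%N by rewrite -(ltr0n R); clear -p19; lra.
pose t : R := Num.sqrt (2 * L).
pose D : R := expR (del * L).
pose r : R := Num.sqrt n%:R.
pose kap : R := r * Num.sqrt p%:R * D.
have pE : (p%:R : R) = expR L by rewrite LE lnK// posrE ltr0n.
have D2 : D ^+ 2 = expR (2 * del * L) by rewrite /D -expRM_natl; congr expR; ring.
have tauh : expR (theta * L) * expR (- (alpha * L)) ^+ 2 = expR ((theta - 2 * alpha) * L).
  by rewrite -expRM_natl -expRD; congr expR; ring.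
have pepsE : p%:R * expR (- (beta * L)) = expR ((1 - beta) * L).
  by rewrite pE -expRD; congr expR; ring.
have sE : (expR (A2 * L) / 2) ^+ 2 = expR (- (alpha * L)) ^+ 2 * (p%:R * expR (- (beta * L)) / 4).
  rewrite pepsE -expRM_natl exprMn exprVn -expRM_natl mulrA -expRD.
  rewrite (_ : 2 ^+ 2 = 4); last by ring.
  by congr (expR _ / _); rewrite /A2; field.
have sp : Num.sqrt (p%:R : R) = expR (L / 2).
  have -> : (p%:R : R) = expR (L / 2) ^+ 2 by rewrite -expRM_natl mulrC divfK// -pE.
  by rewrite sqrtr_sqr ger0_norm// expR_ge0.
have tau01 : 0 < expR (- (alpha * L)) <= 1.
  by rewrite expR_gt0 -[leRHS]expR0 ler_expR oppr_le0 mulr_ge0.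
have eps0 : 0 < expR (- (beta * L)) by exact: expR_gt0.
set tau := expR (- (alpha * L)) in model tauh sE tau01 *.
set eps := expR (- (beta * L)) in model pepsE sE eps0 *.
have /andP[tau0 tau1] := tau01.
have t2 : t ^+ 2 = 2 * L by rewrite sqr_sqrtr// mulr_ge0.
have tE : t = Num.sqrt (2 * ln p%:R) by rewrite -LE.
have n8 : 8 <= (n%:R : R) by clear -f1 n1; lra.
have n8N : (8 <= n)%N by rewrite -(ler_nat R).
have n0N : (0 < n)%N by apply: leq_trans n8N.
have r2 : r ^+ 2 = n%:R by rewrite sqr_sqrtr ?ler0n.
have r0 : 0 <= r by exact: sqrtr_ge0.
have eth : expR (theta / 2 * L) ^+ 2 = expR (theta * L).
  by rewrite -expRM_natl; congr expR; field.
have rlo : expR (theta / 2 * L) / 2 <= r.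
  rewrite -(@ler_pXn2r _ 2)// ?nnegrE ?divr_ge0 ?expR_ge0// r2 exprMn exprVn eth.
  by clear -f1 n1; lra.
have rhi : r <= expR (theta / 2 * L).
  by rewrite -(@ler_pXn2r _ 2)// ?nnegrE ?expR_ge0// r2 eth.
have D1 : 1 <= D by rewrite -[leLHS]expR0 ler_expR mulr_ge0// ltW.
have Dgt0 : 0 < D by exact: expR_gt0.
have k2 : kap ^+ 2 = n%:R * p%:R * D ^+ 2 by rewrite /kap !exprMn r2 sqr_sqrtr.
have kap0 : 0 <= kap by rewrite !mulr_ge0 ?sqrtr_ge0 ?expR_ge0.
(* Spike against noise, as [64 * sqrt p * D <= sqrt n * s]. Multiplied by [sqrt n] it gives [ks],
   squared it gives [Dps]. *)
have key : 64 * (expR (L / 2) * D) <= r * (expR (A2 * L) / 2) ^+ 2.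
  have h1 : expR (A3 * L) = expR (theta / 2 * L) * expR (A2 * L) ^+ 2 * expR (- (L / 2)).
    by rewrite -expRM_natl -!expRD; congr expR; rewrite /A3 /A2; field.
  have h2 : expR ((A3 - del) * L) * D = expR (A3 * L).
    by rewrite -expRD; congr expR; ring.
  have h3 : 512 * D <= expR (A3 * L) by rewrite -h2 ler_pM2r.
  have h4 : expR (L / 2) * (512 * D) <= expR (theta / 2 * L) * expR (A2 * L) ^+ 2.
    apply: (@le_trans _ _ (expR (L / 2) * expR (A3 * L))); first by rewrite ler_pM2l ?expR_gt0.
    by rewrite h1 mulrCA -expRD subrr expR0 mulr1.
  have h5 : expR (theta / 2 * L) / 2 * expR (A2 * L) ^+ 2 <= r * expR (A2 * L) ^+ 2.
    by rewrite ler_wpM2r// sqr_ge0.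
  by rewrite exprMn exprVn; clear -h4 h5; lra.
have ht : 2 * t <= Num.sqrt n%:R * tau.
  rewrite -(@ler_pXn2r _ 2)// ?nnegrE ?mulr_ge0 ?sqrtr_ge0 ?(ltW tau0)//.
  rewrite [leLHS]exprMn [leRHS]exprMn t2 r2.
  have h : expR (theta * L) / 2 * tau ^+ 2 <= n%:R * tau ^+ 2.
    by rewrite ler_wpM2r// exprn_ge0// ltW.
  by clear -h f2 tauh; lra.
have hD : 1 <= D <= p%:R.
  by rewrite D1 pE ler_expR -[leRHS]mul1r ler_wpM2r//; clear -d1 th0; rewrite /A1 in d1; lra.
have hkap : 1 <= kap <= p%:R / 2.
  apply/andP; split.
    rewrite -(@ler_pXn2r _ 2)// ?nnegrE// k2 expr1n -[leLHS]mulr1.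
    apply: ler_pM => //; last by rewrite exprn_ege1.
    by rewrite -[leLHS]mulr1; apply: ler_pM; rewrite ?ler1n.
  rewrite /kap sp pE.
  have h1 : expR L = expR (theta / 2 * L) * expR (A1 * L) * expR (L / 2).
    by rewrite -!expRD; congr expR; rewrite /A1; field.
  have h2 : expR ((A1 - del) * L) * D = expR (A1 * L) by rewrite -expRD; congr expR; ring.
  have h3 : 2 * D <= expR (A1 * L) by rewrite -h2 ler_pM2r.
  have h4 : r * expR (L / 2) * (2 * D) <= expR (theta / 2 * L) * expR (L / 2) * expR (A1 * L).
    apply: ler_pM => //; rewrite ?mulr_ge0 ?expR_ge0 ?(ltW Dgt0)//.
    by rewrite ler_pM2r// expR_gt0.
  by rewrite h1; clear -h4; lra.
have sD : 64 * D <= Num.sqrt ((expR (A2 * L) / 2) ^+ 2).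
  rewrite sqrtr_sqr ger0_norm ?divr_ge0 ?expR_ge0//.
  have h2 : expR ((A2 - del) * L) * D = expR (A2 * L) by rewrite -expRD; congr expR; ring.
  have h3 : 128 * D <= expR (A2 * L) by rewrite -h2 ler_pM2r.
  by clear -h3; lra.
have ks : 64 * kap <= n%:R * (expR (A2 * L) / 2) ^+ 2.
  rewrite /kap sp -r2.
  have h : r * (64 * (expR (L / 2) * D)) <= r * (r * (expR (A2 * L) / 2) ^+ 2).
    by rewrite ler_wpM2l.
  by rewrite expr2; clear -h; lra.
have Dps : 32 * D ^+ 2 * p%:R <= ((expR (A2 * L) / 2) ^+ 2) ^+ 2 * n%:R.
  rewrite -r2 pE; have -> : expR L = expR (L / 2) ^+ 2 by rewrite -expRM_natl mulrC divfK.
  have q0 : 0 <= 64 * (expR (L / 2) * D) by rewrite !mulr_ge0 ?expR_ge0.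
  have r20 : 0 <= r * (expR (A2 * L) / 2) ^+ 2 by rewrite mulr_ge0 ?sqr_ge0.
  have h : (64 * (expR (L / 2) * D)) ^+ 2 <= (r * (expR (A2 * L) / 2) ^+ 2) ^+ 2.
    exact: lerXn2r q0 r20 key.
  have -> : ((expR (A2 * L) / 2) ^+ 2) ^+ 2 * r ^+ 2 = (r * (expR (A2 * L) / 2) ^+ 2) ^+ 2 by ring.
  have -> : 32 * D ^+ 2 * expR (L / 2) ^+ 2 = 32 * (expR (L / 2) * D) ^+ 2 by ring.
  apply: le_trans h; rewrite exprMn; have := sqr_ge0 (expR (L / 2) * D).
  by clear; lra.
apply: (whp_weaken (whp_support_if model n0N p0 eps0 tau01 j hxi tE ht n8N np hD hkap sE sD ks Dps)) => //.
by apply: support_if_failure_le => //; rewrite ?D2 ?pepsE.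
Qed.

Unset Implicit Arguments.

(** * Limits of the Hamming loss *)

Section arw_limits.
Context (R : realType) (alpha beta theta : R).
Context (d : nat -> measure_display) (T : forall p, measurableType (d p)).
Context (P : forall p, probability (T p) R).
Context (ell : forall p, 'I_(nsamples theta p) -> {RV (P p) >-> R})
  (mu : forall p, 'I_p -> {RV (P p) >-> R})
  (Z : forall p, 'I_(nsamples theta p) -> 'I_p -> {RV (P p) >-> R}).
Hypothesis model : forall p, (0 < p)%N ->
  arw_model (epsilon beta p) (tau alpha p) (ell p) (mu p) (Z p).
Hypotheses (halpha : 0 < alpha < 1) (hbeta : 0 < beta < 1) (htheta : 0 < theta < 1).

(* The loss is normalised by [p * epsilon], so each column may fail with probability
   [o (epsilon) = o (p ^ (- beta))]. *)
Lemma hamm_cvg0 (S : forall p, T p -> {set 'I_p}) (c : nat -> R) (C b : R) : beta < b ->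
  (\forall p \near \oo, (forall j, whp (P p) (c p) (fun w => (j \in S p w) = (mu p j w != 0)))
     /\ c p <= C * expR (- (b * ln p%:R))) ->
  (fun p => hamm (epsilon beta p) (mu p) (S p)) @ \oo --> 0%E.
Proof.
move=> bb h; apply: (@cvg_le_expR_ln R _ C (b - beta)); first by rewrite subr_gt0.
near=> p.
have p0 : (0 < p)%N by near: p; exact: nbhs_infty_gt.
have [hw hc] : (forall j, whp (P p) (c p) (fun w => (j \in S p w) = (mu p j w != 0)))
     /\ c p <= C * expR (- (b * ln p%:R)) by near: p.
have epsE : epsilon beta p = expR (- (beta * ln p%:R)) by rewrite /epsilon powR_natE// mulNr.
have e0 : 0 < epsilon beta p by rewrite epsE expR_gt0.
have /andP[h0 h1] := hamm_le p0 e0 hw.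
rewrite h0 (le_trans h1)// lee_fin epsE -expRN opprK mulrBl opprB expRD mulrA mulrAC.
by rewrite ler_wpM2r ?expR_ge0.
Unshelve. all: by end_near. Qed.

Let model_ln p : (0 < p)%N ->
  arw_model (expR (- (beta * ln p%:R))) (expR (- (alpha * ln p%:R))) (ell p) (mu p) (Z p).
Proof. by move=> p0; have := model p p0; rewrite /epsilon /tau !powR_natE// !mulNr. Qed.

Lemma support_q_limit (q : R) : alpha < theta / 4 -> 3 <= q ->
  (fun p => hamm (epsilon beta p) (mu p)
     (fun w => support_q q (arw_data (ell p) (mu p) (Z p) w))) @ \oo --> 0%E.
Proof.
move=> hsig q3; have /andP[al0 _] := halpha; have /andP[_ be1] := hbeta.
have /andP[th0 th1] := htheta; have th01 : 0 < theta <= 1 by rewrite th0 ltW.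
have c1 : 0 < theta - 4 * alpha by lra.
have b65 : beta < 6 / 5 by lra.
apply: (@hamm_cvg0 _ (fun p => 4 * expR (- (6 / 5 * ln p%:R))) 4 (6 / 5)) => //.
near=> p; split => // j.
have p0 : (0 < p)%N by near: p; exact: nbhs_infty_gt.
have L0 : 0 <= ln (p%:R : R) by near: p; exact: near_ln.
have [/andP[n1 _] _] : expR (theta * ln (p%:R : R)) / 2 <= (nsamples theta p)%:R
    <= expR (theta * ln (p%:R : R)) /\ (nsamples theta p <= p)%N.
  by near: p; exact: near_nsamples.
apply: (whp_support_q_rate j (model_ln p p0) erefl L0 (ltW al0) q3 _ n1).
- by near: p; exact: near_expR.
- by near: p; exact: near_ln_expR.
- by near: p; exact: near_ln_expR.
Unshelve. all: by end_near. Qed.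

Lemma support_sa_limit : alpha < theta / 2 -> beta < (1 - theta) / 2 ->
  (fun p => hamm (epsilon beta p) (mu p)
     (fun w => support_sa (arw_data (ell p) (mu p) (Z p) w))) @ \oo --> 0%E.
Proof.
move=> hsig hb; have /andP[al0 _] := halpha; have /andP[_ be1] := hbeta.
have /andP[th0 th1] := htheta; have th01 : 0 < theta <= 1 by rewrite th0 ltW.
have c1 : 0 < theta - 2 * alpha by lra.
(* [alpha + beta < 1 / 2]: the summed means, of order [p * eps * tau], dominate the noise [sqrt p]
   of a row sum. *)
have c2 : 0 < 1 - 2 * alpha - 2 * beta by lra.
have c3 : 0 < 1 - beta by lra.
apply: (@hamm_cvg0 _ (fun p => 5 * expR (- ln p%:R)) 5 1) => //.
near=> p; split => [j|]; last by rewrite mul1r.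
have p0 : (0 < p)%N by near: p; exact: nbhs_infty_gt.
have L0 : 0 <= ln (p%:R : R) by near: p; exact: near_ln.
have [/andP[n1 _] np] : expR (theta * ln (p%:R : R)) / 2 <= (nsamples theta p)%:R
    <= expR (theta * ln (p%:R : R)) /\ (nsamples theta p <= p)%N.
  by near: p; exact: near_nsamples.
apply: (whp_support_sa_rate j (model_ln p p0) p0 erefl L0 (ltW al0) np _ n1).
- by near: p; exact: near_expR.
- by near: p; exact: near_ln_expR.
- by near: p; exact: near_ln_expR.
- by near: p; exact: near_ln_expR.
Unshelve. all: by end_near. Qed.

Lemma support_if_limit (xi : forall p, 'I_(nsamples theta p) -> {RV (P p) >-> R}) :
  alpha < (1 + theta - 2 * beta) / 4 -> (1 - theta) / 2 < beta ->
  (forall p, (0 < p)%N -> forall w,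
     first_left_singular_vector (arw_data (ell p) (mu p) (Z p) w) (\col_i xi p i w)) ->
  (fun p => hamm (epsilon beta p) (mu p)
     (fun w => support_if (\col_i xi p i w) (arw_data (ell p) (mu p) (Z p) w))) @ \oo --> 0%E.
Proof.
move=> hsig hb hxi; have /andP[al0 _] := halpha; have /andP[_ be1] := hbeta.
have /andP[th0 th1] := htheta; have th01 : 0 < theta <= 1 by rewrite th0 ltW.
pose A1 := (1 - theta) / 2; pose A2 := (1 - beta - 2 * alpha) / 2.
pose A3 := theta / 2 + 1 / 2 - beta - 2 * alpha.
(* The estimates below use [D = p ^ del] as a bound for every Gaussian in play, which fails with
   probability [exp (- D ^ 2 / 2)], smaller than any power of [p]. *)
have [del [del0 [d1 [d2 d3]]]] : exists del, 0 < del /\ del < A1 /\ del < A2 /\ del < A3.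
  pose mn := Num.min A1 (Num.min A2 A3).
  (* [A3 > 0] restates [hsig], and [A2 > 0] follows from [2 * A2 = A1 + A3]. *)
  have mn0 : 0 < mn by rewrite !lt_min /A1 /A2 /A3; apply/and3P; split; lra.
  have : mn <= A1 by rewrite ge_min lexx.
  have : mn <= A2 by rewrite !ge_min lexx orbT.
  have : mn <= A3 by rewrite !ge_min lexx !orbT.
  by exists (mn / 2); lra.
have c1 : 0 < theta - 2 * alpha by lra.
have c2 : 0 < 1 - beta by lra.
have c3 : 0 < 2 * del by rewrite mulr_gt0.
apply: (@hamm_cvg0 _ (fun p => 11 * expR (- ln p%:R)) 11 1) => //.
near=> p; split => [j|]; last by rewrite mul1r.
have p0 : (0 < p)%N by near: p; exact: nbhs_infty_gt.
have p19 : 19 <= (p%:R : R) by near: p; exact: nbhs_infty_ger.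
have L0 : 0 <= ln (p%:R : R) by near: p; exact: near_ln.
have [hn np] : expR (theta * ln (p%:R : R)) / 2 <= (nsamples theta p)%:R
    <= expR (theta * ln (p%:R : R)) /\ (nsamples theta p <= p)%N.
  by near: p; exact: near_nsamples.
apply: (whp_support_if_rate j (model_ln p p0) (hxi p p0) np erefl L0 p19 (ltW al0) (ltW th0)
  del0 (ltW d1) _ hn).
- by near: p; exact: near_expR.
- by near: p; exact: near_ln_expR.
- by near: p; apply: near_expR; rewrite subr_gt0.
- by near: p; apply: near_expR; rewrite subr_gt0.
- by near: p; apply: near_expR; rewrite subr_gt0.
- by near: p; exact: near_ln_expR.
- by near: p; exact: near_ln_expR.
Unshelve. all: by end_near. Qed.

End arw_limits.

Theorem theorem3p3 (R : realType) (alpha beta theta : R)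
  (halpha : 0 < alpha < 1) (hbeta : 0 < beta < 1) (htheta : 0 < theta < 1)
  (hsig : alpha < eta_sig theta beta)
  (d : nat -> measure_display) (T : forall p, measurableType (d p))
  (P : forall p, probability (T p) R)
  (ell : forall p, 'I_(nsamples theta p) -> {RV (P p) >-> R})
  (mu : forall p, 'I_p -> {RV (P p) >-> R})
  (Z : forall p, 'I_(nsamples theta p) -> 'I_p -> {RV (P p) >-> R})
  (hmodel : forall p, (0 < p)%N ->
    arw_model (epsilon beta p) (tau alpha p) (ell p) (mu p) (Z p)) :
  [/\ 0 < beta < (1 - theta) / 2 ->
      (fun p => hamm (epsilon beta p) (mu p)
         (fun w => support_sa (arw_data (ell p) (mu p) (Z p) w))) @ \oo
        --> 0%E,
      (1 - theta) / 2 < beta < 1 / 2 ->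
      forall xi : forall p, 'I_(nsamples theta p) -> {RV (P p) >-> R},
      (forall p, (0 < p)%N -> forall w,
         first_left_singular_vector (arw_data (ell p) (mu p) (Z p) w)
           (\col_i xi p i w)) ->
      (fun p => hamm (epsilon beta p) (mu p)
         (fun w => support_if (\col_i xi p i w)
                     (arw_data (ell p) (mu p) (Z p) w))) @ \oo
        --> 0%E
    & 1 / 2 < beta < 1 -> forall q : R, 3 <= q ->
      (fun p => hamm (epsilon beta p) (mu p)
         (fun w => support_q q (arw_data (ell p) (mu p) (Z p) w))) @ \oo
        --> 0%E].
Proof.
move: hsig; rewrite /eta_sig => hsig; split.
- move=> /andP[_ hb]; move: hsig; rewrite ltW// => hsig.
  exact: support_sa_limit hmodel halpha hbeta htheta hsig hb.
- move=> /andP[hb hb2] xi hxi; move: hsig; rewrite leNgt hb/= ltW// => hsig.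
  exact: support_if_limit hmodel halpha hbeta htheta xi hsig hb hxi.
move=> /andP[hb _] q q3; move: hsig.
have h1 : (1 - theta) / 2 < beta by move: htheta hb => /andP[th0 _] hb; lra.
rewrite leNgt h1/= leNgt hb/= => hsig.
exact: support_q_limit hmodel halpha hbeta htheta _ hsig q3.
Qed.
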